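(* Let $X_1,\dots,X_n$ be bounded real random variables on a probability space $(\Omega,\mathbb{P})$. Then, as an identity in $[-\infty,\infty)$, $$H(X_1,\dots,X_n)=-I_{\mathrm{sym}}(X_1,\dots,X_n)+\sum_{i=1}^nH(X_i)=-\overline{I}_{\mathrm{sym}}(X_1,\dots,X_n)+\sum_{i=1}^nH(X_i).$$
   Context: Entropy. For bounded real random variables $X_1,\dots,X_n$ (i.e. $X_i\in L^\infty(\Omega;\mathbb{P})$), the Boltzmann-Gibbs entropy is $H(X_1,\dots,X_n):=-\int_{\mathbb{R}^n}p\log p\,dx_1\cdots dx_n$ if $(X_1,\dots,X_n)$ has a joint density $p$ with respect to Lebesgue measure, and $H(X_1,\dots,X_n):=-\infty$ otherwise. Its value lies in $[-\infty,\infty)$. $H(X_i)$ is the case of one variable. Micro-states. $\mathbb{R}_\le^N$ is the set of $\mathbf{x}=(x_1,\dots,x_N)\in\mathbb{R}^N$ with $x_1\le\dots\le x_N$. $\mathbb{R}^N$ is an algebra under the pointwise product, and $\kappa_N(\mathbf{x}):=\frac1N\sum_{j=1}^Nx_j$. $\mathbb{E}$ is the expectation on $(\Omega,\mathbb{P})$. For $N,m\in\mathbb{N}$, $\delta>0$, let $\Delta(X_1,\dots,X_n;N,m,\delta)$ be the set of $(\mathbf{x}_1,\dots,\mathbf{x}_n)\in(\mathbb{R}^N)^n$ such that $$|\kappa_N(\mathbf{x}_{i_1}\cdots\mathbf{x}_{i_k})-\mathbb{E}(X_{i_1}\cdots X_{i_k})|<\delta$$ for all $1\le i_1,\dots,i_k\le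 n$ and $1\le k\le m$. For $R>0$ let $\Delta_R(X_1,\dots,X_n;N,m,\delta)$ be the subset of those with $\mathbf{x}_i\in[-R,R]^N$ for all $i$; put $\Delta_\infty:=\Delta$. Permutations. $S_N$ is the group of permutations of $\{1,\dots,N\}$, acting on $\mathbb{R}^N$ by $\sigma(\mathbf{x}):=(x_{\sigma^{-1}(1)},\dots,x_{\sigma^{-1}(N)})$; $\gamma_{S_N}$ is the uniform probability measure on $S_N$, and $\gamma_{S_N}^{\otimes n}$ the product measure on $S_N^n$. For $R\in(0,\infty]$, $\Delta_{\mathrm{sym},R}(X_1,\dots,X_n;N,m,\delta)$ is the set of $(\sigma_1,\dots,\sigma_n)\in S_N^n$ such that $(\sigma_1(\mathbf{x}_1),\dots,\sigma_n(\mathbf{x}_n))\in\Delta_R(X_1,\dots,X_n;N,m,\delta)$ for some $(\mathbf{x}_1,\dots,\mathbf{x}_n)\in(\mathbb{R}_\le^N)^n$. Define (with $\log0=-\infty$) $$I_{\mathrm{sym},R}(X_1,\dots,X_n):=-\lim_{m\to\infty,\delta\searrow0}\limsup_{N\to\infty}\frac1N\log\gamma_{S_N}^{\otimes n}\bigl(\Delta_{\mathrm{sym},R}(X_1,\dots,X_n;N,m,\delta)\bigr),$$ and $\overline{I}_{\mathrm{sym},R}(X_1,\dots,X_n)$ by replacing $\limsup$ by $\liminf$. (The inner quantity is nonincreasing in $m$ and nondecreasing in $\delta$, so the limit exists in $[-\infty,0]$; values of $I$ lie in $[0,\infty]$.) Also, for each $i$ let $\xi_i=\{\xi_i(N)\}_{N\in\mathbb{N}}$,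 $\xi_i(N)\in\mathbb{R}_\le^N$, be a sequence with $\kappa_N(\xi_i(N)^k)\to\mathbb{E}(X_i^k)$ as $N\to\infty$ for all $k\in\mathbb{N}$. $I_{\mathrm{sym}}(X_1,\dots,X_n:\xi_1,\dots,\xi_n)$ and $\overline{I}_{\mathrm{sym}}(X_1,\dots,X_n:\xi_1,\dots,\xi_n)$ are defined by the same formulas with the set of $(\sigma_1,\dots,\sigma_n)\in S_N^n$ such that $(\sigma_1(\xi_1(N)),\dots,\sigma_n(\xi_n(N)))\in\Delta(X_1,\dots,X_n;N,m,\delta)$ in place of $\Delta_{\mathrm{sym},R}$. The paper shows that $I_{\mathrm{sym},\infty}$, $I_{\mathrm{sym},R}$ for any $R>0$ with $R\ge\max_i\|X_i\|_\infty$, and $I_{\mathrm{sym}}(\,\cdot:\xi_1,\dots,\xi_n)$ for any such $\xi_i$ all coincide; the common value is denoted $I_{\mathrm{sym}}(X_1,\dots,X_n)$. Likewise for the barred quantities, with common value $\overline{I}_{\mathrm{sym}}(X_1,\dots,X_n)$. *)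

(* Defs.v *)
From HB Require Import structures.
From mathcomp Require Import all_boot all_order all_algebra fingroup perm.
From mathcomp Require Import all_classical all_reals all_analysis.
Set Implicit Arguments.
Unset Strict Implicit.
Unset Printing Implicit Defensive.
Import Order.TTheory GRing.Theory Num.Theory.
Import numFieldNormedType.Exports.
Local Open Scope classical_set_scope.
Local Open Scope ring_scope.

(* R^n is represented by n-tuples with the product sigma-algebra.  The carrier
   is [measurableTypeR R], i.e. R with the Borel structure on which the
   library's [lebesgue_measure] is defined. *)
Notation Rvec R n := (n.-tuple (measurableTypeR R)).

Definition consT (R : realType) (n : nat) (p : measurableTypeR R * Rvec R n) :
  Rvec R n.+1 := [tuple of p.1 :: p.2].

Definition unconsT (R : realType) (n : nat) (t : Rvec R n.+1) :
  measurableTypeR R * Rvec R n := (thead t, [tuple of behead t]).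

Lemma consTK (R : realType) (n : nat) : cancel (@consT R n) (@unconsT R n).
Proof. by case=> x t; congr (_, _); exact: val_inj. Qed.

Lemma measurable_consT (R : realType) (n : nat) :
  measurable_fun [set: measurableTypeR R * Rvec R n] (@consT R n).
Proof. by apply: measurable_cons. Qed.

Lemma measurable_unconsT (R : realType) (n : nat) :
  measurable_fun [set: Rvec R n.+1] (@unconsT R n).
Proof.
apply/measurable_fun_pairP; split.
- exact: (@measurable_tnth _ _ n.+1 ord0).
- exact: measurable_behead.
Qed.

Section lebesgue_cons.
Context (R : realType) (n : nat).
Variable mu : {sigma_finite_measure set (Rvec R n) -> \bar R}.
Local Open Scope ereal_scope.

Let m1 : {sigma_finite_measure set (measurableTypeR R) -> \bar R} :=
  @lebesgue_measure R.

Definition lebesgue_cons := pushforward (m1 \x mu) (@consT R n).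

Let lc0 : lebesgue_cons set0 = 0.
Proof. by rewrite /lebesgue_cons /pushforward preimage_set0 measure0. Qed.

Let lc_ge0 A : 0 <= lebesgue_cons A.
Proof. by rewrite /lebesgue_cons /pushforward measure_ge0. Qed.

Let lc_sigma_additive : semi_sigma_additive lebesgue_cons.
Proof.
have mc A : measurable A -> measurable (@consT R n @^-1` A).
  by move=> mA; rewrite -[X in measurable X]setTI; exact: measurable_consT.
move=> F mF tF mUF; rewrite /lebesgue_cons /pushforward preimage_bigcup.
apply: measure_semi_sigma_additive.
- by move=> i; exact: mc.
- apply/trivIsetP => /= i j _ _ ij; rewrite -preimage_setI.
  by move/trivIsetP : tF => /(_ _ _ _ _ ij) ->//; rewrite preimage_set0.
- by rewrite -preimage_bigcup; exact: mc.
Qed.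

HB.instance Definition _ := isMeasure.Build _ _ _ lebesgue_cons
  lc0 lc_ge0 lc_sigma_additive.

Let lc_sigma_finite : sigma_finite setT lebesgue_cons.
Proof.
have /sigma_finiteP[F [TF ndF Foo]] := sigma_finiteT m1.
have /sigma_finiteP[G [TG ndG Goo]] := sigma_finiteT mu.
exists (fun k => @unconsT R n @^-1` (F k `*` G k)).
  rewrite -preimage_bigcup [X in _ @^-1` X](_ : _ = setT) ?preimage_setT//.
  apply/seteqP; split => // -[x y] _.
  have [i _ Fix_] : (\bigcup_i F i) x by rewrite -TF.
  have [k _ Gky] : (\bigcup_i G i) y by rewrite -TG.
  exists (maxn i k) => //; split.
  - by move: x Fix_; exact/subsetPset/ndF/leq_maxl.
  - by move: y Gky; exact/subsetPset/ndG/leq_maxr.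
move=> k; have [mF Fk] := Foo k; have [mG Gk] := Goo k; split.
  rewrite -[X in measurable X]setTI; apply: measurable_unconsT => //.
  exact: measurableX.
rewrite /lebesgue_cons /pushforward -comp_preimage.
rewrite (_ : _ \o _ = id); last by apply/funext => x; exact: consTK.
by rewrite preimage_id product_measure1E// lte_mul_pinfty// ge0_fin_numE.
Qed.

HB.instance Definition _ := Measure_isSigmaFinite.Build _ _ _ lebesgue_cons
  lc_sigma_finite.

End lebesgue_cons.

Fixpoint lebesgue (R : realType) (n : nat) :
    {sigma_finite_measure set (Rvec R n) -> \bar R} :=
  match n with
  | 0 => dirac ([tuple] : Rvec R 0)
  | n'.+1 => lebesgue_cons (lebesgue R n')
  end.

Lemma lebesgue_box (R : realType) (n : nat)
    (A : 'I_n -> set (measurableTypeR R)) :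
  (forall i, measurable (A i)) ->
  (lebesgue R n [set t | forall i, A i (tnth t i)] =
   \prod_(i < n) lebesgue_measure (A i))%E.
Proof.
elim: n A => [|n IH] A mA.
  rewrite big_ord0 /= diracE mem_set//= => -[] //.
rewrite big_ord_recl /= /lebesgue_cons /pushforward.
pose B : set (Rvec R n) := [set t | forall i, A (lift ord0 i) (tnth t i)].
have mB : measurable B.
  rewrite (_ : B = \bigcap_(i in [set: 'I_n])
      ((fun t => tnth t i) @^-1` A (lift ord0 i))).
    apply: fin_bigcap_measurable => [|i _]; first exact: finite_finset.
    by rewrite -[X in measurable X]setTI; exact: measurable_tnth.
  by apply/seteqP; split => [t Bt i _|t Bt i]; exact: Bt.
rewrite -IH//= -/B -product_measure1E//; congr (_ _).
have tS x t i : tnth (@consT R n (x, t)) (lift ord0 i) = tnth t i.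
  by rewrite !(tnth_nth x).
apply/seteqP; split => [[x t] /= H|[x t] /= [Ax Bt] i].
  by split=> [|i]; [exact: (H ord0)|rewrite -(tS x); exact: H].
by case: (unliftP ord0 i) => [j ->|->//]; rewrite tS; exact: Bt.
Qed.

Definition joint d (T : measurableType d) (R : realType) (P : probability T R)
    (n : nat) (X : 'I_n -> {RV P >-> R}) (t : T) : Rvec R n :=
  [tuple X i t | i < n].

Definition is_joint_density d (T : measurableType d) (R : realType)
    (P : probability T R) (n : nat) (X : 'I_n -> {RV P >-> R})
    (p : Rvec R n -> R) : Prop :=
  [/\ measurable_fun [set: Rvec R n] p, forall x, 0 <= p x &
    forall A : set (Rvec R n), measurable A ->
      P (joint X @^-1` A) = (\int[lebesgue R n]_(x in A) (p x)%:E)%E].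

(* The value does not depend on the chosen density, two densities being equal
   almost everywhere.  [ln 0 = 0], so [p * ln p] vanishes where [p] does. *)
Definition entropy d (T : measurableType d) (R : realType)
    (P : probability T R) (n : nat) (X : 'I_n -> {RV P >-> R}) : \bar R :=
  if pselect (exists p, is_joint_density X p) is left h
  then (- \int[lebesgue R n]_x (sval (cid h) x * ln (sval (cid h) x))%:E)%E
  else -oo%E.

Definition entropy1 d (T : measurableType d) (R : realType)
    (P : probability T R) (X : {RV P >-> R}) : \bar R :=
  entropy (fun _ : 'I_1 => X).

(* An element of (R^N)^n is a function 'I_n -> 'I_N -> R. *)

Definition nondecreasing_vec (R : realType) (N : nat) (x : 'I_N -> R) : Prop :=
  forall j k : 'I_N, (j <= k)%N -> x j <= x k.

Definition kappa (R : realType) (N : nat) (x : 'I_N -> R) : R :=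
  N%:R^-1 * \sum_(j < N) x j.

(* The cutoff [r] ranges over (0, +oo]; at [+oo] the first clause is void. *)
Definition microstates d (T : measurableType d) (R : realType)
    (P : probability T R) (n : nat) (X : 'I_n -> {RV P >-> R}) (r : \bar R)
    (N m : nat) (delta : R) : set ('I_n -> 'I_N -> R) :=
  [set x | (forall i j, (`|x i j|%:E <= r)%E) /\
    forall k : nat, (1 <= k <= m)%N -> forall i : 'I_k -> 'I_n,
      `|kappa (fun j => \prod_(l < k) x (i l) j)
        - fine 'E_P[fun t => \prod_(l < k) X (i l) t]| < delta].

Definition perm_act (R : realType) (N : nat) (s : 'S_N) (x : 'I_N -> R) :
  'I_N -> R := fun j => x ((s^-1)%g j).

Definition unif_perm (R : realType) (n N : nat)
    (A : {set {ffun 'I_n -> 'S_N}}) : R :=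
  #|A|%:R / #|{: {ffun 'I_n -> 'S_N}}|%:R.

Definition Delta_sym d (T : measurableType d) (R : realType)
    (P : probability T R) (n : nat) (X : 'I_n -> {RV P >-> R}) (r : \bar R)
    (N m : nat) (delta : R) : {set {ffun 'I_n -> 'S_N}} :=
  [set s : {ffun 'I_n -> 'S_N} |
    `[< exists2 x : 'I_n -> 'I_N -> R, forall i, nondecreasing_vec (x i) &
        microstates X r m delta (fun i => perm_act (s i) (x i)) >]]%SET.

Definition Delta_sym_at d (T : measurableType d) (R : realType)
    (P : probability T R) (n : nat) (X : 'I_n -> {RV P >-> R})
    (xi : 'I_n -> forall N : nat, 'I_N -> R)
    (N m : nat) (delta : R) : {set {ffun 'I_n -> 'S_N}} :=
  [set s : {ffun 'I_n -> 'S_N} |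
    `[< microstates X +oo%E m delta
          (fun i => perm_act (s i) (xi i N)) >]]%SET.

Definition approximating d (T : measurableType d) (R : realType)
    (P : probability T R) (X : {RV P >-> R})
    (xi : forall N : nat, 'I_N -> R) : Prop :=
  (forall N, nondecreasing_vec (xi N)) /\
  forall k : nat, (1 <= k)%N ->
    kappa (fun j => xi N j ^+ k) @[N --> \oo] --> fine 'E_P[fun t => X t ^+ k].

Definition log_rate (R : realType) (n : nat)
    (D : forall N : nat, nat -> R -> {set {ffun 'I_n -> 'S_N}})
    (m : nat) (delta : R) (N : nat) : \bar R :=
  ((N%:R^-1)%:E * lne (unif_perm R (D N m delta))%:E)%E.

(* The upper and lower limits below are monotone in m and in delta for the
   families [Delta_sym] and [Delta_sym_at], so the joint limit along m -> oo,
   delta -> 0+ exists and agrees with the iterated ones. *)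
Definition I_limsup (R : realType) (n : nat)
    (D : forall N : nat, nat -> R -> {set {ffun 'I_n -> 'S_N}}) : \bar R :=
  (- lim (limn_esup (log_rate D md.1 md.2)
          @[md --> filter_prod (\oo : set_system nat) (0 : R)^'+]))%E.

Definition I_liminf (R : realType) (n : nat)
    (D : forall N : nat, nat -> R -> {set {ffun 'I_n -> 'S_N}}) : \bar R :=
  (- lim (limn_einf (log_rate D md.1 md.2)
          @[md --> filter_prod (\oo : set_system nat) (0 : R)^'+]))%E.

(* [Isym_cut r], for r in (0, +oo] bounding every ||X_i||_oo, and [Isym_at xi],
   for xi approximating X, are the quantities whose common value is the mutual
   information I_sym(X). *)
Section Isym.
Context d (T : measurableType d) (R : realType) (P : probability T R)
  (n : nat) (X : 'I_n -> {RV P >-> R}).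

Definition Isym_cut (r : \bar R) : \bar R := I_limsup (Delta_sym X r).
Definition Isym_cut_bar (r : \bar R) : \bar R := I_liminf (Delta_sym X r).

Definition Isym_at (xi : 'I_n -> forall N : nat, 'I_N -> R) : \bar R :=
  I_limsup (Delta_sym_at X xi).
Definition Isym_at_bar (xi : 'I_n -> forall N : nat, 'I_N -> R) : \bar R :=
  I_liminf (Delta_sym_at X xi).

End Isym.

(* Main.v *)
(* Fix sorted words b_1, ..., b_n of length N over a finite alphabet.  By
   Stirling's formula, the probability that independent uniform permutations
   of the b_i have a given joint type T is exp(- N info(T/N)) up to polynomial
   factors, where [info] is the mutual information of the coordinates.  The
   alphabet consists of the 2^K bins of a box (-A, A] containing the values of
   the X_i.  When the X_i have diffuse laws, indicators of cells are squeezed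
   between polynomials, so micro-states have nearly the cell frequencies of X;
   conversely sorted vectors with the right cell frequencies yield micro-states.
   Hence both exponential rates equal, up to errors vanishing as K grows, minus
   the mutual information of the discretization of X, that is, H_K(X_1,...,X_n)
   - sum_i H_K(X_i) for the discretized entropies H_K.  Finally H <= H_K by
   convexity, and limsup H_K <= H by the Donsker-Varadhan variational formula
   for relative entropy and the density of step functions in L^1 (laws without
   density being treated by Radon-Nikodym).  If some H(X_i) = -oo, then
   H(X_1,...,X_n) = -oo because mutual information is nonnegative; otherwise all
   the laws are diffuse. *)

Require Import Defs.
From HB Require Import structures.
From mathcomp Require Import all_boot all_order all_algebra fingroup perm.
From mathcomp Require Import all_classical all_reals all_analysis.
From mathcomp Require Import measurable_realfun ess_sup_inf ring lra zify.
Set Implicit Arguments.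
Unset Strict Implicit.
Unset Printing Implicit Defensive.
Import Order.TTheory GRing.Theory Num.Theory.
Import numFieldNormedType.Exports.
Local Open Scope classical_set_scope.
Local Open Scope ring_scope.

(** * Random permutations and types *)

Section counting.
Local Open Scope set_scope.
Local Open Scope nat_scope.

(** The agreement of the various definitions of [I_sym] needs no separate argument: every family of
    permutations receives the same two bounds. The upper bound is proved for the largest family,
    with cutoff [+oo], so it has to hold for micro-states with arbitrarily large entries. A
    polynomial close to an indicator on a compact interval is therefore not enough: its error must
    be dominated on the whole line by a second polynomial with small expectation. Near an endpoint
    of a bin this relies on the absence of atoms, whence the separate treatment of [H(X_i) = -oo].
    In this family the sorted vectors may moreover depend on the permutations, but sorted words over
    a finite alphabet are polynomially few. The lower bound is delicate for prescribed sequences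
    [xi], which may leave the range of the [X i] at some indices; these become negligible because
    they are few and the even moments are bounded. Entropies may be [-oo] even when a density
    exists, so the comparison with [H_K] is made by one-sided bounds through bounded test
    functions. *)

Definition type_class (C : finType) (N : nat) (T : C -> nat) :
  {set N.-tuple C} := [set t : N.-tuple C | [forall c, count_mem c t == T c]].

Lemma type_classP (C : finType) (N : nat) (T : C -> nat) (t : N.-tuple C) :
  reflect (forall c, count_mem c t = T c) (t \in type_class N T).
Proof.
rewrite finset.inE; apply: (iffP forallP) => [H c|H c]; first exact/eqP.
by rewrite H.
Qed.

Lemma sum_count_mem (C : finType) (s : seq C) :
  (\sum_c count_mem c s = size s)%N.
Proof.
elim: s => [|x s IH] /=; first by rewrite big1.
rewrite big_split /= IH (bigD1 x)//= eqxx big1 ?addn0 ?add1n// => c.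
by rewrite eq_sym => /negPf ->.
Qed.

(** The multinomial coefficient, kept free of division. Splitting a class by the first letter [a]
    leaves the type [T' a] on the other [N] letters, and the factor [N.+1] of the factorial is
    distributed as the sum of the [T a]. *)
Lemma card_type_class (C : finType) (N : nat) (T : C -> nat) :
  \sum_c T c = N -> #|type_class N T| * \prod_c (T c)`! = N`!.
Proof.
elim: N T => [|N IH] T sT.
  have T0 c : T c = 0.
    by apply/eqP; move/eqP: sT; rewrite sum_nat_eq0 => /forallP/(_ c).
  rewrite big1 => [|c _]; last by rewrite T0.
  rewrite muln1 (_ : type_class 0 T = [set: 0.-tuple C]) ?cardsT ?card_tuple//.
  by apply/setP => t; rewrite finset.in_setT; apply/type_classP => c; rewrite tuple0 T0.
pose T' a c := T c - (c == a).
have cT a : #|[set t in type_class N.+1 T | thead t == a]| =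
    if T a > 0 then #|type_class N (T' a)| else 0.
  case: ifP => Ta; last first.
    apply: eq_card0 => t; rewrite finset.in_set; apply/negP => /andP[/type_classP/(_ a)].
    case/tupleP: t => x t; rewrite theadE => + /eqP xa; rewrite /= xa eqxx => e.
    by move: Ta; rewrite -e add1n.
  have inj : injective (fun t : N.-tuple C => [tuple of a :: t]).
    by move=> t t' /(congr1 val) [/val_inj].
  rewrite -(card_imset _ inj); apply: eq_card => t; rewrite finset.inE.
  apply/andP/imsetP => [[/type_classP H /eqP ta]|[t' /type_classP H ->]].
    case/tupleP: t H ta => x t; rewrite theadE => H xa; subst x.
    exists t => //; apply/type_classP => c; rewrite /T' -H/= (eq_sym a).
    by rewrite addKn.
  split; last by rewrite theadE.
  apply/type_classP => c; rewrite /= H /T' (eq_sym a).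
  by case: eqP => [->|_]; rewrite ?subn0// subnKC.
have -> : #|type_class N.+1 T| =
    \sum_a #|[set t in type_class N.+1 T | thead t == a]|.
  rewrite -sum1_card (partition_big (fun t : N.+1.-tuple C => thead t) xpredT)//=; apply: eq_bigr => a _.
  by rewrite -sum1_card; apply: eq_bigl => t; rewrite finset.in_set.
under eq_bigr do rewrite cT.
rewrite big_distrl/= factS -sT big_distrl /=; apply: eq_bigr => a _.
case: ifP => [Ta|]; last by case: (T a).
rewrite -(IH (T' a)); last first.
  apply/eqP; rewrite -(eqn_add2r 1) [eqbRHS]addn1 -sT (bigD1 a)//= [eqbRHS](bigD1 a)//=.
  rewrite /T' eqxx addnAC subnK//; apply/eqP; congr (_ + _).
  by apply: eq_bigr => c /negPf ->; rewrite subn0.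
rewrite mulnCA; congr (_ * _).
rewrite (bigD1 a)//= [in RHS](bigD1 a)//= mulnA; congr (_ * _).
  by rewrite /T' eqxx; case: (T a) Ta => // m _; rewrite subn1 factS.
by apply: eq_bigr => c /negPf ca; rewrite /T' ca subn0.
Qed.

Definition act_tuple (C : Type) (N : nat) (b : N.-tuple C) (s : 'S_N) :=
  [tuple tnth b (s^-1 j)%g | j < N].

Lemma act_tupleM (C : Type) (N : nat) (b : N.-tuple C) (s p : 'S_N) :
  act_tuple (act_tuple b s) p = act_tuple b (s * p)%g.
Proof.
by apply: eq_from_tnth => j; rewrite !tnth_mktuple invMg permM.
Qed.

Lemma perm_act_tuple (C : eqType) (N : nat) (b : N.-tuple C) (s : 'S_N) :
  perm_eq (act_tuple b s) b.
Proof. by apply/tuple_permP; exists (s^-1)%g. Qed.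

Lemma perm_eq_act_tuple (C : eqType) (N : nat) (b w : N.-tuple C) :
  perm_eq b w -> exists s : 'S_N, act_tuple b s = w.
Proof.
rewrite perm_sym => /tuple_permP[p /val_inj ->]; exists (p^-1)%g.
by apply: eq_from_tnth => j; rewrite !tnth_mktuple invgK.
Qed.

(** Right translation by a permutation taking [b] to [w] maps the stabilizer of [b] onto the fibre
    over [w], so all fibres over rearrangements of [b] have the same size. Dividing the order of the
    symmetric group by the multinomial number of rearrangements gives this size. *)
Lemma card_act_tuple_fiber (C : finType) (N : nat) (b w : N.-tuple C) :
  perm_eq b w ->
  #|[set s : 'S_N | act_tuple b s == w]| = \prod_c (count_mem c b)`!.
Proof.
move=> bw.
pose F (w : N.-tuple C) := [set s : 'S_N | act_tuple b s == w].
have cF (w1 : N.-tuple C) : perm_eq b w1 -> #|F w1| = #|F b|.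
  move=> /perm_eq_act_tuple[p pw].
  rewrite -(card_imset (mem (F b)) (mulIg p)); apply: eq_card => s.
  rewrite !finset.inE; apply/eqP/imsetP => [sw|[s0]].
    exists (s * p^-1)%g; last by rewrite mulgKV.
    rewrite finset.inE -act_tupleM sw -pw act_tupleM mulgV.
    by apply/eqP/eq_from_tnth => j; rewrite tnth_mktuple invg1 perm1.
  by rewrite finset.inE => /eqP s0b ->; rewrite -act_tupleM s0b.
have sN : \sum_c count_mem c b = N by rewrite sum_count_mem size_tuple.
have E : #|F b| * #|type_class N (fun c => count_mem c b)| = N`!.
  rewrite -card_Sn -cardsT -[RHS]sum1_card.
  rewrite (partition_big (act_tuple b)
     (mem (type_class N (fun c => count_mem c b))))/=; last first.
    by move=> s _; apply/type_classP => c; apply/seq.permP; exact: perm_act_tuple.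
  rewrite mulnC -sum_nat_const; apply: eq_bigr => w1 /type_classP bw1.
  rewrite -(cF w1); last by apply/allP => c _; rewrite /= bw1.
  by rewrite -sum1_card; apply: eq_bigl => s; rewrite !finset.inE.
rewrite -/(F w) cF//; move: E; rewrite -(card_type_class sN) mulnC => /eqP.
rewrite eqn_pmul2l => [/eqP//|]; rewrite card_gt0; apply/finset.set0Pn; exists b.
exact/type_classP.
Qed.

Section joint_types.
Variables (n N : nat) (B : finType).
Implicit Types (b : {ffun 'I_n -> N.-tuple B}) (s : {ffun 'I_n -> 'S_N}).

Local Notation cell := {ffun 'I_n -> B}.

Definition joint_tuple b s : N.-tuple cell :=
  [tuple [ffun i => tnth (act_tuple (b i) (s i)) j] | j < N].

Definition marginal (T : cell -> nat) (i : 'I_n) (k : B) : nat :=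
  \sum_(c : cell | c i == k) T c.

Lemma count_marginal (w : N.-tuple cell) (T : cell -> nat) i k :
  w \in type_class N T ->
  count_mem k (map_tuple (fun c : cell => c i) w) = marginal T i k.
Proof.
move=> /type_classP wT; rewrite /marginal (eq_bigr (fun c => count_mem c w)).
  rewrite count_map; elim: (val w) => [|x s IH] /=; first by rewrite big1.
  rewrite big_split /= IH; congr (_ + _).
  case: (eqVneq (x i) k) => xk /=.
    by rewrite (bigD1 x) ?xk//= eqxx big1 ?addn0// => c /andP[_]; rewrite eq_sym => /negPf ->.
  by rewrite big1// => c /eqP ck; case: eqP => // xc; rewrite xc ck eqxx in xk.
by move=> c _; rewrite wT.
Qed.

Lemma card_joint_fiber b (w : N.-tuple cell) :
  #|[set s | joint_tuple b s == w]| =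
  \prod_i #|[set s : 'S_N | act_tuple (b i) s == map_tuple (fun c : cell => c i) w]|.
Proof.
pose F i := [set s : 'S_N | act_tuple (b i) s == map_tuple (fun c : cell => c i) w].
rewrite (eq_card (B := family F)).
  by rewrite card_family foldrE big_map big_enum.
move=> s; rewrite finset.inE; apply/eqP/familyP => [sw i|sF].
  rewrite finset.inE -sw; apply/eqP/eq_from_tnth => j.
  by rewrite [RHS]tnth_map [in RHS]tnth_mktuple ffunE.
apply: eq_from_tnth => j; rewrite tnth_mktuple; apply/ffunP => i; rewrite ffunE.
by have := sF i; rewrite finset.inE => /eqP ->; rewrite tnth_map.
Qed.

(** A word [b i] whose counts are not the marginal of [T] has an empty fibre, hence only an
    inequality. The union bound uses this form, since it enumerates words and types
    independently. *)
Lemma card_joint_type_le b (T : cell -> nat) :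
  #|[set s | joint_tuple b s \in type_class N T]| <=
  #|type_class N T| * \prod_i \prod_k (marginal T i k)`!.
Proof.
rewrite -sum1_card (partition_big (joint_tuple b) (mem (type_class N T)))/=; last first.
  by move=> s; rewrite finset.inE.
rewrite -[leqRHS]sum_nat_const; apply: leq_sum => w wT.
rewrite (_ : \sum_(_ | _) 1 = #|[set s | joint_tuple b s == w]|); last first.
  rewrite -sum1_card; apply: eq_bigl => s; rewrite !finset.inE andb_idl// => /eqP ->.
  by move: wT; rewrite !finset.inE.
rewrite card_joint_fiber; apply: leq_prod => i _.
have [/existsP[s /eqP sw]|] := boolP [exists s, act_tuple (b i) s == map_tuple (fun c : cell => c i) w].
  have bw : perm_eq (b i) (map_tuple (fun c : cell => c i) w).
    by rewrite -sw perm_sym perm_act_tuple.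
  rewrite card_act_tuple_fiber//; apply: leq_prod => k _.
  by rewrite (seq.permP bw) (count_marginal i k wT).
rewrite negb_exists => /forallP H; rewrite eq_card0// => s; rewrite finset.inE.
exact/negbTE/H.
Qed.

Lemma card_joint_type b (T : cell -> nat) :
  (forall i k, count_mem k (b i) = marginal T i k) ->
  #|[set s | joint_tuple b s \in type_class N T]| =
  #|type_class N T| * \prod_i \prod_k (marginal T i k)`!.
Proof.
move=> bT.
rewrite -sum1_card (partition_big (joint_tuple b) (mem (type_class N T)))/=; last first.
  by move=> s; rewrite finset.inE.
rewrite -[RHS]sum_nat_const; apply: eq_bigr => w wT.
rewrite (_ : \sum_(_ | _) 1 = #|[set s | joint_tuple b s == w]|); last first.
  rewrite -sum1_card; apply: eq_bigl => s; rewrite !finset.inE andb_idl// => /eqP ->.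
  by move: wT; rewrite !finset.inE.
rewrite card_joint_fiber; apply: eq_bigr => i _.
rewrite card_act_tuple_fiber; first by apply: eq_bigr => k _; rewrite bT.
by apply/allP => k _ /=; rewrite bT (count_marginal i k wT).
Qed.

End joint_types.

End counting.

(** * Stirling bounds and the function x ln x *)

Section stirling.
Variable R : realType.
Implicit Types x y t : R.

Definition xlnx x : R := x * ln x.

Lemma xlnx0 : xlnx 0 = 0. Proof. by rewrite /xlnx mul0r. Qed.

Lemma ln_le_subr1 x : 0 < x -> ln x <= x - 1.
Proof. by move=> x0; have := @le_ln1Dx R (x - 1); rewrite [1 + _]addrC subrK; apply; lra. Qed.

Lemma ln_ge_1subV x : 0 < x -> 1 - x^-1 <= ln x.
Proof.
move=> x0; have := @ln_le_subr1 x^-1; rewrite invr_gt0 lnV// => /(_ x0).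
lra.
Qed.

(** Induction with [f m = m ln m - m] as comparison: the increment [f m.+2 - f m.+1] lies between
    [ln m.+1] and [ln m.+2], by [1 - 1/q <= ln q <= q - 1] at [q = m.+2 / m.+1]. *)
Lemma ln_fact_bounds (k : nat) :
  xlnx k%:R - k%:R <= ln (k`!%:R : R) <= xlnx k%:R - k%:R + 1 + ln (k.+1)%:R.
Proof.
have lnS0 (m : nat) : 0 <= ln (m.+1)%:R :> R by rewrite ln_ge0// ler1n.
have lnS (m : nat) : 0 < m.+1%:R :> R by rewrite ltr0n.
have fS (m : nat) : ln (m.+1`!)%:R = ln m.+1%:R + ln m`!%:R :> R.
  by rewrite factS natrM lnM ?posrE ?ltr0n ?fact_gt0.
pose f (m : nat) : R := xlnx m%:R - m%:R.
have step (m : nat) : ln m.+1%:R <= f m.+2 - f m.+1 <= ln (m.+2%:R : R).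
  have := lnS m; have := lnS m.+1; rewrite /f /xlnx.
  have : m.+2%:R = m.+1%:R + 1 :> R by rewrite -[m.+2]addn1 natrD.
  set u : R := m.+2%:R; set v : R := m.+1%:R => uv u0 v0.
  have q0 : 0 < u / v by rewrite divr_gt0.
  have := ln_le_subr1 q0; have := ln_ge_1subV q0.
  rewrite ln_div ?posrE// invf_div => h1 h2.
  have h1' : u - v <= u * (ln u - ln v).
    apply: le_trans (ler_wpM2l (ltW u0) h1).
    by rewrite mulrBr mulr1 mulrCA divff ?mulr1 // gt_eqF.
  have h2' : v * (ln u - ln v) <= u - v.
    apply: le_trans (ler_wpM2l (ltW v0) h2) _.
    by rewrite mulrBr mulr1 mulrCA divff ?mulr1 // gt_eqF.
  by move: h1' h2'; rewrite uv; nra.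
have f1 : f 1%N = -1 by rewrite /f /xlnx ln1 mulr0 sub0r.
have lo m : f m <= ln (m`!)%:R.
  elim: m => [|[|m] IH]; first by rewrite /f xlnx0 fact0 ln1 subr0.
    by rewrite f1 ln1; lra.
  by rewrite fS; have /andP[s1 s2] := step m; lra.
have up m : ln (m`!)%:R <= f m.+1 + 1.
  elim: m => [|m IH]; first by rewrite f1 fact0 ln1; lra.
  by rewrite fS; have /andP[s1 s2] := step m; lra.
rewrite lo/=; case: k => [|k]; first by rewrite xlnx0 fact0 !ln1; lra.
rewrite fS; have := up k; rewrite /f.
have : ln k.+1%:R <= ln k.+2%:R :> R by rewrite ler_ln ?posrE// ler_nat.
lra.
Qed.

Lemma xlnx_le0 x : x <= 0 -> xlnx x = 0.
Proof. by move=> x0; rewrite /xlnx ln0 ?mulr0. Qed.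

(** With [s] the square root of [x], [x ln x = 2 s (s ln s)], and [s ln s] lies between -1 and 0 on
    the unit interval. This gives the continuity of [xlnx] at 0. *)
Lemma normr_xlnx_le x : 0 <= x <= 1 -> `|xlnx x| <= 2 * Num.sqrt x.
Proof.
move=> /andP[]; rewrite le_eqVlt => /predU1P[<- _|x0 x1].
  by rewrite xlnx0 normr0 mulr_ge0// sqrtr_ge0.
have s0 : 0 < Num.sqrt x by rewrite sqrtr_gt0.
have xE : x = Num.sqrt x * Num.sqrt x by rewrite -expr2 sqr_sqrtr// ltW.
have s1 : Num.sqrt x <= 1 by rewrite -sqrtr1 ler_sqrt// ltW.
have := ln_ge_1subV s0; have := ln_le0 s1; rewrite /xlnx.
have lE : ln x = ln (Num.sqrt x) + ln (Num.sqrt x) by rewrite {1}xE lnM.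
rewrite lE; set s := Num.sqrt x in s0 xE s1 lE *.
move=> h1 h2; have h3 : s - 1 <= s * ln s.
  apply: le_trans (ler_wpM2l (ltW s0) h2).
  by rewrite mulrBr mulr1 divff ?gt_eqF.
rewrite ler_norml xE; apply/andP; split; nra.
Qed.

Lemma continuous_xlnx : continuous xlnx.
Proof.
move=> x; have [x0|x0|<-] := ltgtP 0 x.
- by apply: cvgM; [exact: cvg_id|exact: continuous_ln].
- rewrite /continuous_at xlnx_le0 ?ltW//; apply: cvg_near_cst.
  near=> y; apply: xlnx_le0; apply/ltW; near: y; exact: lt_nbhsl.
- rewrite /continuous_at xlnx0; apply/cvgrPdist_le => e e0; near=> y.
  rewrite sub0r normrN; have [y0|y0] := leP y 0; first by rewrite xlnx_le0// normr0 ltW.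
  apply: le_trans (normr_xlnx_le _) _.
    by rewrite (ltW y0)/=; near: y; exact: lt_le_nbhsl.
  have y1 : y <= (e / 2) ^+ 2.
    by near: y; apply: lt_le_nbhsl; rewrite exprn_gt0// divr_gt0.
  have : Num.sqrt y <= e / 2.
    rewrite -[leRHS]ger0_norm ?divr_ge0 ?(ltW e0)//.
    by rewrite -sqrtr_sqr ler_sqrt ?exprn_ge0 ?divr_ge0 ?(ltW e0).
  lra.
Unshelve. all: by end_near. Qed.

Lemma natr_xlnx_div (N k : nat) : (0 < N)%N ->
  N%:R * xlnx (k%:R / N%:R) = xlnx k%:R - k%:R * ln N%:R.
Proof.
move=> N0; case: k => [|k]; first by rewrite !mul0r xlnx0 mulr0 subrr.
have Np : 0 < N%:R :> R by rewrite ltr0n.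
rewrite /xlnx ln_div ?posrE ?ltr0n// mulrA mulrCA divff ?gt_eqF// mulr1.
by rewrite mulrBr.
Qed.

End stirling.

(** * Mutual information and the probability of a joint type *)

Section information.
Variables (R : realType) (n : nat) (B : finType).
Local Notation cell := {ffun 'I_n -> B}.
Implicit Types (theta : cell -> R) (T : cell -> nat).

Definition rmarginal theta (i : 'I_n) (k : B) : R :=
  \sum_(c : cell | c i == k) theta c.

Definition info theta : R :=
  \sum_c xlnx (theta c) - \sum_i \sum_k xlnx (rmarginal theta i k).

Lemma sum_rmarginal theta i : \sum_k rmarginal theta i k = \sum_c theta c.
Proof.
by rewrite [RHS](partition_big (fun c : cell => c i) xpredT).
Qed.

Lemma sum_marginal T i : (\sum_k marginal T i k = \sum_c T c)%N.
Proof.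
by rewrite [RHS](partition_big (fun c : cell => c i) xpredT).
Qed.

Lemma rmarginal_nat T (N : nat) i k :
  rmarginal (fun c => (T c)%:R / N%:R) i k = (marginal T i k)%:R / N%:R.
Proof. by rewrite /rmarginal -mulr_suml /marginal natr_sum. Qed.

Lemma info_continuous theta (eta : R) : 0 < eta ->
  exists2 e : R, 0 < e & forall theta',
    (forall c, `|theta' c - theta c| <= e) -> `|info theta' - info theta| <= eta.
Proof.
(* The number of terms [xlnx] in [info], plus one to keep it positive. *)
move=> eta0; pose M : R := #|{: cell}|%:R + (n * #|B|)%:R + 1.
have M0 : 0 < M by rewrite ltr_wpDl// addr_ge0.
have cont x : exists2 d : R, 0 < d &
    forall y, `|y - x| <= d -> `|xlnx y - xlnx x| <= eta / M.
  have /cvgrPdist_le/(_ (eta / M)) := @continuous_xlnx R x.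
  rewrite divr_gt0// => /(_ isT)/nbhs_ballP[d /= d0 H].
  exists (d / 2); first by rewrite divr_gt0.
  move=> y xy; rewrite distrC; apply: H => /=; rewrite /ball/= distrC.
  by apply: le_lt_trans xy _; rewrite ltr_pdivrMr// ltr_pMr// ltr1n.
have fin (I : finType) (x : I -> R) : exists2 d : R, 0 < d &
    forall i y, `|y - x i| <= d -> `|xlnx y - xlnx (x i)| <= eta / M.
  have /choice[d dP] : forall i, exists d : R, 0 < d /\
      forall y, `|y - x i| <= d -> `|xlnx y - xlnx (x i)| <= eta / M.
    by move=> i; have [d d0 H] := cont (x i); exists d.
  exists (\big[Num.min/1]_i d i).
    by apply: lt_bigmin => // i _; have [] := dP i.
  move=> i y xy; have [_ ] := dP i; apply; apply: le_trans xy _.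
  exact: bigmin_le_cond.
have [d1 d10 H1] := fin _ theta.
have [d2 d20 H2] := fin _ (fun p : 'I_n * B => rmarginal theta p.1 p.2).
have K0 : 0 < (#|{: cell}|.+1)%:R :> R by rewrite ltr0n.
exists (Num.min d1 (d2 / #|{: cell}|.+1%:R)).
  by rewrite lt_min d10 divr_gt0.
move=> theta' th.
have E (a b c d : R) : a - b - (c - d) = (a - c) + (d - b) by ring.
rewrite /info E -sumrB !pair_big/= -sumrB.
rewrite (le_trans (ler_normD _ _))//.
have -> : eta = \sum_(c : cell) eta / M + \sum_(p : 'I_n * B) eta / M + eta / M.
  rewrite !sumr_const card_prod card_ord -!(mulr_natl (eta / M)) -[X in _ + X]mul1r.
  by rewrite -!mulrDl -/M mulrCA divff ?mulr1// gt_eqF.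
apply: le_trans (_ : _ <= \sum_(c : cell) eta / M + \sum_(p : 'I_n * B) eta / M) _; last first.
  by rewrite lerDl divr_ge0// ltW.
apply: lerD; apply: (le_trans (ler_norm_sum _ _ _)); apply: ler_sum.
  move=> c _; by apply: H1; apply: le_trans (th c) _; rewrite ge_min lexx.
move=> [i k] _ /=; rewrite distrC; apply: (H2 (i, k)) => /=.
rewrite /rmarginal -sumrB (le_trans (ler_norm_sum _ _ _))//.
apply: (@le_trans _ _ (\sum_(c : cell) d2 / #|{: cell}|.+1%:R)).
  rewrite [leRHS](bigID (fun c : cell => c i == k))/=.
  rewrite -[leLHS]addr0 lerD//; last by apply: sumr_ge0 => *; rewrite divr_ge0// ltW.
  by apply: ler_sum => c _; apply: le_trans (th c) _; rewrite ge_min lexx orbT.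
rewrite sumr_const -[leLHS]mulr_natr -mulrA ler_piMr ?(ltW d20)//.
by rewrite ler_pdivrMl// mulr1 ler_nat.
Qed.

(** Gibbs' inequality against the product [r] of the marginals: [theta ln (r / theta) <= r - theta]
    on each cell, and [r] also sums to 1 because a product of sums expands over the cells. *)
Lemma info_ge0 theta : (forall c, 0 <= theta c) -> \sum_c theta c = 1 ->
  0 <= info theta.
Proof.
move=> th0 th1; rewrite /info subr_ge0.
pose r (c : cell) : R := \prod_i rmarginal theta i (c i).
have thr i c : theta c <= rmarginal theta i (c i).
  by rewrite /rmarginal (bigD1 c)//= lerDl sumr_ge0.
have -> : \sum_i \sum_k xlnx (rmarginal theta i k) =
    \sum_c theta c * \sum_i ln (rmarginal theta i (c i)).
  under [RHS]eq_bigr do rewrite mulr_sumr.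
  rewrite [RHS]exchange_big/=; apply: eq_bigr => i _.
  rewrite [RHS](partition_big (fun c : cell => c i) xpredT)//=.
  apply: eq_bigr => k _; rewrite /xlnx {1}/rmarginal mulr_suml.
  by apply: eq_bigr => c /eqP ->.
apply: (@le_trans _ _ (\sum_c (xlnx (theta c) + (r c - theta c)))).
  apply: ler_sum => c _; have := th0 c; rewrite le_eqVlt => /predU1P[<-|thc].
    rewrite mul0r xlnx0 add0r subr0; apply: prodr_ge0 => i _.
    by apply: sumr_ge0.
  have rp i : 0 < rmarginal theta i (c i) by exact: lt_le_trans (thr i c).
  have [rc ->] : 0 < r c /\ \sum_i ln (rmarginal theta i (c i)) = ln (r c).
    rewrite /r; elim/big_rec2 : _ => [|i y x _ [x0 ->]]; first by rewrite ln1.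
    by rewrite mulr_gt0 ?rp// lnM ?posrE ?rp.
  have q0 : 0 < r c / theta c by rewrite divr_gt0.
  have := ln_le_subr1 q0; rewrite ln_div ?posrE// => h.
  have : theta c * (ln (r c) - ln (theta c)) <= r c - theta c.
    apply: le_trans (ler_wpM2l (ltW thc) h) _.
    by rewrite mulrBr mulr1 mulrCA divff ?mulr1// gt_eqF.
  by rewrite /xlnx mulrBr; lra.
rewrite big_split/= sumrB th1 /r.
rewrite -(bigA_distr_bigA (fun i k => rmarginal theta i k)).
rewrite [X in X - 1]big1 ?subrr ?addr0// => i _.
by rewrite sum_rmarginal.
Qed.

(** The fraction of [S_N^n] that produces the joint type [T] from words having its marginals as
    letter counts. *)
Definition type_weight (N : nat) T : R :=
  (#|type_class N T| * \prod_i \prod_k (marginal T i k)`!)%:R / (N`! ^ n)%:R.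

Lemma ln_prod_nat (I : finType) (F : I -> nat) : (forall i, (0 < F i)%N) ->
  ln (\prod_i F i)%:R = \sum_i ln (F i)%:R :> R.
Proof.
move=> F0; suff [_ ->] : (0 < \prod_i F i)%N /\
  ln (\prod_i F i)%:R = \sum_i ln (F i)%:R :> R by [].
elim/big_rec2 : _ => [|i x y _ [y0 <-]]; first by rewrite ln1.
by rewrite muln_gt0 F0 y0 natrM lnM ?posrE ?ltr0n.
Qed.

Lemma ln_type_weight (N : nat) T : (\sum_c T c)%N = N ->
  ln (type_weight N T) = ln N`!%:R - \sum_c ln (T c)`!%:R
    + \sum_i \sum_k ln (marginal T i k)`!%:R - n%:R * ln N`!%:R.
Proof.
move=> sT; have e := card_type_class sT.
have p0 : (0 < \prod_c (T c)`!)%N by apply: prodn_gt0 => c; exact: fact_gt0.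
have q0 : (0 < \prod_i \prod_k (marginal T i k)`!)%N.
  by apply: prodn_gt0 => i; apply: prodn_gt0 => k; exact: fact_gt0.
have t0 : (0 < #|type_class N T|)%N.
  by have := fact_gt0 N; rewrite -e muln_gt0 => /andP[].
rewrite /type_weight ln_div ?posrE ?ltr0n ?muln_gt0 ?t0 ?expn_gt0 ?fact_gt0//.
rewrite natrM lnM ?posrE ?ltr0n// natrX lnXn ?ltr0n ?fact_gt0// mulr_natl.
have lnN : ln N`!%:R = ln #|type_class N T|%:R + \sum_c ln (T c)`!%:R :> R.
  rewrite -e natrM lnM ?posrE ?ltr0n// ln_prod_nat// => c; exact: fact_gt0.
rewrite {2}lnN addrK ln_prod_nat => [|i]; last first.
  by apply: prodn_gt0 => k; exact: fact_gt0.
congr (_ + _ - _); apply: eq_bigr => i _.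
by rewrite ln_prod_nat => // k; exact: fact_gt0.
Qed.

(** Write [ln k!] as [k ln k - k + e k]. The linear terms cancel because [T] and each of its
    marginals sum to [N], and the terms [k ln k] assemble to [- N info]. What remains is
    [#|cell| + n #|B| + n + 1] errors [e], each between 0 and [1 + ln N.+1]. *)
Lemma type_weight_bounds (N : nat) T : (0 < N)%N -> (\sum_c T c)%N = N ->
  `|ln (type_weight N T) + N%:R * info (fun c => (T c)%:R / N%:R)| <=
  (#|{: cell}| + n * #|B| + n + 1)%:R * (1 + ln N.+1%:R).
Proof.
move=> N0 sT; rewrite ln_type_weight//.
pose e (k : nat) : R := ln k`!%:R - (xlnx k%:R - k%:R).
have eP k : (k <= N)%N -> 0 <= e k <= 1 + ln N.+1%:R.
  move=> kN; have /andP[h1 h2] := ln_fact_bounds R k.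
  have : ln k.+1%:R <= ln N.+1%:R :> R by rewrite ler_ln ?posrE ?ltr0n// ler_nat.
  by rewrite /e; lra.
have E k : ln k`!%:R = e k + (xlnx k%:R - k%:R) by rewrite /e subrK.
have TN c : (T c <= N)%N by rewrite -sT (bigD1 c)//= leq_addr.
have mN i k : (marginal T i k <= N)%N.
  by rewrite -sT -(sum_marginal T i) (bigD1 k)//= leq_addr.
have -> : N%:R * info (fun c => (T c)%:R / N%:R) =
    \sum_c xlnx (T c)%:R - N%:R * ln N%:R
    - (\sum_i \sum_k xlnx (marginal T i k)%:R - n%:R * (N%:R * ln N%:R)).
  rewrite /info mulrBr; congr (_ - _).
    rewrite mulr_sumr -[in X in _ - X * _]sT natr_sum mulr_suml -sumrB.
    by apply: eq_bigr => c _; rewrite natr_xlnx_div.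
  rewrite mulr_sumr mulr_natl -[in X in _ - X](card_ord n) -sumr_const -sumrB.
  apply: eq_bigr => i _; rewrite -[in X in _ - X * _]sT -(sum_marginal T i).
  rewrite natr_sum mulr_suml mulr_sumr -sumrB; apply: eq_bigr => k _.
  by rewrite rmarginal_nat natr_xlnx_div.
have hT : \sum_c (T c)%:R = N%:R :> R by rewrite -natr_sum sT.
have hM i : \sum_k (marginal T i k)%:R = N%:R :> R.
  by rewrite -natr_sum sum_marginal sT.
have -> : \sum_c ln (T c)`!%:R =
    \sum_c e (T c) + (\sum_c xlnx (T c)%:R - N%:R).
  by rewrite -hT -sumrB -big_split; apply: eq_bigr => c _; rewrite E.
rewrite (E N).
have -> : \sum_i \sum_k ln (marginal T i k)`!%:R = \sum_i \sum_k e (marginal T i k)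
    + (\sum_i \sum_k xlnx (marginal T i k)%:R - n%:R * N%:R).
  rewrite mulr_natl -[in X in _ - X](card_ord n) -sumr_const -sumrB -big_split.
  apply: eq_bigr => i _; rewrite -(hM i) -sumrB -big_split.
  by apply: eq_bigr => k _; rewrite E.
set Ec := \sum_c e _; set Em := \sum_i \sum_k e _.
have -> : e N + (xlnx N%:R - N%:R) - (Ec + (\sum_c xlnx (T c)%:R - N%:R)) +
    (Em + (\sum_i \sum_k xlnx (marginal T i k)%:R - n%:R * N%:R)) -
    n%:R * (e N + (xlnx N%:R - N%:R)) +
    (\sum_c xlnx (T c)%:R - N%:R * ln N%:R -
     (\sum_i \sum_k xlnx (marginal T i k)%:R - n%:R * (N%:R * ln N%:R))) =
    e N - Ec + Em - n%:R * e N.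
  by rewrite /xlnx; ring.
set U := 1 + ln N.+1%:R in eP *.
have U0 : 0 <= U by have /andP[h1 h2] := eP _ (leqnn N); exact: le_trans h2.
have /andP[eN0 eN1] := eP _ (leqnn N).
have Ec0 : 0 <= Ec by apply: sumr_ge0 => c _; have /andP[] := eP _ (TN c).
have Ec1 : Ec <= #|{: cell}|%:R * U.
  rewrite mulr_natl -sumr_const; apply: ler_sum => c _.
  by have /andP[] := eP _ (TN c).
have Em0 : 0 <= Em.
  by apply: sumr_ge0 => i _; apply: sumr_ge0 => k _; have /andP[] := eP _ (mN i k).
have Em1 : Em <= n%:R * #|B|%:R * U.
  rewrite -mulrA mulr_natl -[in leRHS](card_ord n) -sumr_const; apply: ler_sum => i _.
  rewrite mulr_natl -sumr_const; apply: ler_sum => k _.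
  by have /andP[] := eP _ (mN i k).
have nE0 : 0 <= n%:R * e N by rewrite mulr_ge0.
have nE1 : n%:R * e N <= n%:R * U by rewrite ler_wpM2l.
rewrite !natrD natrM !mulrDl mul1r.
have nU : 0 <= n%:R * U by rewrite mulr_ge0.
have cU : 0 <= #|{: cell}|%:R * U by rewrite mulr_ge0.
have bU : 0 <= n%:R * #|B|%:R * U by rewrite !mulr_ge0.
rewrite ler_norml; apply/andP; split; lra.
Qed.

Lemma card_perm_family (N : nat) : #|{: {ffun 'I_n -> 'S_N}}| = (N`! ^ n)%N.
Proof. by rewrite card_ffun card_ord card_Sn. Qed.

Lemma unif_perm_type_le (N : nat) (b : {ffun 'I_n -> N.-tuple B}) T :
  unif_perm R [set s | joint_tuple b s \in type_class N T]%SET <= type_weight N T.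
Proof.
by rewrite /unif_perm card_perm_family ler_wpM2r// ler_nat card_joint_type_le.
Qed.

Lemma unif_perm_type (N : nat) (b : {ffun 'I_n -> N.-tuple B}) T :
  (forall i k, count_mem k (b i) = marginal T i k) ->
  unif_perm R [set s | joint_tuple b s \in type_class N T]%SET = type_weight N T.
Proof.
by move=> bT; rewrite /unif_perm card_perm_family card_joint_type.
Qed.

End information.

(** * Exponential rates *)

Section limits.
Variable R : realType.
Implicit Types (u : (\bar R)^nat) (c : \bar R).

Lemma limn_esup_le_near u c :
  (\forall N \near \oo, (u N <= c)%E) -> (limn_esup u <= c)%E.
Proof.
move=> H; apply: ereal_inf_le; exists (ereal_sup (u @` [set N | (u N <= c)%E])).
  by exists [set N | (u N <= c)%E].
by apply: ge_ereal_sup => _ [N /= uN <-].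
Qed.

Lemma limn_einf_ge_near u c :
  (\forall N \near \oo, (c <= u N)%E) -> (c <= limn_einf u)%E.
Proof.
move=> H; rewrite /limn_einf leeNr; apply: limn_esup_le_near.
by apply: filterS H => N; rewrite leeN2.
Qed.

Lemma near_ln_small (K e : R) : 0 < e ->
  \forall N \near \oo, K * (1 + ln N.+1%:R) <= e * N%:R.
Proof.
move=> e0; pose k : R := `|K| + 1; have k0 : 0 < k by rewrite ltr_wpDl.
(* By [ln (d x) <= d x - 1] the logarithm is at most [d x] plus a constant. The slope [d] uses up
   one half of [e]; the other half absorbs the constant for large [N]. *)
have [d d0 kd] : exists2 d, 0 < d & k * d = e / 2.
  by exists (e / 2 / k); rewrite ?divr_gt0// mulrC divfK// gt_eqF.
near=> N.
have N1 : 0 < N.+1%:R :> R by rewrite ltr0n.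
have l0 : 0 <= ln N.+1%:R :> R by rewrite ln_ge0// ler1n.
have h : ln N.+1%:R <= d * N.+1%:R - 1 - ln d.
  have := @ln_le_subr1 R (d * N.+1%:R); rewrite mulr_gt0// lnM ?posrE// => /(_ isT).
  by rewrite [ln d + _]addrC -lerBrDr.
apply: (@le_trans _ _ (k * (1 + ln N.+1%:R))).
  by rewrite ler_wpM2r ?addr_ge0// /k (le_trans (ler_norm K))// lerDl.
apply: (@le_trans _ _ (k * (d * N.+1%:R - ln d))).
  by rewrite ler_wpM2l ?(ltW k0)//; lra.
rewrite mulrBr mulrA kd -[N.+1%:R]natr1.
have : k * (d - ln d) <= e / 2 * N%:R.
  rewrite -ler_pdivrMl ?divr_gt0//; near: N; exact: nbhs_infty_ger.
rewrite mulrBr kd; lra.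
Unshelve. all: by end_near. Qed.

(** The case [g <= 0] occurs for an empty set of permutations, whose logarithm is [-oo]. *)
Lemma lne_le_expR (g x : R) : g <= expR x -> (lne g%:E <= x%:E)%E.
Proof.
move=> gx; have [g0|g0] := leP g 0; first by rewrite le0_lneNy ?lee_fin// leNye.
by rewrite lne_EFin// lee_fin -(expRK x) ler_ln// posrE// expR_gt0.
Qed.

Lemma lne_ge_expR (g x : R) : expR x <= g -> (x%:E <= lne g%:E)%E.
Proof.
move=> gx; have g0 : 0 < g by apply: lt_le_trans gx; exact: expR_gt0.
by rewrite lne_EFin// lee_fin -(expRK x) ler_ln// posrE// expR_gt0.
Qed.

Lemma limn_esup_log_rate_le (n : nat)
    (D : forall N : nat, nat -> R -> {set {ffun 'I_n -> 'S_N}}) m delta (c K : R) :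
  (\forall N \near \oo, unif_perm R (D N m delta) <=
     expR (N%:R * c + K * (1 + ln N.+1%:R))) ->
  (limn_esup (log_rate D m delta) <= c%:E)%E.
Proof.
move=> H; apply/lee_addgt0Pr => e e0; apply: limn_esup_le_near.
near=> N.
have N0 : 0 < N%:R :> R by rewrite ltr0n; near: N; exact: nbhs_infty_gt.
rewrite /log_rate.
apply: (@le_trans _ _ ((N%:R^-1)%:E * (N%:R * c + K * (1 + ln N.+1%:R))%:E)%E).
  rewrite lee_pmul2l ?lte_fin ?invr_gt0//; apply: lne_le_expR.
  by near: N.
rewrite -EFinM -EFinD lee_fin ler_pdivrMl// [leRHS]mulrDr lerD2l [leRHS]mulrC.
by near: N; exact: near_ln_small.
Unshelve. all: by end_near. Qed.

Lemma limn_einf_log_rate_ge (n : nat)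
    (D : forall N : nat, nat -> R -> {set {ffun 'I_n -> 'S_N}}) m delta (c : R)
    (x : R^nat) :
  x @ \oo --> c ->
  (\forall N \near \oo, expR (N%:R * x N) <= unif_perm R (D N m delta)) ->
  (c%:E <= limn_einf (log_rate D m delta))%E.
Proof.
move=> xc H; apply/lee_subgt0Pr => e e0; apply: limn_einf_ge_near.
near=> N.
have N0 : 0 < N%:R :> R by rewrite ltr0n; near: N; exact: nbhs_infty_gt.
rewrite /log_rate.
apply: (@le_trans _ _ ((N%:R^-1)%:E * (N%:R * x N)%:E)%E); last first.
  rewrite lee_pmul2l ?lte_fin ?invr_gt0//; apply: lne_ge_expR.
  by near: N.
rewrite -EFinM -EFinB lee_fin mulrA mulVf ?gt_eqF// mul1r lerBlDr -lerBlDl.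
have : `|c - x N| <= e by near: N; move/cvgrPdist_le : xc; apply.
by apply: le_trans; rewrite ler_norm.
Unshelve. all: by end_near. Qed.

End limits.

(** * Sorted words *)

Section sorted.
Local Open Scope nat_scope.

Definition nondecreasing_ord (N : nat) (f : 'I_N -> nat) :=
  forall j k : 'I_N, j <= k -> f j <= f k.

Lemma card_ltn_ord (N m : nat) : m <= N -> #|[set j : 'I_N | j < m]%SET| = m.
Proof.
move=> mN; rewrite -sum1_card (eq_bigl (fun j : 'I_N => j < m)); last first.
  by move=> j; rewrite inE.
by rewrite -(big_ord_widen _ (fun=> 1) mN) sum1_card card_ord.
Qed.

(** A sublevel set of a nondecreasing function is an initial segment of the indices, so its
    cardinality determines it. *)
Lemma nondecreasing_ordP (N : nat) (f : 'I_N -> nat) (a : nat) (j : 'I_N) :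
  nondecreasing_ord f -> (f j <= a) = (j < #|[set k : 'I_N | f k <= a]%SET|).
Proof.
move=> fm; apply/idP/idP => [fj|].
  rewrite -[X in X <= _](@card_ltn_ord N j.+1)//; apply/subset_leq_card/fintype.subsetP => k.
  by rewrite !inE ltnS => /fm/leq_trans; apply.
apply: contraTT; rewrite -ltnNge -leqNgt => fj.
rewrite -[X in _ <= X](@card_ltn_ord N j) ?(ltnW (ltn_ord j))//.
apply/subset_leq_card/fintype.subsetP => k; rewrite !inE => fk; rewrite ltnNge.
by apply/negP => /fm/(leq_trans fj); rewrite ltnNge fk.
Qed.

(** A sorted word is determined by its [M] cumulative letter counts, each at most [N]. Growth
    polynomial in [N] makes the choice of a sorted word free on the exponential scale. *)
Lemma card_nondecreasing_tuple (N M : nat) (S : {set N.-tuple 'I_M}) :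
  (forall b, b \in S -> nondecreasing_ord (fun j => val (tnth b j))) ->
  #|S| <= N.+1 ^ M.
Proof.
move=> Sm.
pose code (b : N.-tuple 'I_M) : {ffun 'I_M -> 'I_N.+1} :=
  [ffun k : 'I_M => inord #|[set j : 'I_N | tnth b j <= k]%SET|].
have codeE b k : (code b k : nat) = #|[set j : 'I_N | tnth b j <= k]%SET|.
  by rewrite ffunE inordK// ltnS (leq_trans (max_card _))// card_ord.
have inj : {in S &, injective code}.
  move=> b b' /Sm bm /Sm b'm bb'; apply: eq_from_tnth => j; apply/val_inj.
  have H (k : nat) : (val (tnth b j) <= k) = (val (tnth b' j) <= k).
    have [kM|kM] := ltnP k M; last first.
      by rewrite !(leq_trans (ltnW (ltn_ord _)) kM).
    rewrite (nondecreasing_ordP _ _ bm) (nondecreasing_ordP _ _ b'm).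
    have := codeE b (Ordinal kM); have := codeE b' (Ordinal kM).
    by rewrite bb' => -> /= ->.
  by apply/eqP; rewrite eqn_leq H leqnn -H leqnn.
rewrite -(card_in_imset inj) (leq_trans (max_card _))//.
by rewrite card_ffun !card_ord.
Qed.

End sorted.

(** * Union bound over sorted words and joint types *)

Section upper_types.
Variables (R : realType) (n N M : nat).
Hypothesis N_gt0 : (0 < N)%N.
Local Notation cell := {ffun 'I_n -> 'I_M}.

Lemma card_le_sum_cover (I S : finType) (D : {set S}) (P : pred I)
    (E : I -> {set S}) : (forall s, s \in D -> exists2 i, P i & s \in E i) ->
  (#|D| <= \sum_(i | P i) #|E i|)%N.
Proof.
move=> H; rewrite -sum1_card.
under [leqRHS]eq_bigr do rewrite -sum1_card.
rewrite (exchange_big_dep xpredT)//= [leqLHS]big_mkcond; apply: leq_sum => s _.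
case: ifPn => // /H[i Pi sE]; rewrite (bigD1 i)/= ?Pi//.
Qed.

(** The first bracket is the exponent of [N.+1] that bounds the number of pairs of sorted words and
    types; the second comes from [type_weight_bounds]. *)
Definition types_bound : R :=
  ((n * M + #|{: cell}|) + (#|{: cell}| + n * #|'I_M| + n + 1))%:R.

(** The words [b] may depend on [s], so the union runs over all pairs of sorted words and joint
    types within [e] of [theta]. Each pair contributes at most its type weight, and continuity of
    [info] replaces the type by [theta] at the cost of [eta]. *)
Lemma unif_perm_le_types (D : {set {ffun 'I_n -> 'S_N}}) (theta : cell -> R)
    (e eta : R) :
  (forall s, s \in D -> exists2 b : {ffun 'I_n -> N.-tuple 'I_M},
     (forall i, nondecreasing_ord (fun j => val (tnth (b i) j))) &
     forall c, `|(count_mem c (joint_tuple b s))%:R / N%:R - theta c| <= e) ->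
  (forall theta', (forall c, `|theta' c - theta c| <= e) ->
     `|info theta' - info theta| <= eta) ->
  unif_perm R D <= expR (N%:R * (- info theta + eta) + types_bound * (1 + ln N.+1%:R)).
Proof.
move=> HD Hinfo.
pose S : {set N.-tuple 'I_M} :=
  [set b : N.-tuple 'I_M | [forall j : 'I_N, forall k : 'I_N, (j <= k)%N ==> (tnth b j <= tnth b k)%N]]%SET.
have SP b : reflect (nondecreasing_ord (fun j => val (tnth b j))) (b \in S).
  rewrite inE; apply: (iffP forallP) => [H j k jk|H j].
    by have /forallP/(_ k)/implyP := H j; apply.
  by apply/forallP => k; apply/implyP; exact: H.
pose P (p : {ffun 'I_n -> N.-tuple 'I_M} * {ffun cell -> 'I_N.+1}) :=
  [&& [forall i, p.1 i \in S], (\sum_c p.2 c == N)%N &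
      [forall c, `|(p.2 c)%:R / N%:R - theta c| <= e]].
pose E (p : {ffun 'I_n -> N.-tuple 'I_M} * {ffun cell -> 'I_N.+1}) :=
  [set s | joint_tuple p.1 s \in type_class N (fun c => p.2 c : nat)]%SET.
have cov s : s \in D -> exists2 p, P p & s \in E p.
  move=> /HD[b bm bc].
  pose T : {ffun cell -> 'I_N.+1} := [ffun c => inord (count_mem c (joint_tuple b s))].
  have TE c : (T c : nat) = count_mem c (joint_tuple b s).
    by rewrite ffunE inordK// ltnS (leq_trans (count_size _ _))// size_tuple.
  exists (b, T); last by rewrite finset.in_set; apply/type_classP => c; rewrite /= TE.
  apply/and3P; split => /=; first by apply/forallP => i; exact/SP.
    under eq_bigr do rewrite TE.
    by rewrite sum_count_mem size_tuple.
  by apply/forallP => c; rewrite TE.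
have Np : 0 < N%:R :> R by rewrite ltr0n.
pose K1 : R := (#|{: cell}| + n * #|'I_M| + n + 1)%:R.
pose W : R := expR (N%:R * (- info theta + eta) + K1 * (1 + ln N.+1%:R)).
have EW p : P p -> unif_perm R (E p) <= W.
  move=> /and3P[_ /eqP sT /forallP pT].
  apply: le_trans (unif_perm_type_le _ _ _) _.
  have w0 : 0 <= type_weight R N (fun c => p.2 c : nat) by rewrite divr_ge0.
  have [w1|w1] := leP (type_weight R N (fun c => p.2 c : nat)) 0.
    by rewrite (le_trans w1)// expR_ge0.
  rewrite -[leLHS]lnK ?posrE// ler_expR.
  have := type_weight_bounds R N_gt0 sT; have := Hinfo _ pT.
  rewrite -/K1 !ler_norml => /andP[h1 h2] /andP[h3 h4].
  set L := K1 * _ in h3 h4 *; set I' := info _ in h1 h2 h3 h4 *.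
  have : N%:R * (info theta - eta) <= N%:R * I' by rewrite ler_wpM2l ?(ltW Np)//; lra.
  lra.
have cP : (#|[pred p | P p]| <= N.+1 ^ (n * M + #|{: cell}|))%N.
  apply: (@leq_trans #|[predX family (fun _ : 'I_n => mem S) & {: {ffun cell -> 'I_N.+1}}]|).
    apply/subset_leq_card/fintype.subsetP => p; rewrite !inE => /and3P[/forallP pS _ _].
    by rewrite andbT; apply/familyP => i; exact: pS.
  rewrite cardX expnD leq_mul//; last by rewrite card_ffun card_ord.
  rewrite card_family foldrE big_map big_enum/= prod_nat_const card_ord.
  have leX m k a : (m <= k)%N -> (m ^ a <= k ^ a)%N.
    by case: a => // a mk; rewrite leq_exp2r.
  rewrite mulnC expnM; apply: leX.
  rewrite (eq_card (B := mem S))//; apply: card_nondecreasing_tuple => b.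
  by move/SP.
have : unif_perm R D <= \sum_(p | P p) unif_perm R (E p).
  rewrite /unif_perm -mulr_suml ler_wpM2r// -natr_sum ler_nat.
  exact: card_le_sum_cover.
move/le_trans; apply; apply: (@le_trans _ _ (\sum_(p | P p) W)).
  by apply: ler_sum => p; exact: EW.
rewrite sumr_const -[leLHS]mulr_natl.
apply: (@le_trans _ _ ((N.+1 ^ (n * M + #|{: cell}|))%:R * W)).
  by rewrite ler_wpM2r ?expR_ge0// ler_nat.
rewrite natrX -[N.+1%:R in leLHS]lnK ?posrE ?ltr0n// -expRM_natl -expRD ler_expR.
have -> : types_bound = (n * M + #|{: cell}|)%:R + K1 by rewrite /types_bound natrD.
by rewrite addrCA lerD2l mulrDl lerD2r mulrDr mulr1 lerDr.
Qed.

End upper_types.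

(** * Bounded measurable functions *)

Section bounded_measurable.
Context d (T : measurableType d) (R : realType).
Implicit Types (f g : T -> R).

(** A class closed under the ring operations and integrable against every finite measure, so that
    the integrals below carry no integrability conditions. *)
Definition bmfun f := measurable_fun [set: T] f /\
  exists C, forall t, `|f t| <= C.

Lemma bmfun_cst (c : R) : bmfun (fun=> c).
Proof. by split=> //; exists `|c|. Qed.

Lemma bmfunD f g : bmfun f -> bmfun g -> bmfun (fun t => f t + g t).
Proof.
move=> [mf [C fC]] [mg [C' gC]]; split; first exact: measurable_funD.
by exists (C + C') => t; rewrite (le_trans (ler_normD _ _))// lerD.
Qed.

Lemma bmfunM f g : bmfun f -> bmfun g -> bmfun (fun t => f t * g t).
Proof.
move=> [mf [C fC]] [mg [C' gC]]; split; first exact: measurable_funM.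
by exists (C * C') => t; rewrite normrM ler_pM.
Qed.

Lemma bmfunZ c f : bmfun f -> bmfun (fun t => c * f t).
Proof. exact/bmfunM/bmfun_cst. Qed.

Lemma bmfunN f : bmfun f -> bmfun (fun t => - f t).
Proof.
by move=> /(bmfunZ (-1)); congr bmfun; apply/funext => t; rewrite mulN1r.
Qed.

Lemma bmfunB f g : bmfun f -> bmfun g -> bmfun (fun t => f t - g t).
Proof. by move=> bf bg; apply: bmfunD => //; exact: bmfunN. Qed.

Lemma bmfun_norm f : bmfun f -> bmfun (fun t => `|f t|).
Proof.
move=> [mf [C fC]]; split; first exact: measurableT_comp.
by exists C => t; rewrite normr_id.
Qed.

Lemma bmfun_sum (I : Type) (s : seq I) (F : I -> T -> R) :
  (forall i, bmfun (F i)) -> bmfun (fun t => \sum_(i <- s) F i t).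
Proof.
move=> bF; elim: s => [|i s IH].
  by under eq_fun do rewrite big_nil; exact: bmfun_cst.
by under eq_fun do rewrite big_cons; exact: bmfunD.
Qed.

Lemma bmfun_prod (I : Type) (s : seq I) (F : I -> T -> R) :
  (forall i, bmfun (F i)) -> bmfun (fun t => \prod_(i <- s) F i t).
Proof.
move=> bF; elim: s => [|i s IH].
  by under eq_fun do rewrite big_nil; exact: bmfun_cst.
by under eq_fun do rewrite big_cons; exact: bmfunM.
Qed.

Lemma bmfun_indic (A : set T) : measurable A -> bmfun (\1_A : T -> R).
Proof.
move=> mA; split => //; exists 1 => t.
by rewrite indicE; case: (_ \in _); rewrite ?normr1 ?normr0.
Qed.

Lemma bmfun_bool (b : T -> bool) : measurable [set t | b t] ->
  bmfun (fun t => (b t)%:R : R).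
Proof.
move=> /bmfun_indic; congr bmfun; apply/funext => t.
by rewrite indicE; congr (_%:R); congr nat_of_bool; apply/idP/idP; rewrite inE.
Qed.

End bounded_measurable.

Section bounded_integral.
Context d (T : measurableType d) (R : realType).
Variable mu : {finite_measure set T -> \bar R}.
Implicit Types (f g : T -> R).

Lemma bmfun_integrable f : bmfun f -> mu.-integrable [set: T] (EFin \o f).
Proof.
move=> [mf [C fC]]; apply: measurable_bounded_integrable => //.
  exact: fin_num_fun_lty.
exists C; split; first exact: num_real.
by move=> M CM t _ /=; apply: (le_trans (fC t)); exact: ltW.
Qed.

Lemma bm_RintegralD f g : bmfun f -> bmfun g ->
  \int[mu]_t (f t + g t) = \int[mu]_t f t + \int[mu]_t g t.
Proof. by move=> bf bg; rewrite RintegralD//; exact: bmfun_integrable. Qed.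

Lemma bm_RintegralB f g : bmfun f -> bmfun g ->
  \int[mu]_t (f t - g t) = \int[mu]_t f t - \int[mu]_t g t.
Proof. by move=> bf bg; rewrite RintegralB//; exact: bmfun_integrable. Qed.

Lemma bm_RintegralZl c f : bmfun f ->
  \int[mu]_t (c * f t) = c * \int[mu]_t f t.
Proof. by move=> bf; rewrite RintegralZl//; exact: bmfun_integrable. Qed.

Lemma bm_Rintegral_cst c : \int[mu]_t c = c * fine (mu [set: T]).
Proof. by rewrite Rintegral_cst. Qed.

Lemma bm_le_Rintegral f g : bmfun f -> bmfun g -> (forall t, f t <= g t) ->
  \int[mu]_t f t <= \int[mu]_t g t.
Proof. by move=> bf bg fg; apply: le_Rintegral => //; exact: bmfun_integrable. Qed.

Lemma bm_le_normr_Rintegral f : bmfun f ->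
  `|\int[mu]_t f t| <= \int[mu]_t `|f t|.
Proof. by move=> bf; apply: le_normr_Rintegral => //; exact: bmfun_integrable. Qed.

Lemma bm_Rintegral_sum (I : Type) (s : seq I) (F : I -> T -> R) :
  (forall i, bmfun (F i)) ->
  \int[mu]_t (\sum_(i <- s) F i t) = \sum_(i <- s) \int[mu]_t F i t.
Proof.
move=> bF; elim: s => [|i s IH].
  by under eq_Rintegral do rewrite big_nil; rewrite big_nil bm_Rintegral_cst mul0r.
under eq_Rintegral do rewrite big_cons.
by rewrite big_cons bm_RintegralD ?IH//; exact: bmfun_sum.
Qed.

Lemma Rintegral_indic (A : set T) : measurable A ->
  \int[mu]_t (\1_A t : R) = fine (mu A).
Proof. by move=> mA; rewrite /Rintegral integral_indic// setIT. Qed.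

Lemma Rintegral_bool (b : T -> bool) : measurable [set t | b t] ->
  \int[mu]_t ((b t)%:R : R) = fine (mu [set t | b t]).
Proof.
move=> mb; rewrite -Rintegral_indic//; apply: eq_Rintegral => t _.
by rewrite indicE; congr (_%:R); congr nat_of_bool; apply/idP/idP; rewrite inE.
Qed.

End bounded_integral.

Lemma Rintegral_probability_cst d (T : measurableType d) (R : realType)
  (P : probability T R) (c : R) : \int[P]_t c = c.
Proof.
by rewrite Rintegral_cst// [X in fine X]probability_setT mulr1.
Qed.

(** * From moments to cell frequencies *)

Section grid.
Variables (R : realType) (A : R).
Hypothesis A_gt0 : 0 < A.

Definition mesh (K : nat) : R := 2 * A / (2 ^ K)%:R.

Definition grid (K a : nat) : R := - A + a%:R * mesh K.

(* Bins [0] and [2 ^ K + 1] collect the points outside (-A, A]. *)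
Definition bin (K : nat) (s : R) : 'I_(2 ^ K).+2 :=
  inord (\sum_(a < (2 ^ K).+1) (grid K a < s)%R)%N.

Lemma mesh_gt0 K : 0 < mesh K.
Proof. by rewrite divr_gt0 ?mulr_gt0// ltr0n expn_gt0. Qed.

Lemma grid_le K a b : (a <= b)%N -> grid K a <= grid K b.
Proof. by move=> ab; rewrite lerD2l ler_wpM2r ?ler_nat// ltW// mesh_gt0. Qed.

Lemma gridS K a : grid K a.+1 = grid K a + mesh K.
Proof. by rewrite /grid -natr1; ring. Qed.

Lemma grid0 K : grid K 0 = - A. Proof. by rewrite /grid mul0r addr0. Qed.

Lemma grid_max K : grid K (2 ^ K) = A.
Proof.
rewrite /grid /mesh mulrCA divff ?mulr1; first by ring.
by rewrite pnatr_eq0 -lt0n expn_gt0.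
Qed.

(** The grid is increasing, so the grid points below [s] form an initial segment. Through this
    equivalence facts about bins reduce to half-lines. *)
Lemma bin_le K s a : (a <= 2 ^ K)%N -> (bin K s <= a)%N = (s <= grid K a).
Proof.
move=> aK; rewrite inordK; last first.
  rewrite ltnS -[leqRHS]card_ord -sum1_card; apply: leq_sum => i _.
  exact: leq_b1.
have cS c : (c <= (2 ^ K).+1)%N -> (\sum_(i < (2 ^ K).+1) (i < c)%N = c)%N.
  move=> cK; rewrite -[RHS](card_ltn_ord cK) -sum1_card [RHS]big_mkcond.
  by apply: eq_bigr => i _; rewrite finset.inE; case: (i < c)%N.
have [sa|sa] := leP s (grid K a).
  rewrite -[leqRHS](cS a) ?(leqW aK)//; apply: leq_sum => i _.
  have [//|ai] := ltnP i a; first by case: (_ < _).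
  by rewrite ltNge (le_trans sa)// grid_le.
apply/negbTE; rewrite -ltnNge -[X in (X <= _)%N](cS a.+1)//.
apply: leq_sum => i _; have [ia|//] := ltnP i a.+1.
by rewrite (le_lt_trans _ sa)// grid_le.
Qed.

Lemma bin_eq0 K s : (bin K s == 0 :> nat) = (s <= - A).
Proof. by rewrite -leqn0 bin_le// grid0. Qed.

Lemma bin_dist K s (k : nat) : (0 < k <= 2 ^ K)%N -> bin K s = k :> nat ->
  grid K k - mesh K < s <= grid K k.
Proof.
move=> /andP[k0 kK] sk; rewrite -bin_le// sk leqnn andbT.
have -> : grid K k - mesh K = grid K k.-1.
  by rewrite -{1}(prednK k0) gridS addrK.
rewrite ltNge -bin_le ?sk; last by rewrite (leq_trans _ kK)// leq_pred.
by rewrite -ltnNge prednK.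
Qed.

Lemma bin_le_mono K s s' : s <= s' -> (bin K s <= bin K s')%N.
Proof.
move=> ss'; have [h|h] := leqP (bin K s') (2 ^ K); last first.
  by rewrite (leq_trans _ h)// leq_ord.
by rewrite bin_le// (le_trans ss')// -bin_le.
Qed.

End grid.

(** * Polynomial approximation of step functions *)

Section step_polynomial.
Variable R : realType.
Implicit Types (s t y e : R).

Lemma bernoulli_ineq y (k : nat) : -1 <= y -> 1 + k%:R * y <= (1 + y) ^+ k.
Proof.
move=> y1; elim: k => [|k IH]; first by rewrite mul0r addr0 expr0.
have y1' : 0 <= 1 + y by lra.
rewrite exprS; apply: le_trans (ler_wpM2l y1' IH).
rewrite -[k.+1%:R]natr1; have : 0 <= k%:R * y ^+ 2 by rewrite mulr_ge0// sqr_ge0.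
by rewrite expr2; nra.
Qed.

Lemma exprn_lt_eps y e : 0 <= y < 1 -> 0 < e -> exists n0, forall n, (n0 <= n)%N -> y ^+ n <= e.
Proof.
move=> /andP[y0 y1] e0.
have /cvgrPdist_le/(_ e e0)[n0 _ H] : (y ^+ n @[n --> \oo] --> 0).
  by apply: cvg_expr; rewrite ger0_norm.
by exists n0 => n /H; rewrite sub0r normrN; apply: le_trans; rewrite ler_norm.
Qed.

(* The polynomials (1 - y^n)^(2^n) tend to 1 for y < 1/2 and to 0 for y > 1/2. *)
Lemma steep_bounds y (n : nat) : 0 <= y <= 1 ->
  [/\ 0 <= (1 - y ^+ n) ^+ (2 ^ n) <= 1,
      1 - (2 * y) ^+ n <= (1 - y ^+ n) ^+ (2 ^ n) &
      (1 - y ^+ n) ^+ (2 ^ n) * (1 + (2 * y) ^+ n) <= 1].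
Proof.
move=> /andP[y0 y1]; have yn : 0 <= y ^+ n <= 1 by rewrite exprn_ge0//= exprn_ile1.
move: yn => /andP[v0 v1]; have e : (2 * y) ^+ n = (2 ^ n)%:R * y ^+ n.
  by rewrite exprMn natrX.
have b0 : 0 <= (1 - y ^+ n) ^+ (2 ^ n) by rewrite exprn_ge0// subr_ge0.
rewrite e; split.
- by rewrite b0/= exprn_ile1 ?subr_ge0// lerBlDr lerDl.
- by rewrite -mulrN bernoulli_ineq// lerN2.
- apply: (@le_trans _ _ ((1 - y ^+ n) ^+ (2 ^ n) * (1 + y ^+ n) ^+ (2 ^ n))).
    rewrite ler_wpM2l// bernoulli_ineq//; lra.
  rewrite -exprMn exprn_ile1//; nra.
Qed.

(** An affine map [q] sends [[-2A, 2A]] into the unit interval and [t] to 1/2. At distance [theta]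
    from [t], [2 q] differs from 1 by at least [z = theta / (4 A)], so the powers in [steep_bounds]
    give errors at most [e] for large [n]. *)
Lemma step_poly (A t e theta : R) : 0 < A -> `|t| <= 2 * A -> 0 < e -> 0 < theta ->
  exists p : {poly R}, forall s, `|s| <= 2 * A ->
    [/\ 0 <= p.[s] <= 1, s <= t - theta -> 1 - e <= p.[s] &
        t + theta <= s -> p.[s] <= e].
Proof.
move=> A0 tA e0 th0.
(* This ensures [z < 1]; a smaller [theta] only strengthens the conclusion. *)
wlog thA : theta th0 / theta <= A.
  move=> H; have [||p pP] := H (Num.min theta A); rewrite ?lt_min ?ge_min ?th0 ?lexx ?orbT//.
  exists p => s /pP[p1 p2 p3]; split => // st; [apply: p2|apply: p3].
    by apply: (le_trans st); rewrite lerD2l lerN2 ge_min lexx.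
  by apply: le_trans st; rewrite lerD2l ge_min lexx.
pose z := theta / (4 * A).
have A8 : 0 < 8 * A by rewrite mulr_gt0.
have z0 : 0 < z by rewrite divr_gt0// mulr_gt0.
have z1 : z < 1 by rewrite ltr_pdivrMr ?mulr_gt0//; lra.
have zE : 2 * (theta / (8 * A)) = z.
  by rewrite /z; field; rewrite gt_eqF.
have [n1 H1] : exists n0, forall n, (n0 <= n)%N -> (1 - z) ^+ n <= e.
  by apply: exprn_lt_eps => //; rewrite subr_ge0 (ltW z1)/=; lra.
have [n2 H2] : exists n0, forall n, (n0 <= n)%N -> (1 + z)^-1 ^+ n <= e.
  by apply: exprn_lt_eps => //; rewrite invr_ge0 invf_lt1; lra.
pose n := maxn n1 n2.
pose q : {poly R} := (2^-1)%:P + (8 * A)^-1 *: ('X - t%:P).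
exists ((1 - q ^+ n) ^+ (2 ^ n)) => s sA.
have qE : q.[s] = 2^-1 + (8 * A)^-1 * (s - t) by rewrite /q !hornerE.
have -> : ((1 - q ^+ n) ^+ (2 ^ n)).[s] = (1 - q.[s] ^+ n) ^+ (2 ^ n).
  by rewrite !(hornerE, horner_exp).
set y := q.[s] in qE *.
have dE x : (8 * A)^-1 * x = x / (8 * A) by rewrite mulrC.
have y01 : 0 <= y <= 1.
  rewrite qE; move: tA sA; rewrite !ler_norml => /andP[t1 t2] /andP[s1 s2].
  have : - 2^-1 <= (8 * A)^-1 * (s - t) <= 2^-1.
    by rewrite dE ler_pdivlMr// ler_pdivrMr//; apply/andP; split; lra.
  by move=> /andP[h1 h2]; apply/andP; split; lra.
have [b1 b2 b3] := steep_bounds n y01; split => //.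
- move=> st; apply: le_trans b2; rewrite lerD2l lerN2.
  apply: (le_trans _ (H1 n (leq_maxl _ _))); move/andP : y01 => [y0 y1].
  rewrite lerXn2r ?nnegrE ?mulr_ge0//; first by lra.
  have : (8 * A)^-1 * (s - t) <= - (theta / (8 * A)).
    by rewrite dE -mulNr ler_wpM2r ?invr_ge0 ?(ltW A8)//; lra.
  by rewrite qE -zE; lra.
- move=> st; have zy : 1 + z <= 2 * y.
    have : theta / (8 * A) <= (8 * A)^-1 * (s - t).
      by rewrite dE ler_wpM2r ?invr_ge0 ?(ltW A8)//; lra.
    by rewrite qE -zE; lra.
  apply: (le_trans _ (H2 n (leq_maxr _ _))).
  have z10 : 0 < 1 + z by lra.
  rewrite exprVn -[leRHS]mul1r ler_pdivlMr ?exprn_gt0//.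
  apply: le_trans b3; rewrite ler_wpM2l ?(andP b1).1//.
  apply: (@le_trans _ _ ((2 * y) ^+ n)); last by rewrite lerDr.
  by rewrite lerXn2r ?nnegrE// ?(ltW z10)// (le_trans (ltW z10)).
Qed.

(** A high even power dominates any given polynomial far out. The scale [3 / 2 * A] lies between [A]
    and [2 * A]: the power dominates for [|s| >= 2 * A], whereas for [|s| <= A], where the random
    variables live, it is at most [(2 / 3) ^+ (2 * M)]. *)
Lemma poly_tail (A e : R) (p : {poly R}) : 1 <= A -> 0 < e -> exists M : nat,
  (forall s, 2 * A <= `|s| -> `|p.[s]| <= (s / (3 / 2 * A)) ^+ (2 * M)) /\
  (2 / 3) ^+ (2 * M) <= e.
Proof.
move=> A1 e0; have A0 : 0 < A by lra.
pose C := \sum_(i < size p) `|p`_i|.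
pose D := 3 / 2 * A; have D0 : 0 < D by rewrite mulr_gt0//; lra.
have C0 : 0 <= C by apply: sumr_ge0.
pose K := C * D ^+ size p + 1.
have K0 : 0 < K by rewrite ltr_wpDl// mulr_ge0// exprn_ge0// ltW.
have [n1 H1] : exists n0, forall n, (n0 <= n)%N -> (2 / 3) ^+ n <= e.
  by apply: exprn_lt_eps => //; apply/andP; split; lra.
have [n2 H2] : exists n0, forall n, (n0 <= n)%N -> (3 / 4) ^+ n <= K^-1 :> R.
  by apply: exprn_lt_eps; rewrite ?invr_gt0//; apply/andP; split; lra.
(* The summand [n2 + size p] leaves at least [n2] surplus factors, each at least 4/3, to absorb the
   coefficients of [p]; [n1] serves the second clause. *)
exists (n1 + (n2 + size p))%N; split; last by apply: H1; rewrite mul2n -addnn; lia.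
move=> s sA; set m := (2 * _)%N.
have s1 : 1 <= `|s| by apply: le_trans sA; lra.
have v1 : 4 / 3 <= `|s| / D by rewrite ler_pdivlMr// /D; lra.
have mE : m = (size p + (m - size p))%N by rewrite subnKC// /m mul2n -addnn; lia.
apply: (@le_trans _ _ (C * `|s| ^+ size p)).
  rewrite horner_coef (le_trans (ler_norm_sum _ _ _))// mulr_suml; apply: ler_sum => i _.
  by rewrite normrM normrX ler_wpM2l// ler_weXn2l// ltnW.
have -> : (s / D) ^+ m = (`|s| / D) ^+ m.
  have h : (s / D) ^+ 2 = (`|s| / D) ^+ 2 by rewrite !expr_div_n real_normK ?num_real.
  by rewrite /m !(exprM _ 2) h.
rewrite mE exprD exprMn exprVn.
have : K <= (`|s| / D) ^+ (m - size p).
  apply: (@le_trans _ _ ((4 / 3) ^+ (m - size p))); last first.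
    by rewrite lerXn2r ?nnegrE//; lra.
  have := H2 (m - size p)%N; rewrite -[(3 / 4)]invrK invf_div exprVn lef_pV2 ?posrE ?exprn_gt0//.
  by apply; rewrite /m mul2n -addnn; lia.
move=> hK; have sp : 0 <= `|s| ^+ size p by rewrite exprn_ge0.
have Dp : 0 < D ^+ size p by rewrite exprn_gt0.
apply: (@le_trans _ _ (`|s| ^+ size p / D ^+ size p * K)); last first.
  by rewrite ler_wpM2l// divr_ge0// ltW.
have -> : `|s| ^+ size p / D ^+ size p * K = C * `|s| ^+ size p + `|s| ^+ size p / D ^+ size p.
  by rewrite /K; field; rewrite gt_eqF.
by rewrite lerDl divr_ge0// ltW.
Qed.

End step_polynomial.

Section kappa.
Variables (R : realType) (N : nat).
Implicit Types x y : 'I_N -> R.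

Lemma kappaD x y : kappa (fun j => x j + y j) = kappa x + kappa y.
Proof. by rewrite /kappa big_split/= mulrDr. Qed.

Lemma kappaZ (c : R) x : kappa (fun j => c * x j) = c * kappa x.
Proof. by rewrite /kappa -mulr_sumr mulrCA. Qed.

Lemma kappaB x y : kappa (fun j => x j - y j) = kappa x - kappa y.
Proof. by rewrite /kappa sumrB mulrBr. Qed.

Lemma kappa_cst (c : R) : (0 < N)%N -> kappa (fun _ : 'I_N => c) = c.
Proof.
move=> N0; rewrite /kappa sumr_const card_ord -[c *+ N]mulr_natl mulKf//.
by rewrite pnatr_eq0 -lt0n.
Qed.

Lemma kappa_sum (I : Type) (s : seq I) (F : I -> 'I_N -> R) :
  kappa (fun j => \sum_(i <- s) F i j) = \sum_(i <- s) kappa (F i).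
Proof. by rewrite /kappa exchange_big/= mulr_sumr. Qed.

Lemma kappa_le x y : (forall j, x j <= y j) -> kappa x <= kappa y.
Proof. by move=> xy; rewrite ler_wpM2l ?invr_ge0//; apply: ler_sum. Qed.

Lemma kappa_norm_le x : `|kappa x| <= kappa (fun j => `|x j|).
Proof.
by rewrite /kappa normrM ger0_norm ?invr_ge0// ler_wpM2l ?invr_ge0// ler_norm_sum.
Qed.

Lemma kappa_bool (b : 'I_N -> bool) :
  kappa (fun j => (b j)%:R : R) = #|b|%:R / N%:R.
Proof.
rewrite /kappa mulrC -natr_sum -sum1_card [in RHS]big_mkcond/=.
by congr (_%:R / _); apply: eq_bigr => j _; rewrite unfold_in; case: (b j).
Qed.

End kappa.

Section polynomial_functions.
Variables (R : realType) (n : nat).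
Implicit Types (a b : ('I_n -> R) -> R) (x : 'I_n -> R).

(** Monomials are words of indices, the form in which [microstates] constrains moments. *)
Definition poly_eval (s : seq (R * seq 'I_n)) x : R :=
  \sum_(cw <- s) cw.1 * \prod_(i <- cw.2) x i.

Definition ispoly a := exists s, forall x, a x = poly_eval s x.

Lemma ispoly_cst (c : R) : ispoly (fun=> c).
Proof. by exists [:: (c, [::])] => x; rewrite /poly_eval big_seq1 big_nil mulr1. Qed.

Lemma ispoly_coord i : ispoly (fun x => x i).
Proof. by exists [:: (1, [:: i])] => x; rewrite /poly_eval !big_seq1 mul1r. Qed.

Lemma ispolyD a b : ispoly a -> ispoly b -> ispoly (fun x => a x + b x).
Proof.
move=> [s sE] [t tE]; exists (s ++ t) => x.
by rewrite sE tE /poly_eval big_cat.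
Qed.

Lemma ispolyM a b : ispoly a -> ispoly b -> ispoly (fun x => a x * b x).
Proof.
move=> [s sE] [t tE].
exists [seq (c.1 * e.1, c.2 ++ e.2) | c <- s, e <- t] => x.
rewrite sE tE /poly_eval big_allpairs_dep mulr_suml; apply: eq_bigr => c _.
rewrite mulr_sumr; apply: eq_bigr => e _ /=.
by rewrite big_cat/=; ring.
Qed.

Lemma ispolyZ c a : ispoly a -> ispoly (fun x => c * a x).
Proof. exact/ispolyM/ispoly_cst. Qed.

Lemma ispolyN a : ispoly a -> ispoly (fun x => - a x).
Proof.
by move=> /(ispolyZ (-1)); congr ispoly; apply/funext => t; rewrite mulN1r.
Qed.

Lemma ispolyB a b : ispoly a -> ispoly b -> ispoly (fun x => a x - b x).
Proof. by move=> pa pb; apply: ispolyD => //; exact: ispolyN. Qed.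

Lemma ispoly_horner (p : {poly R}) i : ispoly (fun x => p.[x i]).
Proof.
elim/poly_ind : p => [|p c IH].
  by under eq_fun do rewrite horner0; exact: ispoly_cst.
under eq_fun do rewrite hornerMXaddC.
apply: ispolyD; last exact: ispoly_cst.
by apply: ispolyM => //; exact: ispoly_coord.
Qed.

End polynomial_functions.

(** * Statistics of micro-states controlled by finitely many moments *)

Section moment_approximation.
Context d (T : measurableType d) (R : realType) (P : probability T R)
  (n : nat) (X : 'I_n -> {RV P >-> R}) (r0 : R).
Hypothesis X_le : forall i t, `|X i t| <= r0.

Lemma fine_expectation (f : T -> R) : fine 'E_P[f]%E = \int[P]_t f t.
Proof. by rewrite expectation.unlock. Qed.

Definition Xv (t : T) : 'I_n -> R := fun i => X i t.

Lemma bmfun_X i : bmfun (fun t => X i t).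
Proof. by split; [exact: measurable_funPT|exists r0]. Qed.

Lemma bmfun_ispoly a : ispoly a -> bmfun (fun t => a (Xv t)).
Proof.
move=> [s sE]; under eq_fun do rewrite sE.
apply: bmfun_sum => cw; apply: bmfunZ; apply: bmfun_prod => i; exact: bmfun_X.
Qed.

(** The thresholds are uniform in [N], because the limit in [N] is taken for fixed [m] and [delta].
    The cutoff [+oo] covers all others. *)
Definition near_moments (Q : forall N, ('I_n -> 'I_N -> R) -> Prop) :=
  exists m0 : nat, exists2 d0 : R, 0 < d0 & forall m delta, (m0 <= m)%N -> delta <= d0 ->
    forall N (z : 'I_n -> 'I_N -> R), (0 < N)%N -> microstates X +oo%E m delta z -> Q N z.

Lemma near_momentsI (Q1 Q2 : forall N, ('I_n -> 'I_N -> R) -> Prop) :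
  near_moments Q1 -> near_moments Q2 -> near_moments (fun N z => Q1 N z /\ Q2 N z).
Proof.
move=> [m1 [d1 d10 H1]] [m2 [d2 d20 H2]]; exists (maxn m1 m2).
exists (Num.min d1 d2); first by rewrite lt_min d10.
move=> m delta; rewrite geq_max le_min => /andP[mm1 mm2] /andP[dd1 dd2] N z N0 zX.
by split; [exact: (H1 m delta)|exact: (H2 m delta)].
Qed.

Lemma near_momentsS (Q1 Q2 : forall N, ('I_n -> 'I_N -> R) -> Prop) :
  (forall N z, (0 < N)%N -> Q1 N z -> Q2 N z) -> near_moments Q1 -> near_moments Q2.
Proof.
move=> Q12 [m1 [d1 d10 H1]]; exists m1, d1 => // m delta mm dd N z N0 /H1 H.
exact/Q12/H.
Qed.

Lemma near_momentsT (Q : forall N, ('I_n -> 'I_N -> R) -> Prop) :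
  (forall N z, (0 < N)%N -> Q N z) -> near_moments Q.
Proof. by move=> H; exists 0%N, 1 => // m delta _ _ N z N0 _; exact: H. Qed.

Lemma near_moments_forall (I : finType)
    (Q : I -> forall N, ('I_n -> 'I_N -> R) -> Prop) :
  (forall i, near_moments (Q i)) -> near_moments (fun N z => forall i, Q i N z).
Proof.
move=> H.
suff /near_momentsS : near_moments (fun N z => forall i, i \in enum I -> Q i N z).
  by apply => N z _ + i => /(_ i); apply; rewrite mem_enum.
elim: (enum I) => [|i s IH]; first exact: near_momentsT.
apply: near_momentsS (near_momentsI (H i) IH) => N z _ [h1 h2] j.
by rewrite inE => /predU1P[->|/h2].
Qed.

Lemma near_moments_word (w : seq 'I_n) (e : R) : 0 < e ->
  near_moments (fun N z => `|kappa (fun j => \prod_(i <- w) z i j)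
    - \int[P]_t (\prod_(i <- w) X i t)| <= e).
Proof.
move=> e0; exists (size w), e => // m delta wm de N z N0 [_ zX].
have [->|w0] := eqVneq w [::].
  under [X in kappa X]eq_fun do rewrite big_nil.
  under eq_Rintegral do rewrite big_nil.
  by rewrite kappa_cst// Rintegral_probability_cst subrr normr0 ltW.
have := zX (size w); rewrite wm lt0n size_eq0 w0 => /(_ isT (fun l => tnth (in_tuple w) l)).
rewrite fine_expectation => /ltW/le_trans/(_ de).
have -> : (fun j => \prod_(i <- w) z i j) =
    (fun j => \prod_(l < size w) z (tnth (in_tuple w) l) j).
  by apply/funext => j; rewrite big_tnth.
by under [in X in _ -> X]eq_Rintegral do rewrite big_tnth.
Qed.

Lemma near_moments_poly a (e : R) : ispoly a -> 0 < e ->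
  near_moments (fun N z => `|kappa (fun j => a (z^~ j)) - \int[P]_t a (Xv t)| <= e).
Proof.
move=> [s sE] e0.
pose K : R := \sum_(cw <- s) `|cw.1| + 1.
have K0 : 0 < K by rewrite ltr_wpDl// sumr_ge0.
suff : near_moments (fun N z => forall cw, cw \in s ->
    `|kappa (fun j => \prod_(i <- cw.2) z i j) -
      \int[P]_t (\prod_(i <- cw.2) X i t)| <= e / K).
  apply: near_momentsS => N z N0 H.
  have -> : (fun j => a (z^~ j)) = (fun j => \sum_(cw <- s) cw.1 * \prod_(i <- cw.2) z i j).
    by apply/funext => j; rewrite sE.
  have -> : \int[P]_t a (Xv t) = \sum_(cw <- s) cw.1 * \int[P]_t (\prod_(i <- cw.2) X i t).
    under eq_Rintegral do rewrite sE.
    have bp (w : seq 'I_n) : bmfun (fun t => \prod_(i <- w) X i t).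
      by apply: bmfun_prod => i; exact: bmfun_X.
    rewrite bm_Rintegral_sum; last by move=> cw; exact/bmfunZ/bp.
    by apply: eq_bigr => cw _; rewrite bm_RintegralZl//; exact: bp.
  rewrite kappa_sum -sumrB; under eq_bigr do rewrite kappaZ -mulrBr.
  rewrite (le_trans (ler_norm_sum _ _ _))//.
  apply: (@le_trans _ _ (\sum_(cw <- s) `|cw.1| * (e / K))).
    rewrite big_seq [leRHS]big_seq; apply: ler_sum => cw cws.
    by rewrite normrM ler_wpM2l//; exact: H.
  rewrite -mulr_suml mulrCA ler_piMr// ?(ltW e0)//.
  by rewrite ler_pdivrMr// mul1r lerDl.
elim: s {sE K K0} (e / _) (divr_gt0 e0 K0) => [|cw s IH] f f0; first exact: near_momentsT.
apply: near_momentsS (near_momentsI (near_moments_word cw.2 f0) (IH f f0)) => N z _ [h1 h2] c.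
by rewrite inE => /predU1P[->|/h2].
Qed.

(* The functions whose empirical averages are controlled by finitely many
   moments; the third clause bounds the error on all of R^n, not only on the
   range of X, because micro-states may be unbounded. *)
Definition appr (g : ('I_n -> R) -> R) :=
  [/\ forall x, 0 <= g x <= 1, bmfun (fun t => g (Xv t)) &
   forall e : R, 0 < e -> exists a b, [/\ ispoly a, ispoly b,
     forall x, `|g x - a x| <= b x, forall t, 0 <= a (Xv t) <= 1 &
     \int[P]_t b (Xv t) <= e]].

(** The error bound [b] is itself a polynomial, so its empirical average is controlled too. One
    [e / 4] comes from the average of [a], one from the average of [b], and the expectation of [b]
    enters twice. *)
Lemma near_moments_appr g (e : R) : appr g -> 0 < e ->
  near_moments (fun N z => `|kappa (fun j => g (z^~ j)) - \int[P]_t g (Xv t)| <= e).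
Proof.
move=> [g01 bg Hg] e0; have e4 : 0 < e / 4 by rewrite divr_gt0.
have [a [b [pa pb gab _ be]]] := Hg _ e4.
apply: near_momentsS (near_momentsI (near_moments_poly pa e4) (near_moments_poly pb e4)).
move=> N z N0 [ha hb].
have h1 : `|kappa (fun j => g (z^~ j)) - kappa (fun j => a (z^~ j))| <= kappa (fun j => b (z^~ j)).
  rewrite -kappaB (le_trans (kappa_norm_le _))//; exact: kappa_le.
have h2 : `|\int[P]_t g (Xv t) - \int[P]_t a (Xv t)| <= \int[P]_t b (Xv t).
  have ba := bmfun_ispoly pa; rewrite -bm_RintegralB//.
  apply: le_trans (bm_le_normr_Rintegral _ _) _; first exact: bmfunB.
  apply: bm_le_Rintegral => //; last exact: bmfun_ispoly.
  exact/bmfun_norm/bmfunB.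
move: ha hb h1 h2; rewrite !ler_norml => /andP[a1 a2] /andP[b1 b2] /andP[c1 c2] /andP[d1 d2].
by apply/andP; split; lra.
Qed.

Lemma appr_cst (c : R) : 0 <= c <= 1 -> appr (fun=> c).
Proof.
move=> /[dup] c01 /andP[c0 c1]; split => //; first exact: bmfun_cst.
move=> e e0; exists (fun=> c), (fun=> 0); split => //; try exact: ispoly_cst.
- by move=> x; rewrite subrr normr0.
- by rewrite Rintegral_probability_cst ltW.
Qed.

Lemma appr_compl g : appr g -> appr (fun x => 1 - g x).
Proof.
move=> [g01 bg Hg]; split.
- by move=> x; have /andP[g0 g1] := g01 x; apply/andP; split; lra.
- by apply: bmfunB => //; exact: bmfun_cst.
- move=> e e0; have [a [b [pa pb gab a2 be]]] := Hg _ e0.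
  exists (fun x => 1 - a x), b; split => //.
  + by apply: ispolyB => //; exact: ispoly_cst.
  + move=> x; rewrite (_ : _ - _ = - (g x - a x)) ?normrN//; ring.
  + by move=> t; have /andP[h1 h2] := a2 t; apply/andP; split; lra.
Qed.

(** From [g h - a1 a2 = g (h - a2) + (g - a1) a2]. The factor [a2] is unbounded on [R^n], so its
    absolute value is replaced by the polynomial [1 + a2 * a2], which is at most 2 on the range of
    [X]; the clause [0 <= a <= 1] on that range serves this purpose. *)
Lemma apprM g h : appr g -> appr h -> appr (fun x => g x * h x).
Proof.
move=> [g01 bg Hg] [h01 bh Hh]; split.
- move=> x; have /andP[g0 g1] := g01 x; have /andP[h0 h1] := h01 x.
  by rewrite mulr_ge0//= mulr_ile1.
- exact: bmfunM.
- move=> e e0; have e1 : 0 < e / 10 by rewrite divr_gt0.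
  have [a1 [b1 [pa1 pb1 gab1 a21 be1]]] := Hg _ e1.
  have [a2 [b2 [pa2 pb2 gab2 a22 be2]]] := Hh _ e1.
  exists (fun x => a1 x * a2 x), (fun x => b2 x + b1 x * (1 + a2 x * a2 x)).
  have pb : ispoly (fun x => b2 x + b1 x * (1 + a2 x * a2 x)).
    apply: ispolyD => //; apply: ispolyM => //; apply: ispolyD; first exact: ispoly_cst.
    exact: ispolyM.
  split=> //; first exact: ispolyM.
  + move=> x; have -> : g x * h x - a1 x * a2 x = g x * (h x - a2 x) + (g x - a1 x) * a2 x.
      by ring.
    have b10 : 0 <= b1 x := le_trans (normr_ge0 _) (gab1 x).
    rewrite (le_trans (ler_normD _ _))// lerD//.
      rewrite normrM; have /andP[g0 g1] := g01 x; rewrite (ger0_norm g0).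
      by apply: le_trans (gab2 x); rewrite ler_piMl.
    rewrite normrM ler_pM//.
    have [a0|a0] := leP `|a2 x| 1.
      by rewrite (le_trans a0)// lerDl -expr2 sqr_ge0.
    rewrite -expr2 -real_normK ?num_real// ler_wpDl// expr2 ler_peMr//; exact: ltW.
  + move=> t; have /andP[h0 h1] := a21 t; have /andP[h2 h3] := a22 t.
    by rewrite mulr_ge0//= mulr_ile1.
  + have bb1 := bmfun_ispoly pb1; have bb2 := bmfun_ispoly pb2.
    apply: (@le_trans _ _ (\int[P]_t (b2 (Xv t) + 2 * b1 (Xv t)))).
      apply: bm_le_Rintegral; first exact: (bmfun_ispoly pb).
        by apply: bmfunD => //; exact: bmfunZ.
      move=> t; rewrite lerD2l mulrC ler_wpM2r//.
        exact: le_trans (normr_ge0 _) (gab1 _).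
      have /andP[h2 h3] := a22 t.
      by have := mulr_ile1 h2 h2 h3 h3; lra.
    rewrite bm_RintegralD//; last exact: bmfunZ.
    by rewrite bm_RintegralZl//; lra.
Qed.

Lemma appr_prod (I : Type) (s : seq I) (g : I -> ('I_n -> R) -> R) :
  (forall i, appr (g i)) -> appr (fun x => \prod_(i <- s) g i x).
Proof.
move=> H; elim: s => [|i s IH].
  by under eq_fun do rewrite big_nil; apply: appr_cst; rewrite ler01 lexx.
by under eq_fun do rewrite big_cons; exact: apprM.
Qed.

Lemma continuity_of_law i (t : R) (e : R) : P [set w | X i w = t] = 0%E -> 0 < e ->
  exists2 theta, 0 < theta & fine (P [set w | `|X i w - t| <= theta]) <= e.
Proof.
move=> Pt e0.
pose F (k : nat) := [set w | `|X i w - t| <= k.+1%:R^-1].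
have mF k : measurable (F k).
  have -> : F k = (fun w => `|X i w - t|) @^-1` `]-oo, k.+1%:R^-1].
    by apply/seteqP; split => w /=; rewrite in_itv/=.
  rewrite -[X in measurable X]setTI; apply: (_ : measurable_fun setT _) => //.
  exact: (bmfun_norm (bmfunB (bmfun_X i) (bmfun_cst _ _))).1.
have FI : \bigcap_k F k = [set w | X i w = t].
  apply/seteqP; split => w /=; last first.
    by move=> Xt k _; rewrite /F/= Xt subrr normr0.
  move=> H; apply/eqP; rewrite -subr_eq0 -normr_le0; apply/ler_addgt0Pl => f f0.
  rewrite addr0; have [k _ /(_ k (leqnn _)) kf] := near_infty_natSinv_lt (PosNum f0).
  exact: le_trans (H k I) (ltW kf).
have : P \o F @ \oo --> P (\bigcap_k F k).
  apply: nonincreasing_cvg_mu => //.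
  - by rewrite (le_lt_trans (probability_le1 _ _))// ltry.
  - by apply: bigcapT_measurable => k; exact: mF.
  - move=> k l kl; apply/subsetPset => w /= /le_trans; apply.
    by rewrite lef_pV2 ?posrE// ler_nat.
rewrite FI Pt => /fine_cvgP[_ /cvgrPdist_le/(_ e e0)[k _ /(_ k (leqnn _))]].
rewrite /= sub0r normrN => h; exists k.+1%:R^-1; first by rewrite invr_gt0.
by apply: le_trans h; rewrite ler_norm.
Qed.

Lemma measurable_le_X i (t : R) : measurable [set w | X i w <= t].
Proof.
have -> : [set w | X i w <= t] = X i @^-1` `]-oo, t].
  by apply/seteqP; split => w /=; rewrite in_itv/=.
by rewrite -[X in measurable X]setTI; apply: measurable_funPT.
Qed.

Lemma measurable_dist_X i (t e : R) : measurable [set w | `|X i w - t| <= e].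
Proof.
have -> : [set w | `|X i w - t| <= e] = (fun w => `|X i w - t|) @^-1` `]-oo, e].
  by apply/seteqP; split => w /=; rewrite in_itv/=.
rewrite -[X in measurable X]setTI; apply: (_ : measurable_fun setT _) => //.
exact: (bmfun_norm (bmfunB (bmfun_X i) (bmfun_cst _ _))).1.
Qed.

(** The polynomials [p1] and [p2] are approximate steps at [t - th] and [t + th], so
    [p2 - p1 + 3 * f] bounds the error of [p2] for [|s| <= 2 * A]. It is of order [f] except near
    [t], a region of probability at most [f] since [t] is not an atom. Beyond [2 * A] the even power
    [tl] takes over. *)
Lemma appr_le i (A t : R) : 1 <= A -> r0 <= A -> `|t| <= A ->
  P [set w | X i w = t] = 0%E -> appr (fun x => (x i <= t)%R%:R).
Proof.
move=> A1 rA tA Pt; split.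
- by move=> x; rewrite ler0n lern1 leq_b1.
- exact/bmfun_bool/measurable_le_X.
move=> e e0; pose f := e / 10.
have f0 : 0 < f by rewrite divr_gt0.
have A0 : 0 < A by lra.
have [th' th'0 Pth'] := continuity_of_law Pt f0.
pose th := Num.min (th' / 2) A.
have th0 : 0 < th by rewrite lt_min divr_gt0.
have thA : th <= A by rewrite ge_min lexx orbT.
have thth : 2 * th <= th'.
  have : th <= th' / 2 by rewrite ge_min lexx.
  lra.
have Pth : fine (P [set w | `|X i w - t| <= 2 * th]) <= f.
  apply: le_trans Pth'; rewrite fine_le ?fin_num_measure//; try exact: measurable_dist_X.
  rewrite le_measure ?inE//; try exact: measurable_dist_X.
  by move=> w /= /le_trans; apply.
have t1A : `|t - th| <= 2 * A.
  by move: tA; rewrite !ler_norml => /andP[h1 h2]; apply/andP; split; lra.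
have t2A : `|t + th| <= 2 * A.
  by move: tA; rewrite !ler_norml => /andP[h1 h2]; apply/andP; split; lra.
have [p1 p1P] := step_poly A0 t1A f0 th0.
have [p2 p2P] := step_poly A0 t2A f0 th0.
pose b0 : {poly R} := p2 - p1 + (3 * f)%:P.
have b0E s : b0.[s] = p2.[s] - p1.[s] + 3 * f by rewrite /b0 !hornerE.
(* Since [|p2| <= 1 + p2 * p2], the polynomial [2 + p2 * p2] bounds the error everywhere; for large
   [|s|] the tail has to supply what [b0] lacks of it. *)
have [M [M1 M2]] := poly_tail (2%:P + p2 * p2 - b0) A1 f0.
have qE s : (2%:P + p2 * p2 - b0).[s] = 2 + p2.[s] * p2.[s] - b0.[s].
  by rewrite !hornerE.
pose tl : {poly R} := ((3 / 2 * A)^-1 *: 'X) ^+ (2 * M).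
have tlE s : tl.[s] = (s / (3 / 2 * A)) ^+ (2 * M).
  by rewrite /tl !(hornerE, horner_exp) mulrC.
have tl0 s : 0 <= tl.[s] by rewrite tlE exprM exprn_ge0// sqr_ge0.
exists (fun x => p2.[x i]), (fun x => (b0 + tl).[x i]); split.
- exact: ispoly_horner.
- exact: ispoly_horner.
- move=> x; set s := x i; rewrite hornerD.
  have [sA|sA] := leP `|s| (2 * A).
    have [/andP[h1 h2] h3 h4] := p1P _ sA; have [/andP[k1 k2] k3 k4] := p2P _ sA.
    have := tl0 s; rewrite b0E; set u := tl.[s] => u0; clearbody u.
    have [st|st] := leP s t; rewrite /=.
      have : 1 - f <= p2.[s] by apply: k3; lra.
      by rewrite ler_norml => h; apply/andP; split; lra.
    have : p1.[s] <= f by apply: h4; lra.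
    by rewrite ler_norml => h; apply/andP; split; lra.
  have := M1 s (ltW sA); rewrite -tlE qE ler_norml => /andP[h1 h2].
  have q0 : `|p2.[s]| <= 1 + p2.[s] * p2.[s].
    by rewrite ler_norml; apply/andP; split; nra.
  rewrite (le_trans (ler_normB _ _))//.
  have : `|(s <= t)%R%:R : R| <= 1 by case: (s <= t)%R; rewrite ?normr1 ?normr0.
  by lra.
- move=> w; have wA : `|X i w| <= 2 * A by apply: (le_trans (X_le i w)); lra.
  by have [] := p2P _ wA.
have bX : bmfun (fun w => (b0 + tl).[X i w]).
  exact: (bmfun_ispoly (ispoly_horner (b0 + tl) i)).
have bI : bmfun (fun w => (`|X i w - t| <= 2 * th)%R%:R : R).
  exact/bmfun_bool/measurable_dist_X.
apply: (@le_trans _ _ (\int[P]_w ((`|X i w - t| <= 2 * th)%R%:R + 5 * f))).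
  apply: bm_le_Rintegral => //; first by apply: bmfunD => //; exact: bmfun_cst.
  move=> w; rewrite hornerD b0E /Xv; set s := X i w.
  have sr : `|s| <= A by rewrite (le_trans (X_le _ _)).
  have sA : `|s| <= 2 * A by rewrite (le_trans sr)//; lra.
  have tls : tl.[s] <= f.
    apply: le_trans M2; rewrite tlE !exprM.
    have D0 : 0 < 3 / 2 * A by lra.
    have h23 : (0 : R) <= 2 / 3 by lra.
    have hs : `|s / (3 / 2 * A)| <= 2 / 3.
      by rewrite normrM normfV (gtr0_norm D0) ler_pdivrMr//; lra.
    rewrite lerXn2r ?nnegrE ?sqr_ge0//.
    by rewrite -[leLHS]real_normK ?num_real// lerXn2r ?nnegrE.
  have [/andP[h1 h2] h3 h4] := p1P _ sA; have [/andP[k1 k2] k3 k4] := p2P _ sA.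
  case: (leP `|s - t| (2 * th)) => st /=; first lra.
  have [ts|ts] := leP t s.
    rewrite ger0_norm ?subr_ge0// in st.
    have : p2.[s] <= f by apply: k4; lra.
    by lra.
  rewrite ler0_norm ?subr_le0 ?(ltW ts)// in st.
  have : 1 - f <= p1.[s] by apply: h3; lra.
  by lra.
rewrite bm_RintegralD//; last exact: bmfun_cst.
rewrite Rintegral_probability_cst Rintegral_bool; last exact: measurable_dist_X.
apply: le_trans (_ : f + 5 * f <= _); first by rewrite lerD2r.
by rewrite /f; lra.
Qed.

Section cells.
Variables (A : R).
Hypotheses (A_ge1 : 1 <= A) (rA : r0 < A).
Hypothesis X_diffuse : forall i t, P [set w | X i w = t] = 0%E.

Definition cellf (K : nat) (x : 'I_n -> R) : {ffun 'I_n -> 'I_(2 ^ K).+2} :=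
  [ffun i => bin A K (x i)].

Let A_gt0 : 0 < A. Proof. exact: lt_le_trans A_ge1. Qed.

Lemma appr_bin_le i K (k : nat) : appr (fun x => (bin A K (x i) <= k)%:R).
Proof.
have [kK|kK] := leqP k (2 ^ K).
  under eq_fun do rewrite bin_le//.
  apply: (@appr_le i A) => //; first exact: ltW.
  rewrite ler_norml -{1}(grid0 A K) grid_le//=.
  by rewrite -[leRHS](grid_max A K) grid_le.
under eq_fun do rewrite (leq_trans _ kK) ?leq_ord//.
by apply: appr_cst; rewrite ler01 lexx.
Qed.

Lemma appr_bin i K (k : 'I_(2 ^ K).+2) : appr (fun x => (bin A K (x i) == k)%:R).
Proof.
have -> : (fun x : 'I_n -> R => (bin A K (x i) == k)%:R : R) = (fun x =>
    (bin A K (x i) <= k)%:R * (1 - (if (k : nat) is k'.+1 then (bin A K (x i) <= k')%:R else 0))).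
  apply/funext => x; set b := bin A K (x i); rewrite -val_eqE/= eqn_leq.
  case: (k : nat) => [|k']; first by rewrite subr0 mulr1 andbT.
  by case: (leqP b k') => bk; rewrite /= ?subrr ?subr0 ?mulr1 ?mulr0 ?andbF ?andbT.
apply: apprM; first exact: appr_bin_le.
apply: appr_compl; case: (k : nat) => [|k']; last exact: appr_bin_le.
by apply: appr_cst; rewrite ler01 lexx.
Qed.

Lemma cellf_eqE K x c : ((cellf K x == c)%:R : R) = \prod_i (bin A K (x i) == c i)%:R.
Proof.
have [<-|xc] := eqVneq (cellf K x) c.
  by rewrite big1// => i _; rewrite ffunE eqxx.
have [/forallP H|] := boolP [forall i, bin A K (x i) == c i].
  by move/eqP: xc; case; apply/ffunP => i; rewrite ffunE; exact/eqP.
by rewrite negb_forall => /existsP[i /negPf ic]; rewrite (bigD1 i)//= ic mul0r.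
Qed.

Lemma appr_cellf K c : appr (fun x => (cellf K x == c)%:R).
Proof.
under eq_fun do rewrite cellf_eqE.
by apply: appr_prod => i; exact: appr_bin.
Qed.

Definition cell_law K (c : {ffun 'I_n -> 'I_(2 ^ K).+2}) : R :=
  \int[P]_t (cellf K (Xv t) == c)%:R.

Lemma near_moments_cells K (e : R) : 0 < e ->
  near_moments (fun N z => forall c,
    `|kappa (fun j => (cellf K (z^~ j) == c)%:R) - cell_law c| <= e).
Proof.
move=> e0; apply: near_moments_forall => c.
exact: (near_moments_appr (appr_cellf c) e0).
Qed.

End cells.

End moment_approximation.

Lemma count_mktuple (C : eqType) (N : nat) (f : 'I_N -> C) (a : pred C) :
  count a [tuple f j | j < N] = #|[pred j | a (f j)]|.
Proof.
rewrite /= count_map cardE /enum_mem size_filter -enumT.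
by rewrite (@eq_filter _ _ predT) ?filter_predT.
Qed.

(** * Upper bound for the exponential rate *)

Section upper_bound.
Context d (T : measurableType d) (R : realType) (P : probability T R)
  (n : nat) (X : 'I_n -> {RV P >-> R}) (r0 : R).
Hypothesis X_le : forall i t, `|X i t| <= r0.
Variables (A : R).
Hypotheses (A_ge1 : 1 <= A) (rA : r0 < A).
Hypothesis X_diffuse : forall i t, P [set w | X i w = t] = 0%E.

(** Binning is monotone, so sorted vectors become sorted words, and the cell frequencies of the
    permuted vectors are the joint type of the permuted words. The thresholds are independent of the
    subfamily [D], which covers cutoffs and prescribed sequences together. *)
Lemma rate_upper (K : nat) (eta : R) : 0 < eta ->
  exists m0 : nat, exists2 d0 : R, 0 < d0 & forall m delta,
    (m0 <= m)%N -> delta <= d0 ->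
    forall D : forall N : nat, nat -> R -> {set {ffun 'I_n -> 'S_N}},
      (forall N, D N m delta \subset Delta_sym X +oo%E N m delta) ->
      (limn_esup (log_rate D m delta)
       <= (- info (@cell_law _ _ _ P _ X A K) + eta)%:E)%E.
Proof.
move=> eta0; set mu := @cell_law _ _ _ P _ X A K.
have [e e0 He] := info_continuous mu eta0.
have [m0 [d0 d00 H]] := near_moments_cells X_le A_ge1 rA X_diffuse K e0.
exists m0, d0 => // m delta mm dd D DX.
apply: (@limn_esup_log_rate_le _ _ _ _ _ _ (types_bound R n (2 ^ K).+2)).
near=> N.
have N0 : (0 < N)%N by near: N; exact: nbhs_infty_gt.
apply: (unif_perm_le_types N0) He => s /(fintype.subsetP (DX N)).
rewrite finset.inE => /asboolP[x xm xX].
exists [ffun i => [tuple bin A K (x i j) | j < N]].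
  move=> i j k jk; rewrite ffunE !tnth_mktuple; apply: bin_le_mono; last exact: xm.
  exact: lt_le_trans A_ge1.
move=> c; have := H m delta mm dd N _ N0 xX c; rewrite -/mu.
rewrite kappa_bool /joint_tuple count_mktuple.
rewrite (@eq_card _ _ [pred j | pred1 c [ffun i => tnth (act_tuple
  ([ffun i0 => [tuple bin A K (x i0 j0)  | j0 < N]] i) (s i)) j]])//.
move=> j; rewrite !inE unfold_in; congr (_ == _); apply/ffunP => i.
by rewrite !ffunE !tnth_mktuple.
Unshelve. all: by end_near. Qed.

End upper_bound.

(** * Micro-states with prescribed cell frequencies *)

Section products.
Variable R : realType.

Lemma prodr_norm_le (k : nat) (a : 'I_k -> R) (A : R) : (forall l, `|a l| <= A) ->
  `|\prod_l a l| <= A ^+ k.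
Proof.
move=> aA; rewrite normr_prod -[in leRHS](card_ord k) -prodr_const.
by apply: ler_prod => l _; rewrite normr_ge0 aA.
Qed.

Lemma prodr_dist_le (k : nat) (a b : 'I_k -> R) (A h : R) : 1 <= A ->
  (forall l, `|a l| <= A) -> (forall l, `|b l| <= A) ->
  (forall l, `|a l - b l| <= h) ->
  `|\prod_l a l - \prod_l b l| <= k%:R * A ^+ k * h.
Proof.
move=> A1; elim: k a b => [|k IH] a b aA bA abh.
  by rewrite !big_ord0 subrr normr0 !mul0r.
have A0 : 0 <= A by lra.
have h0 : 0 <= h := le_trans (normr_ge0 _) (abh ord0).
rewrite !big_ord_recl.
set p := \prod_(i < k) a _; set q := \prod_(i < k) b _.
have -> : a ord0 * p - b ord0 * q = a ord0 * (p - q) + (a ord0 - b ord0) * q by ring.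
have pq : `|p - q| <= k%:R * A ^+ k * h by apply: IH => l.
have qA : `|q| <= A ^+ k by exact: prodr_norm_le.
rewrite (le_trans (ler_normD _ _))// !normrM.
have -> : k.+1%:R * A ^+ k.+1 * h = A * (k%:R * A ^+ k * h) + h * A ^+ k.+1.
  by rewrite -natr1 exprS; ring.
rewrite lerD// ler_pM//; apply: (le_trans qA).
by rewrite exprS ler_peMl// exprn_ge0.
Qed.

Lemma prodr_le_sum (k : nat) (w : 'I_k.+1 -> R) : (forall l, 0 <= w l) ->
  \prod_l w l <= \sum_l w l ^+ k.+1.
Proof.
move=> w0; have [l0 _ H] := @arg_maxP _ R _ (@ord0 k) xpredT w isT.
apply: (@le_trans _ _ (w l0 ^+ k.+1)).
  rewrite -[in leRHS](card_ord k.+1) -prodr_const; apply: ler_prod => l _.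
  by rewrite w0/=; exact: H.
by rewrite (bigD1 l0)//= lerDl sumr_ge0// => l _; rewrite exprn_ge0.
Qed.

(** Only moments of a prescribed sequence are bounded, so a product is controlled by even powers of
    its factors. Averaged over exceptional indices, [eta^-1] contributes little because these
    indices are few, and the power sum because [eta] is small. *)
Lemma prodr_young (k : nat) (z : 'I_k.+1 -> R) (eta : R) : 0 < eta ->
  `|\prod_l z l| <= eta^-1 + eta * \sum_l z l ^+ (2 * k.+1).
Proof.
move=> eta0; set p := \prod_l z l.
have : p ^+ 2 <= \sum_l z l ^+ (2 * k.+1).
  rewrite -prodrXl; under [leRHS]eq_bigr do rewrite exprM.
  by apply: prodr_le_sum => l; rewrite sqr_ge0.
rewrite -[leLHS]real_normK ?num_real//; set u := `|p| => h.
have u0 : 0 <= u by exact: normr_ge0.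
apply: (@le_trans _ _ (eta^-1 + eta * u ^+ 2)); last first.
  by rewrite lerD2l ler_wpM2l// ltW.
have : 0 <= eta^-1 * (1 - eta * u) ^+ 2 by rewrite mulr_ge0 ?sqr_ge0// invr_ge0 ltW.
have -> : eta^-1 * (1 - eta * u) ^+ 2 = eta^-1 + eta * u ^+ 2 - 2 * u.
  by field; rewrite gt_eqF.
lra.
Qed.

End products.

Section sorted_tuples.

Lemma nondecreasing_tuple_exists (N M : nat) (f : 'I_M -> nat) :
  (\sum_k f k = N)%N -> exists2 b : N.-tuple 'I_M,
    nondecreasing_ord (fun j => val (tnth b j)) & forall k, count_mem k b = f k.
Proof.
move=> sf; pose s := flatten [seq nseq (f k) k | k <- enum 'I_M].
pose le (a b : 'I_M) := (a <= b)%N.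
have cs k : count_mem k s = f k.
  rewrite count_flatten -map_comp sumnE big_map big_enum (bigD1 k)//=.
  rewrite count_nseq/= eqxx mul1n big1 ?addn0// => k' /negPf k'k.
  by rewrite count_nseq/= k'k.
have ss : size (sort le s) == N.
  by rewrite size_sort -sum_count_mem -sf; apply/eqP/eq_bigr => k _; rewrite cs.
exists (Tuple ss) => [j k jk|k]; last by rewrite /= (seq.permP (permEl (perm_sort le s))).
have [x0 _] : exists x : 'I_M, True by exists (tnth (Tuple ss) j).
rewrite !(tnth_nth x0).
have letr : transitive le by move=> a1 a2 a3; exact: leq_trans.
have lerf : reflexive le by move=> a1; exact: leqnn.
have st : sorted le (Tuple ss) by apply: sort_sorted => a1 a2; exact: leq_total.
have := @sorted_leq_nth _ le letr lerf x0 (Tuple ss) st j k.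
by rewrite !inE size_tuple !ltn_ord => /(_ isT isT jk).
Qed.

(** If [f j] and [g j] differ, some threshold [a] separates them. Sublevel sets of sorted functions
    are nested initial segments, so the symmetric difference of two of them has as many elements as
    their cardinalities differ. Closeness of distributions thus becomes agreement at most
    indices. *)
Lemma card_neq_nondecreasing (R : realType) (N M : nat) (f g : 'I_N -> nat) :
  nondecreasing_ord f -> nondecreasing_ord g ->
  (forall j, f j <= M)%N -> (forall j, g j <= M)%N ->
  kappa (fun j => (f j != g j)%:R : R) <=
  \sum_(a < M) `|kappa (fun j => (f j <= a)%N%:R : R) - kappa (fun j => (g j <= a)%N%:R : R)|.
Proof.
move=> fm gm fM gM.
apply: (@le_trans _ _ (kappa (fun j => \sum_(a < M) ((f j <= a) != (g j <= a))%N%:R))).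
  apply: kappa_le => j; have [fg|fg] := eqVneq (f j) (g j).
    by apply: sumr_ge0 => a _.
  wlog fltg : f g fm gm fM gM fg / (f j < g j)%N.
    move=> H; move: (fg); rewrite neq_ltn => /orP[h|h]; first exact: H h.
    have := H g f gm fm gM fM; rewrite eq_sym => /(_ fg h) /=.
    by congr (_ <= _); apply: eq_bigr => a _; rewrite eq_sym.
  have aM : (f j < M)%N by apply: leq_trans fltg (gM j).
  rewrite (bigD1 (Ordinal aM))//= leqnn leqNgt fltg/= lerDl.
  by apply: sumr_ge0.
rewrite kappa_sum; apply: ler_sum => a _.
have iN : `|N%:R^-1| = N%:R^-1 :> R by rewrite ger0_norm ?invr_ge0.
rewrite !kappa_bool -mulrBl normrM iN ler_wpM2r ?invr_ge0//.
pose u := #|[set k : 'I_N | (f k <= a)%N]%SET|; pose v := #|[set k : 'I_N | (g k <= a)%N]%SET|.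
have fu j : (f j <= a)%N = (j < u)%N by exact: nondecreasing_ordP.
have gv j : (g j <= a)%N = (j < v)%N by exact: nondecreasing_ordP.
have uN : (u <= N)%N by rewrite -[leqRHS](card_ord N) max_card.
have vN : (v <= N)%N by rewrite -[leqRHS](card_ord N) max_card.
have -> : #|(fun j => (f j <= a)%N)| = u.
  by apply: eq_card => j; rewrite finset.inE.
have -> : #|(fun j => (g j <= a)%N)| = v.
  by apply: eq_card => j; rewrite finset.inE.
have E : (#|(fun j : 'I_N => ((f j <= a) != (g j <= a))%N)| + minn u v = maxn u v)%N.
  rewrite -(@card_ltn_ord N (minn u v)) ?geq_min ?uN//.
  rewrite -[RHS](@card_ltn_ord N (maxn u v)) ?geq_max ?uN//.
  rewrite -[RHS](cardID (mem [set j : 'I_N | (j < minn u v)%N]%SET)) addnC; congr (_ + _)%N.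
    apply: eq_card => j; rewrite !(finset.inE, inE)/=; lia.
  apply: eq_card => j; rewrite !(finset.inE, inE)/= [LHS]unfold_in fu gv.
  by case: (ltnP j u); case: (ltnP j v) => ? ?; lia.
have : (#|(fun j : 'I_N => ((f j <= a) != (g j <= a))%N)| = (u - v) + (v - u))%N by lia.
move=> ->; rewrite natrD; have [uv|/ltnW vu] := leqP u v.
  have -> : (u - v = 0)%N by lia.
  by rewrite add0r natrB// distrC ler_norm.
have -> : (v - u = 0)%N by lia.
by rewrite addr0 natrB// ler_norm.
Qed.

End sorted_tuples.

(** Round [N * p c] down and give the deficit, at most [#|C|], to one letter of positive mass. No
    letter of mass zero is then ever used, which later guarantees that each letter comes from a
    value of [X]. *)
Lemma types_exist (R : realType) (C : finType) (p : C -> R) :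
  (forall c, 0 <= p c) -> \sum_c p c = 1 ->
  exists T : nat -> C -> nat, [/\ forall N, (\sum_c T N c = N)%N,
    forall N c, (0 < T N c)%N -> 0 < p c &
    forall c, (T N c)%:R / N%:R @[N --> \oo] --> p c].
Proof.
move=> p0 p1; have [c0 pc0] : exists c0, 0 < p c0.
  apply: contrapT => H; have : \sum_c p c = 0.
    rewrite big1// => c _; apply/eqP; rewrite eq_le p0 andbT leNgt.
    by apply/negP => pc; apply: H; exists c.
  by rewrite p1 => /eqP; rewrite oner_eq0.
pose t (N : nat) c := Num.truncn (N%:R * p c).
have tle N c : (t N c)%:R <= N%:R * p c by rewrite truncn_le mulr_ge0.
have tgt N c : N%:R * p c < (t N c)%:R + 1 by rewrite natr1 truncnS_gt.
have sN N : \sum_c N%:R * p c = N%:R by rewrite -mulr_sumr p1 mulr1.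
have st N : (\sum_c t N c <= N)%N.
  by rewrite -(ler_nat R) natr_sum -[leRHS]sN; apply: ler_sum.
have st2 N : (N - \sum_c t N c <= #|C|)%N.
  rewrite leq_subLR -(ler_nat R) natrD -[leLHS]sN natr_sum.
  rewrite -sum1_card natr_sum -big_split/=; apply: ler_sum => c _; exact/ltW/tgt.
exists (fun N c => t N c + (c == c0) * (N - \sum_c t N c))%N; split.
- move=> N; rewrite big_split/= [X in (_ + X)%N](bigD1 c0)//= eqxx mul1n.
  by rewrite [X in (_ + (_ + X))%N]big1 ?addn0 ?subnKC// => c /negPf ->.
- move=> N c; have [->//|_] := eqVneq c c0; rewrite mul0n addn0.
  rewrite /t truncn_gt_nat => h; rewrite lt_neqAle p0 andbT eq_sym.
  by apply/eqP => pc; move: h; rewrite pc mulr0 ler10.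
- move=> c; apply/cvgrPdist_le => e e0; near=> N.
  have N0 : 0 < N%:R :> R by rewrite ltr0n; near: N; exact: nbhs_infty_gt.
  set u := (_ + _)%N.
  have u1 : u%:R <= N%:R * p c + #|C|%:R.
    rewrite natrD lerD// ler_nat; apply: leq_trans (st2 N).
    by case: (c == c0); rewrite ?mul1n.
  have u2 : N%:R * p c <= u%:R + 1.
    by rewrite (le_trans (ltW (tgt N c)))// lerD2r ler_nat leq_addr.
  have uE : p c - u%:R / N%:R = (N%:R * p c - u%:R) / N%:R.
    by field; rewrite gt_eqF.
  have : (#|C|%:R + 1) <= e * N%:R.
    by rewrite -ler_pdivrMl// mulrC; near: N; exact: nbhs_infty_ger.
  have C0 : 0 <= #|C|%:R :> R by [].
  move=> h; rewrite uE normrM normfV (gtr0_norm N0) ler_pdivrMr// ler_norml.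
  by apply/andP; split; lra.
Unshelve. all: by end_near. Qed.

Lemma kappa_perm (R : realType) (N : nat) (s : 'S_N) (f : 'I_N -> R) :
  kappa (fun j => f ((s^-1)%g j)) = kappa f.
Proof.
by rewrite /kappa [in RHS](reindex_inj (@perm_inj _ (s^-1)%g)).
Qed.

Lemma kappa_tuple (R : realType) (N : nat) (C : finType) (J : N.-tuple C) (F : C -> R) :
  kappa (fun j => F (tnth J j)) = \sum_c (count_mem c J)%:R / N%:R * F c.
Proof.
rewrite /kappa (partition_big (tnth J) xpredT)//= mulr_sumr; apply: eq_bigr => c _.
have -> : count_mem c J = #|[pred j | tnth J j == c]|.
  have {1}-> : J = [tuple tnth J j | j < N].
    by apply: eq_from_tnth => j; rewrite tnth_mktuple.
  by rewrite count_mktuple.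
rewrite (eq_bigr (fun=> F c)); last by move=> j /eqP ->.
by rewrite sumr_const -[F c *+ _]mulr_natl mulrA [N%:R^-1 * _]mulrC.
Qed.

Section cell_laws.
Context d (T : measurableType d) (R : realType) (P : probability T R)
  (n : nat) (X : 'I_n -> {RV P >-> R}) (A : R).
Hypothesis A_gt0 : 0 < A.

Local Notation cell K := {ffun 'I_n -> 'I_(2 ^ K).+2}.
Local Notation law K := (@cell_law _ _ _ P _ X A K).

Lemma measurable_cellf K (c : cell K) : measurable [set t | cellf A K (Xv X t) == c].
Proof.
have -> : [set t | cellf A K (Xv X t) == c] =
    \bigcap_(i in [set: 'I_n]) [set t | bin A K (X i t) == c i].
  apply/seteqP; split => t /=.
    by move=> /eqP <- i _ /=; rewrite ffunE.
  by move=> H; apply/eqP/ffunP => i; rewrite ffunE; apply/eqP; exact: H.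
apply: fin_bigcap_measurable => [|i _]; first exact: finite_finset.
have ml (k : nat) : measurable [set t | (bin A K (X i t) <= k)%N].
  have [kK|kK] := leqP k (2 ^ K).
    rewrite (_ : [set t | _] = [set w | X i w <= grid A K k]).
      exact: measurable_le_X.
    by apply/seteqP; split => t /=; rewrite bin_le.
  rewrite (_ : [set t | _] = setT)//; apply/seteqP; split => // t _ /=.
  by rewrite (leq_trans _ kK)// leq_ord.
rewrite (_ : [set t | _] = [set t | (bin A K (X i t) <= c i)%N] `\`
    (if (c i : nat) is k.+1 then [set t | (bin A K (X i t) <= k)%N] else set0)).
  by apply: measurableD => //; case: (c i : nat).
apply/seteqP; split => t /=.
  move=> /eqP e; split; first by rewrite e.
  by case E: (c i : nat) => [|k]//=; rewrite e E ltnn.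
move=> [h1 h2]; rewrite -val_eqE/= eqn_leq h1/=; move: h2.
by case: (c i : nat) => // k /= /negP; rewrite -ltnNge.
Qed.

Lemma cell_lawE K (c : cell K) : law K c = fine (P [set t | cellf A K (Xv X t) == c]).
Proof. by rewrite /cell_law Rintegral_bool//; exact: measurable_cellf. Qed.

Lemma cell_law_ge0 K (c : cell K) : 0 <= law K c.
Proof. by rewrite cell_lawE fine_ge0. Qed.

Lemma bmfun_cellf K (c : cell K) : bmfun (fun t => (cellf A K (Xv X t) == c)%:R : R).
Proof. exact/bmfun_bool/measurable_cellf. Qed.

Lemma cell_sumE K (F : cell K -> R) x :
  F (cellf A K x) = \sum_c F c * (cellf A K x == c)%:R.
Proof.
rewrite (bigD1 (cellf A K x))//= eqxx mulr1 big1 ?addr0// => c.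
by rewrite eq_sym => /negPf ->; rewrite mulr0.
Qed.

Lemma bmfun_cell K (F : cell K -> R) : bmfun (fun t => F (cellf A K (Xv X t))).
Proof.
under eq_fun do rewrite cell_sumE.
by apply: bmfun_sum => c; apply: bmfunZ; exact: bmfun_cellf.
Qed.

Lemma Rintegral_cell K (F : cell K -> R) :
  \int[P]_t F (cellf A K (Xv X t)) = \sum_c law K c * F c.
Proof.
under eq_Rintegral do rewrite cell_sumE.
rewrite bm_Rintegral_sum; last by move=> c; apply: bmfunZ; exact: bmfun_cellf.
by apply: eq_bigr => c _; rewrite bm_RintegralZl 1?mulrC//; exact: bmfun_cellf.
Qed.

Lemma sum_cell_law K : \sum_c law K c = 1.
Proof.
have := Rintegral_cell (fun _ : cell K => 1); rewrite Rintegral_probability_cst => ->.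
by apply: eq_bigr => c _; rewrite mulr1.
Qed.

Lemma cell_law_gt0 K (c : cell K) : 0 < law K c -> exists t, cellf A K (Xv X t) = c.
Proof.
move=> pc; apply: contrapT => H; move: pc; rewrite cell_lawE.
rewrite (_ : [set t | _] = set0) ?measure0 ?ltxx//.
by apply/seteqP; split => // t /= /eqP tc; apply: H; exists t.
Qed.

End cell_laws.

Section clip.
Variable R : realType.
Implicit Types C x y : R.

Definition clip C x : R := Num.max (- C) (Num.min C x).

Lemma clip_le C x : 0 <= C -> `|clip C x| <= C.
Proof.
by move=> C0; rewrite ler_norml /clip le_max lexx/= ge_max ge_min lexx andbT; lra.
Qed.

Lemma clip_dist C x y : `|x| <= C -> `|x - clip C y| <= `|x - y|.
Proof.
rewrite ler_norml => /andP[x1 x2]; rewrite /clip.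
case: (leP C y) => h1; last first.
  case: (leP (- C) y) => h2 //.
  by rewrite !ger0_norm; lra.
have -> : Num.max (- C) C = C by apply/max_idPr; lra.
by rewrite !ler0_norm; lra.
Qed.

Lemma clip_id C x : `|x| <= C -> clip C x = x.
Proof.
rewrite ler_norml => /andP[x1 x2].
by rewrite /clip (min_idPr x2) (max_idPr x1).
Qed.

End clip.

(** * Lower bound for the exponential rate *)

Section lower_bound.
Context d (T : measurableType d) (R : realType) (P : probability T R)
  (n : nat) (X : 'I_n -> {RV P >-> R}) (r0 : R).
Hypotheses (r0_ge0 : 0 <= r0) (X_le : forall i t, `|X i t| <= r0).
Variables (A : R).
Hypothesis rA : r0 + 1 <= A.

Let A_ge1 : 1 <= A.
Proof. by apply: le_trans rA; rewrite lerDr. Qed.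
Let A_gt0 : 0 < A. Proof. exact: lt_le_trans A_ge1. Qed.

Local Notation cell K := {ffun 'I_n -> 'I_(2 ^ K).+2}.
Local Notation law K := (@cell_law _ _ _ P _ X A K).

(** The right endpoint of a bin, clipped so that vectors of representatives respect every cutoff
    that is at least [r0]. *)
Definition rep K (k : 'I_(2 ^ K).+2) : R := clip r0 (grid A K k).

Lemma rep_le K (k : 'I_(2 ^ K).+2) : `|rep k| <= r0.
Proof. exact: clip_le. Qed.

Lemma bin_inner K (s : R) : - r0 <= s <= r0 -> (0 < bin A K s <= 2 ^ K)%N.
Proof.
have rA' := rA; move=> /andP[s1 s2]; rewrite lt0n bin_eq0// -ltNge bin_le// grid_max.
by apply/andP; split; lra.
Qed.

(** The point [s] may lie outside [[-r0, r0]]; its bin meets this interval at [s'], so the clipped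
    endpoint still belongs to the bin. *)
Lemma rep_dist K (s s' : R) : - r0 <= s' <= r0 -> bin A K s = bin A K s' ->
  `|s - rep (bin A K s)| <= mesh A K.
Proof.
move=> /[dup] /bin_inner - /(_ K) b /andP[s1 s2] ss'.
have /andP[u1 u2] := @bin_dist _ _ A_gt0 K s' _ b erefl.
have /andP[v1 v2] : grid A K (bin A K s') - mesh A K < s <= grid A K (bin A K s').
  by apply: bin_dist; rewrite ?ss'.
have h0 := mesh_gt0 A_gt0 K.
rewrite /rep /clip ss'; set g := grid A K _ in u1 u2 v1 v2 *.
rewrite ler_norml maxEle minEle.
by case: (leP r0 g) => rg; [case: (leP (- r0) r0)|case: (leP (- r0) g)] => rg';
  apply/andP; split; lra.
Qed.

Lemma rep_X_dist K i t : `|X i t - rep (bin A K (X i t))| <= mesh A K.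
Proof. by apply: (@rep_dist K _ (X i t)) => //; rewrite -ler_norml. Qed.

Lemma expect_rep_dist K (k : nat) (w : 'I_k -> 'I_n) :
  `|\sum_c law K c * \prod_l rep (c (w l)) - \int[P]_t \prod_l X (w l) t|
    <= k%:R * A ^+ k * mesh A K.
Proof.
rewrite -(Rintegral_cell X A_gt0 (fun c : cell K => \prod_l rep (c (w l)))).
have bX : bmfun (fun t => \prod_l X (w l) t).
  by apply: bmfun_prod => l; exact: (bmfun_X X_le).
have bR := bmfun_cell X A_gt0 (fun c : cell K => \prod_l rep (c (w l))).
rewrite -bm_RintegralB// (le_trans (bm_le_normr_Rintegral _ _))//; first exact: bmfunB.
rewrite -[leRHS](Rintegral_probability_cst P).
apply: bm_le_Rintegral; [exact/bmfun_norm/bmfunB|exact: bmfun_cst|].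
have rA' := rA; move=> t; apply: prodr_dist_le => // l.
- by rewrite (le_trans (rep_le _))//; lra.
- by rewrite (le_trans (X_le _ _))//; lra.
- by rewrite ffunE distrC rep_X_dist.
Qed.

Section rate.
Variables (K : nat) (Tn : nat -> cell K -> nat).
Hypothesis Tn_sum : forall N, (\sum_c Tn N c = N)%N.
Hypothesis Tn_cvg : forall c, (Tn N c)%:R / N%:R @[N --> \oo] --> law K c.
Variable b : forall N, {ffun 'I_n -> N.-tuple 'I_(2 ^ K).+2}.
Hypothesis b_count : forall N i k, count_mem k (b N i) = marginal (Tn N) i k.
Variable x : forall N, 'I_n -> 'I_N -> R.
Arguments x {N}.

Let bad N (i : 'I_n) (j : 'I_N) : bool :=
  (mesh A K < `|x i j - rep (tnth (b N i) j)|)%R.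

Hypothesis x_bad : forall i, kappa (fun j : 'I_N => (bad i j)%:R : R) @[N --> \oo] --> 0.
Hypothesis x_moments : forall i k, exists C : R,
  \forall N \near \oo, kappa (fun j : 'I_N => x i j ^+ (2 * k)) <= C.
Hypothesis mesh_le1 : mesh A K <= 1.

(** Averages are invariant under permutation of the indices, so exceptional indices and even moments
    are controlled uniformly in [s]; the cell frequencies are fixed by the joint type. Off the
    exceptional indices the entries are close to representatives, and on them [prodr_young]
    applies. *)
Lemma near_word_moment (k : nat) (w : 'I_k.+1 -> 'I_n) (delta : R) :
  2 * (k.+1%:R * A ^+ k.+1 * mesh A K) < delta ->
  \forall N \near \oo, forall s : {ffun 'I_n -> 'S_N},
    joint_tuple (b N) s \in type_class N (Tn N) ->
    `|kappa (fun j => \prod_(l < k.+1) perm_act (s (w l)) (x (w l)) j)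
      - \int[P]_t \prod_(l < k.+1) X (w l) t| < delta.
Proof.
have rA' := rA; have r00 := r0_ge0; have A1' := A_ge1.
set E := k.+1%:R * A ^+ k.+1 * mesh A K => Edelta.
(* The total error is at most [2 * E + 3 * g]: [E + 2 * g] from replacing entries by
   representatives, [g] from the cell frequencies and [E] from the expectation. The constants [eta],
   [W] and [U] are chosen so that each share is [g]. *)
pose g := (delta - 2 * E) / 4.
have g0 : 0 < g by rewrite divr_gt0// subr_gt0.
have h0 : 0 < mesh A K := mesh_gt0 A_gt0 K.
have Ak0 : 0 <= A ^+ k.+1 by rewrite exprn_ge0// ltW.
have E0 : 0 <= E by rewrite !mulr_ge0// ltW.
have /choice[C HC] := fun l => x_moments (w l) k.+1.
pose S : R := \sum_l `|C l| + 1.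
have S0 : 0 < S by rewrite ltr_wpDl// sumr_ge0.
pose eta : R := g / S.
have eta0 : 0 < eta by rewrite divr_gt0.
pose V : R := A ^+ k.+1 + eta^-1.
have V0 : 0 < V by rewrite ltr_wpDl// invr_gt0.
pose W : R := k.+1%:R * V; have W0 : 0 < W by rewrite mulr_gt0.
pose U : R := A ^+ k.+1 * #|{: cell K}|%:R + 1.
have U0 : 0 < U by rewrite ltr_wpDl// mulr_ge0.
near=> N => s /type_classP sT.
have N0 : (0 < N)%N by near: N; exact: nbhs_infty_gt.
have badN l : kappa (fun j : 'I_N => (bad (w l) j)%:R : R) <= g / W.
  move: l; near: N; apply: filter_forall => l.
  have /cvgrPdist_le/(_ (g / W)) := x_bad (w l); rewrite divr_gt0// => /(_ isT).
  by apply: filterS => N; rewrite sub0r normrN; apply: le_trans; rewrite ler_norm.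
have momN l : kappa (fun j : 'I_N => x (w l) j ^+ (2 * k.+1)) <= C l.
  by move: l; near: N; apply: filter_forall => l; exact: HC.
have TN c : `|(Tn N c)%:R / N%:R - law K c| <= g / U.
  move: c; near: N; apply: filter_forall => c.
  have /cvgrPdist_le/(_ (g / U)) := @Tn_cvg c; rewrite divr_gt0// => /(_ isT).
  by apply: filterS => N; rewrite distrC.
pose z l j := perm_act (s (w l)) (x (w l)) j.
pose y l j : R := rep (tnth (b N (w l)) ((s (w l))^-1%g j)).
pose bz l j := bad (w l) ((s (w l))^-1%g j).
have y_le l j : `|y l j| <= A by rewrite (le_trans (rep_le _))//; lra.
have step1 : `|kappa (fun j => \prod_l z l j) - kappa (fun j => \prod_l y l j)| <= E + 2 * g.
  rewrite -kappaB (le_trans (kappa_norm_le _))//.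
  apply: (@le_trans _ _ (kappa (fun j => E + (V * \sum_l (bz l j)%:R +
      eta * \sum_l z l j ^+ (2 * k.+1))))).
    apply: kappa_le => j.
    have sb0 : 0 <= \sum_l (bz l j)%:R :> R by apply: sumr_ge0.
    have sz0 : 0 <= \sum_l z l j ^+ (2 * k.+1).
      by apply: sumr_ge0 => l _; rewrite exprM exprn_ge0// sqr_ge0.
    have [/existsP[l lb]|] := boolP [exists l, bz l j].
      have s1 : 1 <= \sum_l (bz l j)%:R :> R.
        by rewrite (bigD1 l)//= lb lerDl sumr_ge0.
      rewrite (le_trans (ler_normB _ _))//.
      have h1 := prodr_young (fun l => z l j) eta0.
      have h2 : `|\prod_l y l j| <= A ^+ k.+1 by exact: prodr_norm_le.
      have h3 : V <= V * \sum_l (bz l j)%:R by rewrite ler_peMr// ltW.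
      by move: h3; rewrite {1}/V; lra.
    rewrite negb_exists => /forallP nb.
    have zy l : `|z l j - y l j| <= mesh A K by have := nb l; rewrite -leNgt.
    have z_le l : `|z l j| <= A.
      have -> : z l j = y l j + (z l j - y l j) by ring.
      rewrite (le_trans (ler_normD _ _))//.
      have := rep_le (tnth (b N (w l)) ((s (w l))^-1%g j)).
      by rewrite -/(y l j); have := zy l; have := mesh_le1; lra.
    apply: le_trans (prodr_dist_le A_ge1 z_le (y_le^~ j) zy) _.
    by rewrite lerDl addr_ge0 // mulr_ge0// ltW.
  have g2 : 2 * g = g + g by ring.
  rewrite kappaD kappa_cst// kappaD !kappaZ !kappa_sum lerD2l g2 lerD//.
    apply: (@le_trans _ _ (V * \sum_(l < k.+1) g / W)).
      rewrite ler_wpM2l ?(ltW V0)//; apply: ler_sum => l _.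
      by rewrite (kappa_perm (s (w l)) (fun j => (bad (w l) j)%:R)).
    rewrite sumr_const card_ord -[_ *+ _]mulr_natl /W le_eqVlt; apply/orP; left.
    by apply/eqP; field; rewrite gt_eqF// nat1r pnatr_eq0.
  apply: (@le_trans _ _ (eta * S)); last by rewrite /eta divfK// gt_eqF.
  rewrite ler_wpM2l ?(ltW eta0)// /S ler_wpDr//; apply: ler_sum => l _.
  rewrite (kappa_perm (s (w l)) (fun j => x (w l) j ^+ (2 * k.+1))).
  by rewrite (le_trans (momN l))// ler_norm.
have step2 : `|kappa (fun j => \prod_l y l j)
    - \sum_c law K c * \prod_l rep (c (w l))| <= g.
  have -> : kappa (fun j => \prod_l y l j) =
      \sum_c (count_mem c (joint_tuple (b N) s))%:R / N%:R * \prod_l rep (c (w l)).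
    rewrite -(kappa_tuple _ (fun c : cell K => \prod_l rep (c (w l)))).
    congr kappa; apply/funext => j; apply: eq_bigr => l _.
    by rewrite tnth_mktuple ffunE tnth_mktuple.
  rewrite -sumrB (le_trans (ler_norm_sum _ _ _))//.
  apply: (@le_trans _ _ (\sum_(c : cell K) g / U * A ^+ k.+1)).
    apply: ler_sum => c _; rewrite -mulrBl normrM ler_pM// ?sT ?TN//.
    by apply: prodr_norm_le => l; rewrite (le_trans (rep_le _))//; lra.
  rewrite sumr_const -[_ *+ _]mulr_natl.
  have -> : #|{: cell K}|%:R * (g / U * A ^+ k.+1) = g * ((A ^+ k.+1 * #|{: cell K}|%:R) / U).
    by ring.
  by rewrite ler_piMr ?(ltW g0)// ler_pdivrMr// mul1r lerDl.
have step3 := expect_rep_dist K w.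
move: step1 step2 step3; rewrite -/E.
set a1 := kappa _; set a2 := kappa _; set a3 := \sum_c _; set a4 := Rintegral _ _ _.
have gE : 4 * g = delta - 2 * E by rewrite /g mulrC divfK.
rewrite !ler_norml ltr_norml => /andP[b1 b2] /andP[b3 b4] /andP[b5 b6].
by apply/andP; split; lra.
Unshelve. all: by end_near. Qed.

(** The words [b N] have exactly the marginals of [Tn N], so the permutations with this joint type
    have proportion exactly [type_weight], and for large [N] all of them yield micro-states. *)
Lemma rate_lower (m : nat) (delta : R)
    (D : forall N : nat, nat -> R -> {set {ffun 'I_n -> 'S_N}}) :
  0 < delta -> 2 * (m%:R * A ^+ m * mesh A K) < delta ->
  (forall N (s : {ffun 'I_n -> 'S_N}),
    microstates X +oo%E m delta (fun i => perm_act (s i) (x i)) ->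
    joint_tuple (b N) s \in type_class N (Tn N) -> s \in D N m delta) ->
  ((- info (law K))%:E <= limn_einf (log_rate D m delta))%E.
Proof.
move=> delta0 Hm HD.
pose c0 : R := (#|{: cell K}| + n * #|'I_(2 ^ K).+2| + n + 1)%:R.
pose xs (N : nat) : R := - info (fun c => (Tn N c)%:R / N%:R) - c0 * (1 + ln N.+1%:R) / N%:R.
have xs_cvg : xs @ \oo --> - info (law K).
  rewrite -[X in _ --> X]subr0; apply: cvgB.
    apply: cvgN; apply/cvgrPdist_le => e e0.
    have [f f0 Hf] := info_continuous (law K) e0.
    near=> N; rewrite distrC; apply: Hf => c; rewrite distrC; move: c.
    near: N; apply: filter_forall => c.
    by have /cvgrPdist_le := @Tn_cvg c; apply.
  apply/cvgrPdist_le => e e0; near=> N.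
  have N0 : 0 < N%:R :> R by rewrite ltr0n; near: N; exact: nbhs_infty_gt.
  have l0 : 0 <= ln N.+1%:R :> R by rewrite ln_ge0// ler1n.
  rewrite sub0r normrN ger0_norm; last by rewrite !mulr_ge0 ?addr_ge0// invr_ge0 ltW.
  by rewrite ler_pdivrMr//; near: N; exact: near_ln_small.
apply: limn_einf_log_rate_ge xs_cvg _.
near=> N.
have N0 : (0 < N)%N by near: N; exact: nbhs_infty_gt.
have Np : 0 < N%:R :> R by rewrite ltr0n.
have sub : [set s | joint_tuple (b N) s \in type_class N (Tn N)]%SET \subset D N m delta.
  apply/fintype.subsetP => s; rewrite finset.in_set => sT; apply: HD => //; split.
    by move=> i j; rewrite leey.
  have words (k : 'I_m) (w : {ffun 'I_k.+1 -> 'I_n}) :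
    `|kappa (fun j => \prod_(l < k.+1) perm_act (s (w l)) (x (w l)) j)
      - \int[P]_t \prod_(l < k.+1) X (w l) t| < delta.
    move: k w s sT; near: N.
    suff : \forall N \near \oo, forall (k : 'I_m) (w : {ffun 'I_k.+1 -> 'I_n})
        (s : {ffun 'I_n -> 'S_N}), joint_tuple (b N) s \in type_class N (Tn N) ->
      `|kappa (fun j => \prod_(l < k.+1) perm_act (s (w l)) (x (w l)) j)
      - \int[P]_t \prod_(l < k.+1) X (w l) t| < delta.
      by apply: filterS => N H k w s; exact: H.
    apply: filter_forall => k; apply: filter_forall => w.
    apply: near_word_moment; apply: le_lt_trans Hm.
    rewrite ler_wpM2l// ler_wpM2r ?(ltW (mesh_gt0 A_gt0 K))//.
    by rewrite ler_pM ?ler_nat ?exprn_ge0 ?(ltW A_gt0)// ler_weXn2l.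
  case=> [//|k] /andP[_ km] w.
  rewrite fine_expectation; have := words (Ordinal km) [ffun l => w l].
  rewrite /=; under [X in kappa X - _]eq_fun do under eq_bigr do rewrite !ffunE.
  by under eq_Rintegral do under eq_bigr do rewrite ffunE.
apply: (@le_trans _ _ (type_weight R N (Tn N))); last first.
  rewrite -(unif_perm_type R (b_count N)) /unif_perm ler_wpM2r ?invr_ge0//.
  by rewrite ler_nat subset_leq_card.
have := type_weight_bounds R N0 (Tn_sum N); rewrite -/c0.
rewrite ler_norml => /andP[h1 _].
have w0 : 0 < type_weight R N (Tn N).
  rewrite divr_gt0 ?ltr0n ?expn_gt0 ?fact_gt0// muln_gt0; apply/andP; split.
    have := card_type_class (Tn_sum N); have := fact_gt0 N.
    by case: (#|_|) => // + e; rewrite -e.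
  by apply: prodn_gt0 => i; apply: prodn_gt0 => k; exact: fact_gt0.
rewrite -[leRHS]lnK ?posrE// ler_expR /xs mulrBr mulrN mulrCA divff ?gt_eqF// mulr1.
lra.
Unshelve. all: by end_near. Qed.

End rate.

End lower_bound.

Lemma cvg_sumr (R : realType) (I : Type) (s : seq I) (f : I -> R^nat) (l : I -> R) :
  (forall i, f i @ \oo --> l i) ->
  \sum_(i <- s) f i N @[N --> \oo] --> \sum_(i <- s) l i.
Proof.
move=> fl; elim: s => [|i s IH].
  by under eq_fun do rewrite big_nil; rewrite big_nil; exact: cvg_cst.
by under eq_fun do rewrite big_cons; rewrite big_cons; exact: cvgD.
Qed.

Section lower_bounds.
Context d (T : measurableType d) (R : realType) (P : probability T R)
  (n : nat) (X : 'I_n -> {RV P >-> R}) (r0 : R).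
Hypotheses (r0_ge0 : 0 <= r0) (X_le : forall i t, `|X i t| <= r0).
Variables (A : R).
Hypothesis rA : r0 + 1 <= A.

Let A_ge1 : 1 <= A.
Proof. by apply: le_trans rA; rewrite lerDr. Qed.
Let A_gt0 : 0 < A. Proof. exact: lt_le_trans A_ge1. Qed.
Let r0_ltA : r0 < A. Proof. by apply: lt_le_trans rA; rewrite ltrDl. Qed.

Local Notation cell K := {ffun 'I_n -> 'I_(2 ^ K).+2}.
Local Notation law K := (@cell_law _ _ _ P _ X A K).

Lemma sorted_bins_exist K : exists (Tn : nat -> cell K -> nat)
    (b : forall N, {ffun 'I_n -> N.-tuple 'I_(2 ^ K).+2}),
  [/\ forall N, (\sum_c Tn N c = N)%N,
      forall N c, (0 < Tn N c)%N -> 0 < law K c,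
      forall c, (Tn N c)%:R / N%:R @[N --> \oo] --> law K c,
      forall N i, nondecreasing_ord (fun j => val (tnth (b N i) j)) &
      forall N i k, count_mem k (b N i) = marginal (Tn N) i k].
Proof.
have [Tn [T1 T2 T3]] := types_exist (@cell_law_ge0 _ _ _ P _ X A A_gt0 K)
  (sum_cell_law X A_gt0 K).
have ex N i : exists b : N.-tuple 'I_(2 ^ K).+2,
    nondecreasing_ord (fun j => val (tnth b j)) /\
    forall k, count_mem k b = marginal (Tn N) i k.
  have [|b b1 b2] := @nondecreasing_tuple_exists N _ (marginal (Tn N) i).
    by rewrite sum_marginal.
  by exists b.
exists Tn, (fun N => [ffun i => sval (cid (ex N i))]); split => // N i => [|k];
  by rewrite ffunE; have [] := svalP (cid (ex N i)).
Qed.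

Lemma rate_lower_sym K m delta (r : \bar R) : (r0%:E <= r)%E -> mesh A K <= 1 ->
  0 < delta -> 2 * (m%:R * A ^+ m * mesh A K) < delta ->
  ((- info (law K))%:E <= limn_einf (log_rate (Delta_sym X r) m delta))%E.
Proof.
move=> r0r h1 delta0 Hm; have [Tn [b [T1 T2 T3 b1 b2]]] := sorted_bins_exist K.
(* With the representatives themselves as entries, no index is exceptional and every entry is
   bounded by [r0]. *)
pose x N i (j : 'I_N) : R := rep r0 A (tnth (b N i) j).
apply: (@rate_lower _ _ _ _ _ X r0 r0_ge0 X_le A rA K Tn T1 T3 b b2 x) => //.
- move=> i; rewrite (_ : (fun N => _) = fun=> 0); first exact: cvg_cst.
  apply/funext => N; rewrite (_ : (fun j => _) = fun=> 0).
    by rewrite /kappa big1 ?mulr0.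
  apply/funext => j; rewrite /x subrr normr0 ltNge ltW//.
  exact: mesh_gt0.
- move=> i k; exists (r0 ^+ (2 * k)); near=> N.
  rewrite -[leRHS](@kappa_cst R N); last by near: N; exact: nbhs_infty_gt.
  apply: kappa_le => j; rewrite !exprM lerXn2r ?nnegrE ?sqr_ge0//.
  by rewrite -[leLHS]real_normK ?num_real// lerXn2r ?nnegrE// rep_le.
- move=> N s [_ sX] sT; rewrite finset.inE; apply/asboolP; exists (x N).
    move=> i j k jk; rewrite /x /rep.
    have := grid_le A_gt0 K (b1 N i j k jk); set u := grid _ _ _; set v := grid _ _ _ => uv.
    have uv' : Num.min r0 u <= Num.min r0 v by rewrite le_min !ge_min lexx uv orbT.
    by rewrite ge_max !le_max lexx uv' orbT.
  split=> // i j; apply: le_trans r0r; rewrite lee_fin; exact: rep_le.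
Unshelve. all: by end_near. Qed.

Hypothesis X_diffuse : forall i t, P [set w | X i w = t] = 0%E.

(** For large [N] the vector [xi N] is a micro-state of the single variable [X i], so the moment
    estimates apply to the one-variable family [Y]. *)
Lemma cdf_approximating i (xi : forall N : nat, 'I_N -> R) K (a : nat) :
  approximating (X i) xi ->
  kappa (fun j => (bin A K (xi N j) <= a)%N%:R : R) @[N --> \oo] -->
  \int[P]_t (bin A K (X i t) <= a)%N%:R.
Proof.
move=> [_ xiX]; apply/cvgrPdist_le => e e0.
pose Y (_ : 'I_1) := X i.
have Y_le j t : `|Y j t| <= r0 by exact: X_le.
have aY := @appr_bin_le _ _ _ P 1 Y r0 Y_le A A_ge1 r0_ltA (fun _ => X_diffuse i) ord0 K a.
have [m0 [d0 d00 H]] := near_moments_appr Y_le aY e0.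
have ms : \forall N \near \oo, microstates Y +oo%E m0 d0 (fun _ => xi N).
  have : \forall N \near \oo, forall k : 'I_m0,
      `|kappa (fun j => xi N j ^+ k.+1) - fine 'E_P[fun t => X i t ^+ k.+1]| < d0.
    apply: filter_forall => k.
    have /cvgrPdist_lt/(_ _ d00) := xiX k.+1 isT.
    by apply: filterS => N; rewrite distrC.
  apply: filterS => N HN; split; first by move=> *; rewrite leey.
  case=> [//|k] /andP[_ km] w; have := HN (Ordinal km).
  rewrite /= !fine_expectation.
  have -> : (fun j => \prod_(l < k.+1) xi N j) = (fun j => xi N j ^+ k.+1).
    by apply/funext => j; rewrite prodr_const card_ord.
  by under [in X in _ -> X]eq_Rintegral do rewrite prodr_const card_ord.
near=> N; rewrite distrC.
by apply: (H m0 d0 (leqnn _) (lexx _) N (fun _ => xi N)); near: N => //; exact: nbhs_infty_gt.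
Unshelve. all: by end_near. Qed.

(** The binned word of [xi i N] and the word [b N i] are both sorted and have asymptotically equal
    cumulative frequencies, so they agree outside a vanishing proportion of indices. Where they
    agree, the entry of [xi] is within one mesh of the representative. *)
Lemma rate_lower_at (xi : 'I_n -> forall N : nat, 'I_N -> R) K m delta :
  (forall i, approximating (X i) (xi i)) -> mesh A K <= 1 ->
  0 < delta -> 2 * (m%:R * A ^+ m * mesh A K) < delta ->
  ((- info (law K))%:E <= limn_einf (log_rate (Delta_sym_at X xi) m delta))%E.
Proof.
move=> xiX h1 delta0 Hm; have [Tn [b [T1 T2 T3 b1 b2]]] := sorted_bins_exist K.
apply: (@rate_lower _ _ _ _ _ X r0 r0_ge0 X_le A rA K Tn T1 T3 b b2 (fun N i => xi i N)) => //.
- move=> i; pose M := (2 ^ K).+1.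
  have cvg0 : \sum_(a < M) `|kappa (fun j : 'I_N => (bin A K (xi i N j) <= a)%N%:R : R)
      - kappa (fun j => (tnth (b N i) j <= a)%N%:R)| @[N --> \oo] --> (0 : R).
    rewrite -[X in _ --> X](_ : \sum_(a < M) (0 : R) = 0); last by rewrite big1.
    apply: cvg_sumr => a; rewrite -[X in _ --> X](normr0 R); apply: cvg_norm.
    pose q := \int[P]_t (bin A K (X i t) <= a)%N%:R : R.
    rewrite -(subrr q); apply: cvgB; first exact: cdf_approximating.
    have -> : (fun N => kappa (fun j => (tnth (b N i) j <= a)%N%:R : R)) =
        (fun N => \sum_(c : cell K) (Tn N c)%:R / N%:R * (c i <= a)%N%:R).
      apply/funext => N.
      rewrite (kappa_tuple (b N i) (fun k => (k <= a)%N%:R)).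
      rewrite [RHS](partition_big (fun c : cell K => c i) xpredT)//=.
      apply: eq_bigr => k _; rewrite b2 -rmarginal_nat /rmarginal mulr_suml.
      by apply: eq_bigr => c /eqP ->.
    have -> : q = \sum_(c : cell K) law K c * (c i <= a)%N%:R.
      rewrite -(Rintegral_cell X A_gt0 (fun c : cell K => (c i <= a)%N%:R)).
      by apply: eq_Rintegral => t _; rewrite ffunE.
    by apply: cvg_sumr => c; apply: cvgM; [exact: T3|exact: cvg_cst].
  apply: (squeeze_cvgr _ (cvg_cst 0) cvg0); near=> N; apply/andP; split.
    by rewrite mulr_ge0 ?invr_ge0// sumr_ge0.
  apply: le_trans (_ : _ <= kappa (fun j : 'I_N =>
      (bin A K (xi i N j) != tnth (b N i) j :> nat)%:R)) _; last first.
    apply: (@card_neq_nondecreasing R N M (fun j => bin A K (xi i N j))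
      (fun j => tnth (b N i) j)) => //.
    + move=> j k jk; apply: bin_le_mono => //.
      by have [xm _] := xiX i; exact: xm.
    + exact: b1.
    + by move=> j; rewrite -ltnS ltn_ord.
    + by move=> j; rewrite -ltnS ltn_ord.
  apply: kappa_le => j; have [e|ne] := eqVneq (bin A K (xi i N j)) (tnth (b N i) j).
    rewrite e eqxx ltNge; suff -> : `|xi i N j - rep r0 A (tnth (b N i) j)| <= mesh A K by [].
    (* A letter that occurs in [b N i] comes from a cell of positive probability, so its bin
       contains a value of [X i], as [rep_dist] requires. *)
    have : (0 < count_mem (tnth (b N i) j) (b N i))%N.
      by rewrite -has_count has_pred1 mem_tnth.
    rewrite b2 /marginal lt0n sum_nat_eq0 negb_forall => /existsP[c].
    rewrite negb_imply -lt0n => /andP[/eqP ci /T2 Tc].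
    have [t tc] := cell_law_gt0 A_gt0 Tc.
    have bt : bin A K (X i t) = tnth (b N i) j.
      by rewrite -ci -tc ffunE.
    rewrite -e; apply: (@rep_dist R r0 r0_ge0 A rA K _ (X i t)) => //.
      by rewrite -ler_norml.
    by rewrite e bt.
  by rewrite val_eqE ne ler_nat leq_b1.
- move=> i k; case: k => [|k].
    by exists 1; near=> N; rewrite kappa_cst//; near: N; exact: nbhs_infty_gt.
  exists (fine 'E_P[fun t => X i t ^+ (2 * k.+1)] + 1).
  have [_ /(_ (2 * k.+1)%N) ] := xiX i; rewrite muln_gt0/= => /(_ isT).
  move=> /cvgrPdist_le/(_ 1 ltr01); apply: filterS => N.
  by rewrite distrC ler_norml => /andP[_]; rewrite lerBlDl addrC.
- by move=> N s sX sT; rewrite finset.inE; apply/asboolP.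
Unshelve. all: by end_near. Qed.

End lower_bounds.

(** * Discretized entropies *)

Section bounded_induction.
Context d (Y : measurableType d) (R : realType).
Implicit Types g h : Y -> R.

Lemma truncn_layers (v e : R) (m : nat) : 0 < e -> 0 <= v < e * m%:R ->
  `|v - \sum_(j < m) e * ((j.+1%:R * e <= v)%R)%:R| <= e.
Proof.
move=> e0 /andP[v0 vm]; have ve : 0 <= v / e by rewrite divr_ge0// ltW.
pose t := Num.truncn (v / e).
have tm : (t <= m)%N.
  have [//|mt] := leqP t m; move: mt; rewrite truncn_gt_nat ler_pdivlMr// => h.
  by move: vm; rewrite ltNge mulrC (le_trans _ h)// ler_pM2r// ler_nat.
have -> : \sum_(j < m) e * ((j.+1%:R * e <= v)%R)%:R = e * t%:R.
  rewrite -mulr_sumr -natr_sum; congr (_ * _%:R).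
  under eq_bigr do rewrite -ler_pdivlMr// -truncn_gt_nat -/t.
  rewrite -[RHS](card_ltn_ord tm) -sum1_card [RHS]big_mkcond.
  by apply: eq_bigr => j _; rewrite finset.inE; case: (j < t)%N.
have /andP[h1 h2] := truncn_itv ve; rewrite -/t in h1 h2.
rewrite ler_pdivlMr// in h1; rewrite ltr_pdivrMr// -natr1 mulrDl mul1r in h2.
by rewrite ler_norml; apply/andP; split; lra.
Qed.

(* Layer-cake sums of indicators approximate uniformly. *)
Lemma bmfun_ind (Q : (Y -> R) -> Prop) :
  (forall E, measurable E -> Q (\1_E : Y -> R)) ->
  (forall g h, bmfun g -> bmfun h -> Q g -> Q h -> Q (fun y => g y + h y)) ->
  (forall c g, bmfun g -> Q g -> Q (fun y => c * g y)) ->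
  (forall g, bmfun g -> (forall e : R, 0 < e -> exists2 h, bmfun h /\ Q h &
     forall y, `|g y - h y| <= e) -> Q g) ->
  forall g, bmfun g -> Q g.
Proof.
move=> Q1 QD QZ Ql g bg; apply: Ql => // e e0.
have [mg [C0 gC0]] := bg; pose C : R := `|C0| + 1.
have gC y : - C < g y < C.
  rewrite -ltr_norml; apply: le_lt_trans (gC0 y) _.
  by rewrite /C (le_lt_trans (ler_norm _))// ltrDl.
pose m := (Num.truncn (2 * C / e)).+1.
have mC : 2 * C < e * m%:R by rewrite [e * _]mulrC -ltr_pdivrMr// truncnS_gt.
pose E (j : 'I_m) := [set y | j.+1%:R * e <= g y + C].
have mE j : measurable (E j).
  have -> : E j = g @^-1` `[j.+1%:R * e - C, +oo[.
    by apply/seteqP; split => y /=; rewrite in_itv/= andbT lerBlDr.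
  by rewrite -[X in measurable X]setTI; exact: mg.
pose s y := \sum_(j <- index_enum 'I_m) e * (\1_(E j) y : R).
have bs1 j : bmfun (fun y => e * (\1_(E j) y : R)).
  by apply: bmfunZ; exact: bmfun_indic.
have bs : bmfun s by exact: bmfun_sum.
have Q0 : Q (fun=> 0).
  have := QZ 0 _ (bmfun_indic R measurable0) (Q1 _ measurable0).
  by congr Q; apply/funext => y; rewrite mul0r.
have QT : Q (fun=> 1).
  have := Q1 _ measurableT.
  by congr Q; apply/funext => y; rewrite indicE in_setT.
have Qs : Q s.
  rewrite /s; elim: (index_enum _) => [|j r IH].
    by under eq_fun do rewrite big_nil.
  under eq_fun do rewrite big_cons.
  by apply: QD => //; [exact: bmfun_sum|apply: QZ; [exact: bmfun_indic|exact: Q1]].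
exists (fun y => s y + - C * 1).
  split; first by apply: bmfunD => //; exact: bmfun_cst.
  by apply: QD => //; [exact: bmfun_cst|apply: QZ => //; exact: bmfun_cst].
move=> y; rewrite mulr1.
have -> : g y - (s y - C) = g y + C - s y by ring.
have -> : s y = \sum_(j < m) e * ((j.+1%:R * e <= g y + C)%R)%:R.
  apply: eq_bigr => j _; congr (_ * _); rewrite indicE; congr (_%:R).
  by congr nat_of_bool; apply/idP/idP; rewrite inE.
apply: truncn_layers => //; have /andP[h1 h2] := gC y.
by apply/andP; split; lra.
Qed.

End bounded_induction.

(** * Approximation in L^1 by functions constant on cells *)

Section step_density.
Variables (R : realType) (n : nat) (A : R).
Hypothesis A_gt0 : 0 < A.
Local Notation cell K := {ffun 'I_n -> 'I_(2 ^ K).+2}.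

Definition box : set (Rvec R n) :=
  [set x | forall i, (- A < tnth x i <= A)].

Definition cellT K (x : Rvec R n) : cell K := cellf A K (tnth x).

Lemma measurable_coord_le i (t : R) : measurable [set x : Rvec R n | tnth x i <= t].
Proof.
have -> : [set x : Rvec R n | tnth x i <= t] = (fun x => tnth x i) @^-1` `]-oo, t].
  by apply/seteqP; split => w /=; rewrite in_itv/=.
by rewrite -[X in measurable X]setTI; apply: measurable_tnth.
Qed.

Lemma measurable_cellT K (c : cell K) : measurable [set x | cellT K x == c].
Proof.
have -> : [set x | cellT K x == c] =
    \bigcap_(i in [set: 'I_n]) [set x : Rvec R n | bin A K (tnth x i) == c i].
  apply/seteqP; split => t /=.
    by move=> /eqP <- i _ /=; rewrite ffunE.
  by move=> H; apply/eqP/ffunP => i; rewrite ffunE; apply/eqP; exact: H.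
apply: fin_bigcap_measurable => [|i _]; first exact: finite_finset.
have ml (k : nat) : measurable [set t : Rvec R n | (bin A K (tnth t i) <= k)%N].
  have [kK|kK] := leqP k (2 ^ K).
    rewrite (_ : [set t | _] = [set w | tnth w i <= grid A K k]).
      exact: measurable_coord_le.
    by apply/seteqP; split => t /=; rewrite bin_le.
  rewrite (_ : [set t | _] = setT)//; apply/seteqP; split => // t _ /=.
  by rewrite (leq_trans _ kK)// leq_ord.
rewrite (_ : [set t | _] = [set t : Rvec R n | (bin A K (tnth t i) <= c i)%N] `\`
    (if (c i : nat) is k.+1 then [set t | (bin A K (tnth t i) <= k)%N] else set0)).
  by apply: measurableD => //; case: (c i : nat).
apply/seteqP; split => t /=.
  move=> /eqP e; split; first by rewrite e.
  by case E: (c i : nat) => [|k]//=; rewrite e E ltnn.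
move=> [h1 h2]; rewrite -val_eqE/= eqn_leq h1/=; move: h2.
by case: (c i : nat) => // k /= /negP; rewrite -ltnNge.
Qed.

Lemma bmfun_cellT K (F : cell K -> R) : bmfun (fun x => F (cellT K x)).
Proof.
under eq_fun do rewrite /cellT cell_sumE.
apply: bmfun_sum => c; apply: bmfunZ; apply/bmfun_bool; exact: measurable_cellT.
Qed.

Lemma measurable_box : measurable box.
Proof.
have -> : box = \bigcap_(i in [set: 'I_n]) [set x | tnth x i <= A] `&`
    \bigcap_(i in [set: 'I_n]) ~` [set x | tnth x i <= - A].
  apply/seteqP; split => x /=.
    move=> H; split => i _ /=; have /andP[h1 h2] := H i => //.
    by apply/negP; rewrite -ltNge.
  move=> [h1 h2] i; rewrite (h1 i I) andbT.
  by have /negP := h2 i I; rewrite -ltNge.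
apply: measurableI; apply: fin_bigcap_measurable => [|i _]; try exact: finite_finset.
  exact: measurable_coord_le.
by apply: measurableC; exact: measurable_coord_le.
Qed.

Variable rho : {finite_measure set (Rvec R n) -> \bar R}.
Hypothesis rho_box : rho (~` box) = 0%E.

(** Asking for all large [K], and not only for some [K], lets two approximations share a
    partition. *)
Definition step_approx (g : Rvec R n -> R) := forall e : R, 0 < e ->
  exists K0 : nat, forall K, (K0 <= K)%N -> exists F : cell K -> R,
    \int[rho]_x `|g x - F (cellT K x)| <= e.

Lemma step_approxD g h : bmfun g -> bmfun h -> step_approx g -> step_approx h ->
  step_approx (fun x => g x + h x).
Proof.
move=> bg bh Hg Hh e e0; have e2 : 0 < e / 2 by rewrite divr_gt0.
have [K1 H1] := Hg _ e2; have [K2 H2] := Hh _ e2.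
exists (maxn K1 K2) => K; rewrite geq_max => /andP[/H1[F HF] /H2[G HG]].
exists (fun c => F c + G c).
have bF := bmfun_cellT F; have bG := bmfun_cellT G.
apply: (@le_trans _ _ (\int[rho]_x (`|g x - F (cellT K x)| + `|h x - G (cellT K x)|))).
  apply: bm_le_Rintegral.
  - by apply/bmfun_norm/bmfunB; exact: bmfunD.
  - by apply: bmfunD; exact/bmfun_norm/bmfunB.
  - by move=> x; rewrite opprD addrACA ler_normD.
rewrite bm_RintegralD; [|exact/bmfun_norm/bmfunB|exact/bmfun_norm/bmfunB].
by rewrite [leRHS]splitr lerD.
Qed.

Lemma step_approxZ c g : bmfun g -> step_approx g -> step_approx (fun x => c * g x).
Proof.
move=> bg Hg e e0; pose k : R := `|c| + 1; have k0 : 0 < k by rewrite ltr_wpDl.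
have [K0 H] := Hg _ (divr_gt0 e0 k0); exists K0 => K /H[F HF].
exists (fun a => c * F a).
under eq_Rintegral do rewrite -mulrBr normrM.
rewrite bm_RintegralZl; last by apply/bmfun_norm/bmfunB => //; exact: bmfun_cellT.
apply: le_trans (ler_wpM2l (normr_ge0 c) HF) _.
by rewrite mulrCA ler_piMr ?(ltW e0)// ler_pdivrMr// mul1r lerDl.
Qed.

Lemma step_approx_limit g : bmfun g ->
  (forall e : R, 0 < e -> exists2 h, bmfun h /\ step_approx h &
     \int[rho]_x `|g x - h x| <= e) -> step_approx g.
Proof.
move=> bg H e e0; have e2 : 0 < e / 2 by rewrite divr_gt0.
have [h [bh Hh] gh] := H _ e2; have [K0 HK] := Hh _ e2.
exists K0 => K /HK[F HF]; exists F.
have bF := bmfun_cellT F.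
apply: (@le_trans _ _ (\int[rho]_x (`|g x - h x| + `|h x - F (cellT K x)|))).
  apply: bm_le_Rintegral.
  - exact/bmfun_norm/bmfunB.
  - by apply: bmfunD; exact/bmfun_norm/bmfunB.
  - by move=> x; rewrite ler_distD.
rewrite bm_RintegralD; [|exact/bmfun_norm/bmfunB|exact/bmfun_norm/bmfunB].
by rewrite [leRHS]splitr lerD.
Qed.

Lemma step_approx_bounded g (C : R) : bmfun g -> (forall x, `|g x| <= C) ->
  step_approx g -> forall e : R, 0 < e ->
  exists K0 : nat, forall K, (K0 <= K)%N -> exists F : cell K -> R,
    (forall c, `|F c| <= C) /\ \int[rho]_x `|g x - F (cellT K x)| <= e.
Proof.
move=> bg gC Hg e e0; have [K0 H] := Hg _ e0; exists K0 => K /H[F HF].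
have C0 : 0 <= C := le_trans (normr_ge0 _) (gC point).
exists (fun c => clip C (F c)); split; first by move=> c; exact: clip_le.
apply: le_trans HF; apply: bm_le_Rintegral.
- by apply/bmfun_norm/bmfunB => //; exact: (bmfun_cellT (fun c => clip C (F c))).
- by apply/bmfun_norm/bmfunB => //; exact: bmfun_cellT.
- by move=> x; exact: clip_dist.
Qed.

Lemma step_approxM g h : bmfun g -> bmfun h -> step_approx g -> step_approx h ->
  step_approx (fun x => g x * h x).
Proof.
move=> bg bh Hg Hh e e0; have [mg [C gC]] := bg; have [mh [D hD]] := bh.
have C0 : 0 <= C := le_trans (normr_ge0 _) (gC point).
have D0 : 0 <= D := le_trans (normr_ge0 _) (hD point).
pose k : R := C + D + 1; have k0 : 0 < k by rewrite ltr_wpDl// addr_ge0.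
have [K1 H1] := step_approx_bounded bg gC Hg (divr_gt0 e0 k0).
have [K2 H2] := step_approx_bounded bh hD Hh (divr_gt0 e0 k0).
exists (maxn K1 K2) => K; rewrite geq_max => /andP[/H1[F [FC HF]] /H2[G [GD HG]]].
exists (fun c => F c * G c).
have bF := bmfun_cellT F; have bG := bmfun_cellT G.
have b1 : bmfun (fun x => `|g x - F (cellT K x)|) by exact/bmfun_norm/bmfunB.
have b2 : bmfun (fun x => `|h x - G (cellT K x)|) by exact/bmfun_norm/bmfunB.
apply: (@le_trans _ _ (\int[rho]_x (D * `|g x - F (cellT K x)| + C * `|h x - G (cellT K x)|))).
  apply: bm_le_Rintegral.
  - by apply/bmfun_norm/bmfunB; exact: bmfunM.
  - by apply: bmfunD; exact: bmfunZ.
  - move=> x; set f := F _; set p := G _.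
    have -> : g x * h x - f * p = (g x - f) * p + g x * (h x - p) by ring.
    rewrite (le_trans (ler_normD _ _))// !normrM lerD//.
      by rewrite mulrC ler_wpM2r// /p GD.
    by rewrite ler_wpM2r.
rewrite bm_RintegralD; [|exact: bmfunZ|exact: bmfunZ].
rewrite !bm_RintegralZl//.
apply: (@le_trans _ _ (D * (e / k) + C * (e / k))); first by rewrite lerD// ler_wpM2l.
rewrite -mulrDl mulrCA ler_piMr ?(ltW e0)// ler_pdivrMr// mul1r /k; lra.
Qed.

Lemma step_approx_cst c : step_approx (fun=> c).
Proof.
move=> e e0; exists 0%N => K _; exists (fun=> c).
by under eq_Rintegral do rewrite subrr normr0; rewrite bm_Rintegral_cst mul0r ltW.
Qed.

Lemma step_approx_set E (S : nat -> set (Rvec R n)) : measurable E ->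
  (forall K, measurable (S K)) -> fine (rho (S K)) @[K --> \oo] --> 0 ->
  (forall K, exists F : cell K -> R, forall x, `|\1_E x - F (cellT K x)| <= \1_(S K) x) ->
  step_approx (\1_E : Rvec R n -> R).
Proof.
move=> mE mS S0 H e e0.
have /cvgrPdist_le/(_ e e0)[K0 _ HK] := S0; exists K0 => K /HK.
rewrite sub0r normrN => rS; have [F HF] := H K; exists F.
apply: (@le_trans _ _ (\int[rho]_x (\1_(S K) x : R))).
  apply: bm_le_Rintegral => //; last exact: bmfun_indic.
  by apply/bmfun_norm/bmfunB; [exact: bmfun_indic|exact: bmfun_cellT].
by rewrite Rintegral_indic// (le_trans _ rS)// ler_norm.
Qed.

Lemma mesh_le (K L : nat) : (K <= L)%N -> mesh A L <= mesh A K.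
Proof.
move=> KL; rewrite /mesh ler_wpM2l ?mulr_ge0 ?(ltW A_gt0)//.
by rewrite lef_pV2 ?posrE ?ltr0n ?expn_gt0// ler_nat leq_exp2l.
Qed.

Lemma mesh_small (e : R) : 0 < e -> exists K0, forall K, (K0 <= K)%N -> mesh A K < e.
Proof.
move=> e0; exists (Num.truncn (2 * A / e)) => K KK; apply: le_lt_trans (mesh_le KK) _.
rewrite /mesh; set k := Num.truncn _.
rewrite ltr_pdivrMr ?ltr0n ?expn_gt0// -ltr_pdivrMl// mulrC.
by apply: lt_le_trans (truncnS_gt _) _; rewrite ler_nat -/k ltn_expl.
Qed.

Lemma step_approx_setC E : measurable E -> step_approx (\1_E : Rvec R n -> R) ->
  step_approx (\1_(~` E) : Rvec R n -> R).
Proof.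
move=> mE HE; have -> : (\1_(~` E) : Rvec R n -> R) = (fun x => 1 + -1 * \1_E x).
  apply/funext => x; rewrite !indicE in_setC mulN1r.
  by case: (x \in E); rewrite ?subrr ?subr0.
apply: step_approxD; [exact: bmfun_cst|apply: bmfunZ; exact: bmfun_indic| |].
  exact: step_approx_cst.
by apply: step_approxZ => //; exact: bmfun_indic.
Qed.

Lemma step_approx_setU E F : measurable E -> measurable F ->
  step_approx (\1_E : Rvec R n -> R) -> step_approx (\1_F : Rvec R n -> R) ->
  step_approx (\1_(E `|` F) : Rvec R n -> R).
Proof.
move=> mE mF HE HF.
have -> : (\1_(E `|` F) : Rvec R n -> R) =
    (fun x => \1_E x + (\1_F x + -1 * (\1_E x * \1_F x))).
  apply/funext => x; rewrite !indicE in_setU mulN1r.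
  by case: (x \in E); case: (x \in F); rewrite /=; ring.
have bE := bmfun_indic R mE; have bF := bmfun_indic R mF.
have bEF := bmfunM bE bF.
apply: step_approxD => //; first by apply: bmfunD => //; exact: bmfunZ.
apply: step_approxD => //; first exact: bmfunZ.
by apply: step_approxZ => //; exact: step_approxM.
Qed.

Lemma finite_measure_nonincreasing (D : nat -> set (Rvec R n)) :
  (forall k, measurable (D k)) -> nonincreasing_seq D -> \bigcap_k D k = set0 ->
  fine (rho (D k)) @[k --> \oo] --> 0.
Proof.
move=> mD nD D0.
have : rho \o D @ \oo --> rho (\bigcap_k D k).
  apply: nonincreasing_cvg_mu => //; last by rewrite D0.
  by rewrite ltey_eq fin_num_measure.
by rewrite D0 measure0 => /fine_cvgP[].
Qed.

Lemma step_approx_bigcup (F : nat -> set (Rvec R n)) :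
  (forall k, measurable (F k)) ->
  (forall k, step_approx (\1_(F k) : Rvec R n -> R)) ->
  step_approx (\1_(\bigcup_k F k) : Rvec R n -> R).
Proof.
move=> mF HF; pose U N := \big[setU/set0]_(i < N) F i.
have mU N : measurable (U N) by apply: bigsetU_measurable.
have mUF : measurable (\bigcup_k F k) by exact: bigcupT_measurable.
have HU N : step_approx (\1_(U N) : Rvec R n -> R).
  elim: N => [|N IH]; rewrite /U.
    rewrite big_ord0; have -> : (\1_set0 : Rvec R n -> R) = fun=> 0.
      by apply/funext => x; rewrite indicE in_set0.
    exact: step_approx_cst.
  rewrite big_ord_recr/=; apply: step_approx_setU => //; exact: mU.
have UN N : U N `<=` \bigcup_k F k.
  by rewrite /U -bigcup_mkord => x [i _ Fx]; exists i.
have D0 : fine (rho ((\bigcup_k F k) `\` U N)) @[N --> \oo] --> 0.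
  apply: finite_measure_nonincreasing.
  - by move=> k; exact: measurableD.
  - move=> k l kl; apply/subsetPset; apply: setDS.
    rewrite /U -!bigcup_mkord => x [i /= ik Fx]; exists i => //=.
    exact: leq_trans kl.
  - apply/seteqP; split => // x H; have [[k _ Fx] _] := H 0%N I.
    have [_] := H k.+1 I; apply; rewrite /U -bigcup_mkord; exists k => //=.
apply: step_approx_limit; first exact: bmfun_indic.
move=> e e0; have /cvgrPdist_le/(_ e e0)[N _ /(_ N (leqnn N))] := D0.
rewrite sub0r normrN => h; exists (\1_(U N)).
  by split=> //; exact: bmfun_indic.
apply: le_trans (le_trans (ler_norm _) h).
rewrite -Rintegral_indic; last exact: measurableD.
apply: bm_le_Rintegral.
- by apply/bmfun_norm/bmfunB; exact: bmfun_indic.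
- by apply: bmfun_indic; exact: measurableD.
- move=> x; rewrite !indicE in_setD.
  have [xU|xU] := boolP (x \in U N).
    have -> : x \in \bigcup_k F k by apply/mem_set/(UN N)/set_mem.
    by rewrite subrr normr0.
  by rewrite subr0 andbT; case: (x \in _); rewrite ?normr1 ?normr0.
Qed.

(** Inside the box the cells beyond the bin of [t] miss only a strip of width [mesh A K] next to the
    hyperplane. The strip is open on the side of [t], so it decreases to the empty set even when
    [rho] charges the hyperplane. For [t] outside [[-A, A[] the indicator is constant on the box. *)
Lemma step_approx_halfspace i (t : R) :
  step_approx (\1_[set x : Rvec R n | t < tnth x i] : Rvec R n -> R).
Proof.
have mE (s : R) : measurable [set x : Rvec R n | s < tnth x i].
  have -> : [set x : Rvec R n | s < tnth x i] = ~` [set x | tnth x i <= s].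
    apply/seteqP; split => x /=; first by move=> h; apply/negP; rewrite -ltNge.
    by move/negP; rewrite -ltNge.
  by apply: measurableC; exact: measurable_coord_le.
have indle (E S : set (Rvec R n)) (b : bool) x : (x \notin S -> (x \in E) = b) ->
    `|\1_E x - b%:R : R| <= \1_S x.
  move=> H; rewrite !indicE; case: (x \in S) H => H.
    by case: (x \in E); case: b {H}; rewrite ?subrr ?subr0 ?sub0r ?normrN ?normr0 ?normr1.
  by rewrite H// subrr normr0.
have [tA|tA] := ltP t (- A).
  apply: (@step_approx_set _ (fun=> ~` box)) => //.
  - by move=> _; apply: measurableC; exact: measurable_box.
  - by under eq_cvg do rewrite rho_box; exact: cvg_cst.
  - move=> K; exists (fun=> true%:R) => x; apply: indle; rewrite in_setC negbK.
    move=> /set_mem xb; apply/mem_set => /=; have /andP[xA _] := xb i.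
    exact: lt_trans xA.
have [At|At] := leP A t.
  apply: (@step_approx_set _ (fun=> ~` box)) => //.
  - by move=> _; apply: measurableC; exact: measurable_box.
  - by under eq_cvg do rewrite rho_box; exact: cvg_cst.
  - move=> K; exists (fun=> false%:R) => x; apply: indle; rewrite in_setC negbK.
    move=> /set_mem xb; apply/negbTE/negP => /set_mem /=; have /andP[_ xA] := xb i.
    by move=> /(le_lt_trans At); rewrite ltNge xA.
pose S' K := [set x : Rvec R n | t < tnth x i] `&`
  [set x : Rvec R n | tnth x i <= t + mesh A K].
have mS' K : measurable (S' K).
  by apply: measurableI => //; exact: measurable_coord_le.
apply: (@step_approx_set _ S') => //.
  apply: finite_measure_nonincreasing => //.
    move=> k l kl; apply/subsetPset => x [h1 /= h2]; split => //=.
    by rewrite (le_trans h2)// lerD2l mesh_le.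
  apply/seteqP; split => // x H; have [/= tx _] := H 0%N I.
  have [K0 /(_ K0 (leqnn _)) HK] : exists K0, forall K, (K0 <= K)%N ->
      mesh A K < tnth x i - t by apply: mesh_small; rewrite subr_gt0.
  have [_ /=] := H K0 I; rewrite leNgt; apply/negP; rewrite negbK.
  by rewrite addrC -ltrBrDr.
move=> K; pose k := bin A K t.
exists (fun c : cell K => (k < c i)%N%:R) => x; apply: indle => xS.
rewrite ffunE ltnNge.
have kb : (k <= 2 ^ K)%N by rewrite bin_le// grid_max ltW.
rewrite bin_le// -ltNge.
apply/idP/idP => [/set_mem /= tx|gx].
  rewrite ltNge; apply: contra xS => xg; apply/mem_set; split => //=.
  have [t0|t0] := eqVneq t (- A).
    move: xg; have -> : (k : nat) = 0%N by apply/eqP; rewrite bin_eq0// t0.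
    by rewrite grid0 -t0 leNgt tx.
  have k0 : (0 < k)%N by rewrite lt0n bin_eq0// -ltNge lt_neqAle eq_sym t0.
  have /andP[h1 h2] := @bin_dist _ _ A_gt0 K t k (introT andP (conj k0 kb)) erefl.
  by rewrite (le_trans xg)// -lerBlDr ltW.
apply/mem_set => /=; apply: le_lt_trans gx; rewrite -bin_le//.
Qed.

(** The sets with approximable indicator form a sigma-algebra, and the open half-lines generating
    the Borel sets have coordinate preimages in it. These preimages generate the product
    structure. *)
Lemma step_approx_indic E : measurable E -> step_approx (\1_E : Rvec R n -> R).
Proof.
pose C := [set E : set (Rvec R n) | measurable E /\ step_approx (\1_E : Rvec R n -> R)].
have sC : sigma_algebra setT C.
  split.
  - split=> //; have -> : (\1_set0 : Rvec R n -> R) = fun=> 0.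
      by apply/funext => x; rewrite indicE in_set0.
    exact: step_approx_cst.
  - move=> E' [mE' HE']; rewrite setTD; split; first exact: measurableC.
    exact: step_approx_setC.
  - move=> F HF; split; first by apply: bigcupT_measurable => k; have [] := HF k.
    by apply: step_approx_bigcup => k; have [] := HF k.
have coordC (i : 'I_n) (B : set (measurableTypeR R)) : measurable B ->
    C ((fun x : Rvec R n => tnth x i) @^-1` B).
  pose G := [set B : set R | C ((fun x : Rvec R n => tnth x i) @^-1` B)].
  have sG : sigma_algebra setT G.
    have [s0 sD sU] := sC; split.
    - by rewrite /G/= preimage_set0.
    - by move=> B' /sD; rewrite /G/= !setTD preimage_setC.
    - by move=> F HF; rewrite /G/= preimage_bigcup; exact: sU.
  move=> mB; have {}mB : (@RGenOInfty.G R).-sigma.-measurable B.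
    by rewrite -RGenOInfty.measurableE.
  apply: (smallest_sub (G := @RGenOInfty.G R) sG) mB => // _ [t ->]; rewrite /G/=.
  have -> : (fun x : Rvec R n => tnth x i) @^-1` `]t, +oo[ = [set x | t < tnth x i].
    by apply/seteqP; split => x /=; rewrite in_itv/= andbT.
  split; last exact: step_approx_halfspace.
  have -> : [set x : Rvec R n | t < tnth x i] = ~` [set x | tnth x i <= t].
    apply/seteqP; split => x /=; first by move=> h; apply/negP; rewrite -ltNge.
    by move/negP; rewrite -ltNge.
  by apply: measurableC; exact: measurable_coord_le.
move=> mE; suff [] : C E by [].
apply: (smallest_sub (G := \big[setU/set0]_(i < n) preimage_set_system setT
   (fun x : Rvec R n => tnth x i) measurable)) mE => //.
apply: (big_ind (fun S => S `<=` C)) => // [S S' SC S'C X [/SC|/S'C]//|i _ X [B mB <-]].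
by rewrite setTI; exact: coordC.
Qed.

Theorem step_approx_bmfun g : bmfun g -> step_approx g.
Proof.
apply: bmfun_ind g.
- exact: step_approx_indic.
- exact: step_approxD.
- by move=> c g; exact: step_approxZ.
- move=> g bg H; apply: step_approx_limit => // e e0.
  pose k : R := fine (rho setT) + 1; have k0 : 0 < k by rewrite ltr_wpDl// fine_ge0.
  have [h [bh Hh] gh] := H _ (divr_gt0 e0 k0); exists h => //.
  apply: (@le_trans _ _ (\int[rho]_x (e / k))).
    by apply: bm_le_Rintegral => //; [exact/bmfun_norm/bmfunB|exact: bmfun_cst].
  rewrite bm_Rintegral_cst mulrAC ler_pdivrMr// ler_wpM2l ?(ltW e0)//.
  by rewrite /k lerDl.
Qed.

End step_density.

(** Linear functionals that are Lipschitz for the uniform norm are determined by their values on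
    indicators. This identifies integrals against [lamB], and against a law with density, with
    Lebesgue integrals over the box. *)
Lemma bmfun_functional_eq d (Y : measurableType d) (R : realType)
    (L1 L2 : (Y -> R) -> R) (C : R) :
  (forall g h, bmfun g -> bmfun h -> L1 (fun y => g y + h y) = L1 g + L1 h) ->
  (forall g h, bmfun g -> bmfun h -> L2 (fun y => g y + h y) = L2 g + L2 h) ->
  (forall c g, bmfun g -> L1 (fun y => c * g y) = c * L1 g) ->
  (forall c g, bmfun g -> L2 (fun y => c * g y) = c * L2 g) ->
  (forall g h e, bmfun g -> bmfun h -> (forall y, `|g y - h y| <= e) ->
     `|L1 g - L1 h| <= C * e) ->
  (forall g h e, bmfun g -> bmfun h -> (forall y, `|g y - h y| <= e) ->
     `|L2 g - L2 h| <= C * e) ->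
  (forall E, measurable E -> L1 (\1_E) = L2 (\1_E)) ->
  forall g, bmfun g -> L1 g = L2 g.
Proof.
move=> L1D L2D L1Z L2Z L1C L2C L12; apply: bmfun_ind => //.
- by move=> g h bg bh gE hE; rewrite L1D// L2D// gE hE.
- by move=> c g bg gE; rewrite L1Z// L2Z// gE.
move=> g bg H; apply/eqP; rewrite -subr_eq0 -normr_le0; apply/ler_addgt0Pl => e e0.
rewrite addr0; pose k : R := 2 * `|C| + 1.
have k0 : 0 < k by rewrite ltr_wpDl// mulr_ge0.
have [h [bh hE] gh] := H _ (divr_gt0 e0 k0).
have -> : L1 g - L2 g = (L1 g - L1 h) - (L2 g - L2 h) by rewrite hE; ring.
rewrite (le_trans (ler_normB _ _))//.
have := L1C _ _ _ bg bh gh; have := L2C _ _ _ bg bh gh.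
have : C * (e / k) <= `|C| * (e / k).
  by rewrite ler_wpM2r ?ler_norm// divr_ge0// ltW.
have : (2 * `|C|) * (e / k) <= e.
  by rewrite mulrCA ler_piMr ?(ltW e0)// ler_pdivrMr// mul1r lerDl.
lra.
Qed.

Lemma bm_Rintegral_dist_le d (Y : measurableType d) (R : realType)
    (m : {finite_measure set Y -> \bar R}) (g h : Y -> R) (e : R) :
  bmfun g -> bmfun h -> (forall y, `|g y - h y| <= e) ->
  `|\int[m]_y g y - \int[m]_y h y| <= fine (m setT) * e.
Proof.
move=> bg bh gh; rewrite -bm_RintegralB//.
apply: le_trans (bm_le_normr_Rintegral _ (bmfunB bg bh)) _.
rewrite mulrC -(bm_Rintegral_cst m e); apply: bm_le_Rintegral => //.
- exact/bmfun_norm/bmfunB.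
- exact: bmfun_cst.
Qed.

Section finite_measure_add.
Context d (Y : measurableType d) (R : realType).
Variables (m1 m2 : {finite_measure set Y -> \bar R}).

Let measure_add_fin : fin_num_fun (measure_add m1 m2).
Proof. by move=> E mE; rewrite measure_addE fin_numD !fin_num_measure. Qed.

HB.instance Definition _ := Measure.on (measure_add m1 m2).
HB.instance Definition _ := @Measure_isFinite.Build _ Y R (measure_add m1 m2) measure_add_fin.

Lemma Rintegral_measure_add (g : Y -> R) : bmfun g -> (forall y, 0 <= g y) ->
  \int[measure_add m1 m2]_y g y = \int[m1]_y g y + \int[m2]_y g y.
Proof.
move=> bg g0; rewrite /Rintegral ge0_integral_measure_add//.
- rewrite fineD//; apply: integrable_fin_num => //; exact: bmfun_integrable.
- by move=> y _; rewrite lee_fin.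
- by apply/measurable_EFinP; case: bg.
Qed.

End finite_measure_add.

(** * Lebesgue measure on the box *)

Section volume.
Variables (R : realType) (n : nat) (A : R).
Hypothesis A_gt0 : 0 < A.
Local Notation cell K := {ffun 'I_n -> 'I_(2 ^ K).+2}.
Local Notation lam := (lebesgue R n).

Lemma lebesgue_box_lt_pinfty : (lam (@box R n A) < +oo)%E.
Proof.
have -> : @box R n A = [set t | forall i, `]- A, A]%classic (tnth t i)].
  by apply/seteqP; split => t H i; have := H i; rewrite /= in_itv.
rewrite (lebesgue_box (A := fun _ => `]- A, A]%classic))//.
rewrite (eq_bigr (fun=> (A - - A)%:E)) => [|i _]; last first.
  by rewrite lebesgue_measure_itv/= lte_fin ifT//; have A0 := A_gt0; lra.
by rewrite prodEFin ltry.
Qed.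

Definition lamB : {finite_measure set (Rvec R n) -> \bar R} :=
  mfrestr (@measurable_box R n A) lebesgue_box_lt_pinfty.

Definition vol K (c : cell K) : R := fine (lamB [set x | cellT A K x == c]).

Definition inner K (c : cell K) := [forall i, (0 < c i <= 2 ^ K)%N].

Lemma volE K (c : cell K) : vol c = if inner c then mesh A K ^+ n else 0.
Proof.
pose I_ (k : nat) : set R := if (0 < k <= 2 ^ K)%N then
  `]grid A K k - mesh A K, grid A K k]%classic else set0.
have mI k : measurable (I_ k) by rewrite /I_; case: ifP.
have cellE : [set x : Rvec R n | cellT A K x == c] `&` box A =
    [set t | forall i, I_ (c i) (tnth t i)].
  apply/seteqP; split => [x [/= /eqP xc xb] i|x xI].
    have bi : bin A K (tnth x i) = c i :> nat by rewrite -xc ffunE.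
    have /andP[b1 b2] := xb i.
    have ci : (0 < c i <= 2 ^ K)%N.
      by rewrite -bi lt0n bin_eq0// -ltNge b1/= bin_le// grid_max.
    by rewrite /I_ ci /= in_itv/=; exact: bin_dist.
  have xin i : (0 < c i <= 2 ^ K)%N /\ grid A K (c i) - mesh A K < tnth x i <= grid A K (c i).
    by have := xI i; rewrite /I_; case: ifP => //= _; rewrite in_itv.
  have prE i : grid A K (c i) - mesh A K = grid A K (c i).-1.
    have [/andP[c0 _] _] := xin i.
    by rewrite -{1}(prednK c0) gridS addrK.
  split.
    apply/eqP/ffunP => i; rewrite ffunE; apply/val_inj/eqP => /=.
    have [/andP[c0 c1] ] := xin i; rewrite prE => /andP[x1 x2].
    rewrite eqn_leq bin_le// x2/= -(prednK c0) ltnNge bin_le -?ltNge//.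
    by rewrite (leq_trans _ c1)// leq_pred.
  move=> i; have [/andP[c0 c1] ] := xin i; rewrite prE => /andP[x1 x2].
  rewrite -{1}(grid0 A K) (le_lt_trans _ x1) ?grid_le//=.
  by rewrite (le_trans x2)// -[leRHS](grid_max A K) grid_le.
rewrite /vol /lamB /= /mfrestr /mrestr cellE (lebesgue_box (A := fun i => I_ (c i))); last by move=> i; exact: mI.
have lI k : lebesgue_measure (I_ k) = (if (0 < k <= 2 ^ K)%N then mesh A K else 0)%:E.
  rewrite /I_; case: ifP => _; last by rewrite measure0.
  rewrite lebesgue_measure_itv/= lte_fin ltrBlDr ltrDl mesh_gt0//.
  by rewrite -EFinB; congr EFin; ring.
rewrite (eq_bigr (fun i => (if (0 < c i <= 2 ^ K)%N then mesh A K else 0)%:E)) => [|i _//].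
rewrite prodEFin /=; case: ifPn => [/forallP ci|].
  by rewrite (eq_bigr (fun=> mesh A K)) ?prodr_const ?card_ord// => i _; rewrite ci.
by rewrite negb_forall => /existsP[i /negPf ci]; rewrite (bigD1 i)//= ci mul0r.
Qed.

Lemma vol_le K (c : cell K) : vol c <= mesh A K ^+ n.
Proof.
by rewrite volE; case: ifP => // _; rewrite exprn_ge0// ltW// mesh_gt0.
Qed.

Lemma vol_ge0 K (c : cell K) : 0 <= vol c.
Proof. exact: fine_ge0. Qed.

Lemma Rintegral_cellT (m : {finite_measure set (Rvec R n) -> \bar R}) K (F : cell K -> R) :
  \int[m]_x F (cellT A K x) = \sum_c fine (m [set x | cellT A K x == c]) * F c.
Proof.
under eq_Rintegral do rewrite /cellT cell_sumE.
have bc (c : cell K) : bmfun (fun x : Rvec R n => (cellf A K (tnth x) == c)%:R : R).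
  by apply: bmfun_bool; exact: measurable_cellT.
rewrite bm_Rintegral_sum; last by move=> c; exact/bmfunZ/bc.
apply: eq_bigr => c _; rewrite bm_RintegralZl//.
by rewrite mulrC Rintegral_bool//; exact: measurable_cellT.
Qed.

Lemma bm_box_integrable (g : Rvec R n -> R) : bmfun g ->
  lam.-integrable (box A) (EFin \o g).
Proof.
move=> [mg [C gC]]; have mb := @measurable_box R n A.
apply: measurable_bounded_integrable => //.
- exact: lebesgue_box_lt_pinfty.
- exact: measurable_funTS.
- exists C; split; first exact: num_real.
  by move=> M CM t _ /=; apply: (le_trans (gC t)); exact: ltW.
Qed.

Lemma lamBE (g : Rvec R n -> R) : bmfun g ->
  \int[lamB]_x g x = \int[lam]_(x in box A) g x.
Proof.
have mb := @measurable_box R n A.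
have bi := bm_box_integrable.
apply: (bmfun_functional_eq (L1 := fun g => \int[lamB]_x g x)
  (L2 := fun g => \int[lam]_(x in box A) g x) (C := fine (lam (box A)))).
- by move=> *; exact: bm_RintegralD.
- by move=> g' h bg bh; rewrite RintegralD//; exact: bi.
- by move=> *; exact: bm_RintegralZl.
- by move=> c g' bg; rewrite RintegralZl//; exact: bi.
- move=> g' h e bg bh gh; have := bm_Rintegral_dist_le lamB bg bh gh.
  by rewrite /= /mfrestr /mrestr setTI.
- move=> g' h e bg bh gh; rewrite -RintegralB//; [|exact: bi|exact: bi].
  apply: le_trans (le_normr_Rintegral _ _) _ => //; first exact/bi/bmfunB.
  rewrite mulrC -Rintegral_cst//; apply: le_Rintegral => //.
  - exact/bi/bmfun_norm/bmfunB.
  - exact/bi/bmfun_cst.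
- move=> E mE; rewrite Rintegral_indic// /Rintegral integral_indic//.
Qed.

End volume.

Lemma expR_dist_le (R : realType) (M a b : R) : `|a| <= M -> `|b| <= M ->
  `|expR a - expR b| <= expR M * `|a - b|.
Proof.
wlog ab : a b / b <= a.
  move=> H aM bM; have [ba|ab] := leP b a; first exact: H.
  by rewrite distrC [X in _ * X]distrC; apply: H => //; exact: ltW.
move=> aM bM; rewrite !ger0_norm ?subr_ge0 ?ler_expR//.
have h : expR a * (1 + (b - a)) <= expR b.
  have -> : expR b = expR a * expR (b - a) by rewrite -expRD; congr expR; ring.
  by rewrite ler_wpM2l ?expR_ge0// expR_ge1Dx.
have h2 : expR a * (a - b) <= expR M * (a - b).
  by rewrite ler_wpM2r ?subr_ge0// ler_expR (le_trans (ler_norm _)).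
by move: h h2; rewrite !mulrDr !mulrN mulr1; lra.
Qed.

(* Young's inequality for the convex conjugates [u ln u - u] and [exp]. *)
Lemma young_xlnx (R : realType) (u v F : R) : 0 < u -> 0 < v ->
  u * F - v * expR F + u <= xlnx u - u * ln v.
Proof.
move=> u0 v0; have y0 : 0 < v * expR F / u by rewrite divr_gt0// mulr_gt0// expR_gt0.
have := ler_wpM2l (ltW u0) (ln_le_subr1 y0).
rewrite lnM ?posrE ?invr_gt0// ?mulr_gt0 ?expR_gt0//.
rewrite lnV ?posrE// lnM ?posrE ?expR_gt0// expRK.
have -> : u * (v * expR F / u - 1) = v * expR F - u by field; rewrite gt_eqF.
rewrite /xlnx; lra.
Qed.

(** * Discretized entropy and test functions *)

Section law_entropy.
Variables (R : realType) (n : nat) (A : R).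
Hypothesis A_gt0 : 0 < A.
Local Notation cell K := {ffun 'I_n -> 'I_(2 ^ K).+2}.
Local Notation lam := (lebesgue R n).
Variable nu : probability (Rvec R n) R.
Hypothesis nu_box : nu (~` @box R n A) = 0%E.

Definition nucell K (c : cell K) : R := fine (nu [set x | cellT A K x == c]).

(** The differential entropy of the law averaged over cells, whose density on a cell [c] is
    [nucell c / mesh A K ^+ n]; this normalization produces the term in [ln (mesh A K)]. *)
Definition Hdisc K : R := - \sum_c xlnx (@nucell K c) + n%:R * ln (mesh A K).

Local Notation lamB := (lamB n A_gt0).

Lemma nucell_ge0 K (c : cell K) : 0 <= nucell c. Proof. exact: fine_ge0. Qed.

Lemma Rintegral_nucell K (F : cell K -> R) :
  \int[nu]_x F (cellT A K x) = \sum_c nucell c * F c.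
Proof. exact: Rintegral_cellT. Qed.

Lemma Rintegral_vol K (F : cell K -> R) :
  \int[lamB]_x F (cellT A K x) = \sum_c vol A_gt0 c * F c.
Proof. exact: Rintegral_cellT. Qed.

Lemma sum_nucell K : \sum_c @nucell K c = 1.
Proof.
have := Rintegral_nucell (fun _ : cell K => 1); rewrite Rintegral_probability_cst => ->.
by apply: eq_bigr => c _; rewrite mulr1.
Qed.

Lemma nucell_inner K (c : cell K) : ~~ inner c -> nucell c = 0.
Proof.
rewrite /nucell negb_forall => /existsP[i ci].
rewrite (@subset_measure0 _ _ _ nu _ (~` @box R n A)) //.
- exact: measurable_cellT.
- by apply: measurableC; exact: measurable_box.
move=> x /= /eqP xc xb; have /andP[b1 b2] := xb i; move/negP: ci; apply.
have bi : bin A K (tnth x i) = c i :> nat by rewrite -xc ffunE.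
by rewrite -bi lt0n bin_eq0// -ltNge b1/= bin_le// grid_max.
Qed.

Lemma nucell_vol K (c : cell K) : 0 < nucell c -> vol A_gt0 c = mesh A K ^+ n.
Proof.
move=> c0; rewrite volE//; case: ifPn => // /nucell_inner ci.
by rewrite ci ltxx in c0.
Qed.

Lemma Hdisc_sum K : - Hdisc K = \sum_c (xlnx (@nucell K c) - nucell c * ln (mesh A K ^+ n)).
Proof.
rewrite sumrB -mulr_suml sum_nucell mul1r lnXn ?mesh_gt0// /Hdisc -mulr_natl; ring.
Qed.

(* Donsker-Varadhan: up to a constant [- Hdisc K] is a relative entropy between
   discretizations, so any test function bounds it from below once it is nearly
   constant on cells. *)
Lemma dv_Hdisc (psi : Rvec R n -> R) (e : R) : bmfun psi -> 0 < e ->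
  exists K0, forall K, (K0 <= K)%N ->
    \int[nu]_x psi x - \int[lamB]_x expR (psi x) + 1 - e <= - Hdisc K.
Proof.
move=> bpsi e0; have [mpsi [M psiM]] := bpsi.
have M0 : 0 <= M := le_trans (normr_ge0 _) (psiM point).
(* With the sum of the two measures, a single step function approximates [psi] in both L^1 norms. *)
pose rho : {finite_measure set (Rvec R n) -> \bar R} := measure_add nu lamB.
have rho_box : rho (~` @box R n A) = 0%E.
  have -> : rho (~` @box R n A) = (nu (~` @box R n A) + lamB (~` @box R n A))%E.
    exact: measure_addE.
  by rewrite nu_box add0e /= /mfrestr /mrestr setICl measure0.
pose k : R := 1 + expR M; have k0 : 0 < k by rewrite addr_gt0// expR_gt0.
have [K0 H] := step_approx_bounded A_gt0 bpsi psiM (step_approx_bmfun A_gt0 rho_box bpsi)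
  (divr_gt0 e0 k0).
exists K0 => K /H[F [FM]]; pose G x := F (cellT A K x).
have bG : bmfun G by exact: bmfun_cellT.
have bd : bmfun (fun x => `|psi x - G x|) by exact/bmfun_norm/bmfunB.
have bexp g : bmfun g -> (forall x, `|g x| <= M) -> bmfun (fun x => expR (g x)).
  move=> [mg _] gM; split; first exact: measurableT_comp.
  exists (expR M) => x; rewrite ger0_norm ?expR_ge0// ler_expR.
  exact: le_trans (ler_norm _) (gM x).
have GM x : `|G x| <= M by exact: FM.
rewrite Rintegral_measure_add //.
set d1 := \int[nu]_x `|_|; set d2 := \int[lamB]_x `|_| => d12.
have d10 : 0 <= d1 by apply: Rintegral_ge0.
have d20 : 0 <= d2 by apply: Rintegral_ge0.
have h1 : \int[nu]_x psi x - \int[nu]_x G x <= d1.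
  rewrite -bm_RintegralB// (le_trans (ler_norm _))//.
  by apply: bm_le_normr_Rintegral; exact: bmfunB.
have h2 : \int[lamB]_x expR (G x) - \int[lamB]_x expR (psi x) <= expR M * d2.
  rewrite -bm_RintegralB; [|exact: bexp|exact: bexp].
  rewrite -bm_RintegralZl//; apply: bm_le_Rintegral.
  - by apply: bmfunB; exact: bexp.
  - exact: bmfunZ.
  - move=> x; rewrite (le_trans (ler_norm _))// [X in _ * X]distrC.
    exact: expR_dist_le.
(* Young's inequality with [u = nucell c] and [v = vol A_gt0 c], summed over the cells; cells
   without mass contribute a nonpositive term on the left. *)
have h3 : \int[nu]_x G x - \int[lamB]_x expR (G x) + 1 <= - Hdisc K.
  rewrite Rintegral_nucell (Rintegral_vol (fun c => expR (F c))) -(sum_nucell K).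
  rewrite -sumrB -big_split/= Hdisc_sum; apply: ler_sum => c _.
  have := nucell_ge0 c; rewrite le_eqVlt => /predU1P[<-|c0].
    rewrite !mul0r xlnx0 subr0 sub0r addr0 oppr_le0 mulr_ge0 ?expR_ge0//.
    exact: vol_ge0.
  rewrite nucell_vol//; apply: young_xlnx => //.
  by rewrite exprn_gt0// mesh_gt0.
have h4 : d1 + expR M * d2 <= e.
  have : k * (d1 + d2) <= e by rewrite mulrC -ler_pdivlMr.
  have : d1 <= k * d1 by rewrite ler_peMl// lerDl expR_ge0.
  have : expR M * d2 <= k * d2 by rewrite ler_wpM2r// lerDr.
  lra.
lra.
Qed.

End law_entropy.

(** Positive and negative parts are compared separately, so that the integral of [xlnx (p x)] may be
    infinite. *)
Lemma le_integral_measurable d (Y : measurableType d) (R : realType)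
    (mu : {measure set Y -> \bar R}) (D : set Y) (f g : Y -> \bar R) :
  measurable D -> measurable_fun D f -> measurable_fun D g ->
  (forall x, D x -> (f x <= g x)%E) ->
  (\int[mu]_(x in D) f x <= \int[mu]_(x in D) g x)%E.
Proof.
move=> mD mf mg fg; have fg' : {in D, forall x, (f x <= g x)%E}.
  by move=> x /set_mem; exact: fg.
rewrite integralE [leRHS]integralE leeB//; apply: ge0_le_integral => //.
- exact: measurable_funepos.
- exact: measurable_funepos.
- by move=> x Dx; apply: (funepos_le fg'); exact/mem_set.
- exact: measurable_funeneg.
- exact: measurable_funeneg.
- by move=> x Dx; apply: (funeneg_le fg'); exact/mem_set.
Qed.

Lemma measurable_xlnx (R : realType) : measurable_fun [set: R] (@xlnx R).
Proof. by apply: continuous_measurable_fun; exact: continuous_xlnx. Qed.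

(** * Laws with a density *)

Section density.
Variables (R : realType) (n : nat) (A : R).
Hypothesis A_gt0 : 0 < A.
Local Notation cell K := {ffun 'I_n -> 'I_(2 ^ K).+2}.
Local Notation lam := (lebesgue R n).
Local Notation B := (@box R n A).
Local Notation lamB := (lamB n A_gt0).
Variable nu : probability (Rvec R n) R.
Hypothesis nu_box : nu (~` B) = 0%E.
Variable p : Rvec R n -> R.
Hypothesis mp : measurable_fun [set: Rvec R n] p.
Hypothesis p_ge0 : forall x, 0 <= p x.
Hypothesis pE : forall E, measurable E -> nu E = (\int[lam]_(x in E) (p x)%:E)%E.

Let mB : measurable B := measurable_box A.
Let mpE : measurable_fun [set: Rvec R n] (EFin \o p).
Proof. exact/measurable_EFinP. Qed.

Lemma density_integrable : lam.-integrable [set: Rvec R n] (EFin \o p).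
Proof.
apply/integrableP; split => //.
under eq_integral do rewrite /= ger0_norm//.
by rewrite -pE// probability_setT ltry.
Qed.

Lemma bm_density_integrable g : bmfun g -> lam.-integrable B (fun x => (g x * p x)%:E).
Proof.
move=> [mg [C gC]]; apply: (@le_integrable _ _ _ _ _ _ _ (fun x => C%:E * (EFin \o p) x)%E) => //.
- by apply/measurable_EFinP/measurable_funTS/measurable_funM.
- move=> x _ /=; rewrite lee_fin !normrM ler_wpM2r//.
  by rewrite (le_trans (gC x))// ler_norm.
- by apply: integrableZl => //; apply: integrableS density_integrable.
Qed.

Lemma density_change g : bmfun g ->
  \int[nu]_x g x = \int[lam]_(x in B) (g x * p x).
Proof.
have p1 : \int[lam]_(x in B) (1 * p x) <= 1.
  rewrite /Rintegral; under eq_integral do rewrite mul1r.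
  by rewrite -pE// -lee_fin fineK ?fin_num_measure// probability_le1.
apply: (bmfun_functional_eq (L1 := fun g => \int[nu]_x g x)
  (L2 := fun g => \int[lam]_(x in B) (g x * p x)) (C := 1)).
- by move=> *; exact: bm_RintegralD.
- move=> g' h bg bh; under eq_Rintegral do rewrite mulrDl.
  by rewrite RintegralD//; exact: bm_density_integrable.
- by move=> *; exact: bm_RintegralZl.
- move=> c g' bg; under eq_Rintegral do rewrite -mulrA.
  by rewrite RintegralZl//; exact: bm_density_integrable.
- move=> g' h e bg bh gh; have := bm_Rintegral_dist_le nu bg bh gh.
  by rewrite [X in fine X]probability_setT.
- move=> g' h e bg bh gh.
  rewrite -RintegralB//; [|exact: bm_density_integrable|exact: bm_density_integrable].
  under eq_Rintegral do rewrite -mulrBl.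
  apply: le_trans (le_normr_Rintegral _ _) _ => //.
    by apply: bm_density_integrable; exact: bmfunB.
  apply: (@le_trans _ _ (\int[lam]_(x in B) (e * p x))).
    apply: le_Rintegral => //.
    - have := bm_density_integrable (bmfun_norm (bmfunB bg bh)).
      by under eq_fun do rewrite -{1}(ger0_norm (p_ge0 _)) -normrM.
    - by apply: bm_density_integrable; exact: bmfun_cst.
    - by move=> x _; rewrite normrM [`|p x|]ger0_norm// ler_wpM2r.
  have e0 : 0 <= e := le_trans (normr_ge0 _) (gh point).
  have -> : \int[lam]_(x in B) (e * p x) = e * \int[lam]_(x in B) (1 * p x).
    rewrite -RintegralZl//; last by apply: bm_density_integrable; exact: bmfun_cst.
    by apply: eq_Rintegral => x _; rewrite mul1r.
  by rewrite mul1r ler_piMr.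
- move=> E mE; rewrite Rintegral_indic// /Rintegral.
  have -> : (\int[lam]_(x in B) (\1_E x * p x)%:E = \int[lam]_(x in B `&` E) (p x)%:E)%E.
    rewrite integral_mkcondr; apply: eq_integral => x _.
    by rewrite patchE indicE; case: (x \in E); rewrite ?mul1r ?mul0r.
  rewrite -pE; last exact: measurableI.
  congr fine; apply/eqP; rewrite eq_le; apply/andP; split; last first.
    by apply: le_measure; rewrite ?inE//; exact: measurableI.
  have -> : E = (B `&` E) `|` (~` B `&` E) by rewrite -setIUl setUv setTI.
  apply: le_trans (measureU2 _ _ _) _; [exact: measurableI| |].
    by apply: measurableI => //; exact: measurableC.
  rewrite [X in (_ + X)%E](_ : _ = 0%E) ?adde0.
    by rewrite -setIUl setUv setTI.
  apply: (@subset_measure0 _ _ _ nu _ (~` B)) => //.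
  - by apply: measurableI => //; exact: measurableC.
  - exact: measurableC.
Qed.

(** The complement of the box is null for [nu], so [p] vanishes almost everywhere there, and
    [xlnx 0 = 0]. *)
Lemma integral_xlnx_box :
  (\int[lam]_x (xlnx (p x))%:E = \int[lam]_(x in B) (xlnx (p x))%:E)%E.
Proof.
rewrite [RHS]integral_mkcond; apply: ae_eq_integral => //.
- apply/measurable_EFinP/measurableT_comp => //; exact: measurable_xlnx.
- apply/(measurable_restrictT _ _).1 => //.
  by apply/measurable_EFinP/measurable_funTS/measurableT_comp => //; exact: measurable_xlnx.
have mC : measurable (~` B) by exact: measurableC.
have : ae_eq lam (~` B) (EFin \o p) (cst 0%E).
  apply/(ae_eq_integral_abs lam mC); first exact: measurable_funTS.
  by under eq_integral do rewrite /= ger0_norm//; rewrite -pE.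
apply: filterS => x px _; rewrite patchE; case: ifPn => // xB.
suff [->] : (p x)%:E = 0%:E by rewrite xlnx0.
apply: px => Bx; move/negP: xB; apply; exact/mem_set.
Qed.

Lemma Rintegral_density_box : \int[lam]_(x in B) p x = 1.
Proof.
rewrite -(Rintegral_probability_cst nu 1) density_change; last exact: bmfun_cst.
by apply: eq_Rintegral => x _; rewrite mul1r.
Qed.

Lemma xlnx_young (y f : R) : 0 <= y -> y * f + y - expR f <= xlnx y.
Proof.
rewrite le_eqVlt => /predU1P[<-|y0].
  by rewrite xlnx0 mul0r !add0r oppr_le0 expR_ge0.
have := young_xlnx f y0 (@ltr01 R); rewrite ln1 mulr0 subr0 mul1r; lra.
Qed.

(** Jensen's inequality by supporting lines: take for [f] in [xlnx_young] the logarithm of the cell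
    average of the density, slightly shifted. The left side then integrates to at least
    [- Hdisc A nu K - s0]. *)
Lemma entropy_le_Hdisc K :
  (- (\int[lam]_x (xlnx (p x))%:E) <= (Hdisc A nu K)%:E)%E.
Proof.
rewrite -[leRHS]oppeK leeN2 integral_xlnx_box; apply/lee_addgt0Pr => s0 s00.
pose V := \int[lamB]_x (1 : R).
have V0 : 0 <= V by apply: Rintegral_ge0.
pose s : R := s0 / (V + 1); have s_gt0 : 0 < s by rewrite divr_gt0// ltr_wpDl.
have sV : s * V <= s0.
  by rewrite /s mulrAC ler_pdivrMr ?ltr_wpDl// ler_pM2l// lerDl.
pose h : R := mesh A K ^+ n; have h0 : 0 < h by rewrite exprn_gt0// mesh_gt0.
(* The shift by [s] keeps the test function finite on cells of measure zero. *)
pose F (c : cell K) := ln (nucell A nu c / h + s).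
have ns_gt0 (c : cell K) : 0 < nucell A nu c / h + s.
  by rewrite ltr_wpDl// divr_ge0 ?(ltW h0)// nucell_ge0.
pose f x := F (cellT A K x).
have bf : bmfun f by exact: (bmfun_cellT A_gt0).
have bef : bmfun (fun x => expR (f x)) := bmfun_cellT A_gt0 (fun c => expR (F c)).
have i1 := bm_density_integrable bf.
have i2 : lam.-integrable B (EFin \o p) by apply: integrableS density_integrable.
have i3 := bm_box_integrable A_gt0 bef.
have i12 : lam.-integrable B (EFin \o (fun x => f x * p x + p x)) := integrableD mB i1 i2.
have int_g : \int[lam]_(x in B) (f x * p x + p x - expR (f x)) =
    \int[nu]_x f x + 1 - \int[lamB]_x expR (f x).
  rewrite RintegralB//.
  by rewrite RintegralD// -density_change// Rintegral_density_box lamBE.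
have i4 : lam.-integrable B (EFin \o (fun x => f x * p x + p x - expR (f x))) :=
  integrableB mB i12 i3.
apply: (@le_trans _ _ (\int[lam]_(x in B) (f x * p x + p x - expR (f x))%:E + s0%:E)%E); last first.
  apply: leeD => //; apply: le_integral_measurable => //.
  - by have /integrableP[] := i4.
  - by apply/measurable_EFinP/measurable_funTS/measurableT_comp => //; exact: measurable_xlnx.
  - by move=> x _; rewrite lee_fin mulrC xlnx_young.
rewrite -[X in (X + _)%E]fineK; last exact: (integrable_fin_num mB i4).
rewrite -/(Rintegral lam B _) int_g -EFinD lee_fin (Hdisc_sum A_gt0).
rewrite (Rintegral_nucell A_gt0 nu F) (Rintegral_vol A_gt0 (fun c => expR (F c))).
have e1 : \sum_(c : cell K) (xlnx (nucell A nu c) - nucell A nu c * ln h) <= \sum_(c : cell K) nucell A nu c * F c.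
  apply: ler_sum => c _; have := nucell_ge0 A nu c.
  rewrite le_eqVlt => /predU1P[<-|c0]; first by rewrite xlnx0 !mul0r subr0.
  rewrite /xlnx -mulrBr ler_wpM2l ?(ltW c0)// -ln_div ?posrE//.
  by rewrite ler_ln ?posrE ?divr_gt0// lerDl ltW.
have e2 : \sum_(c : cell K) vol A_gt0 c * expR (F c) <= 1 + s0.
  apply: le_trans (lerD (lexx 1) sV).
  have -> : V = \sum_(c : cell K) vol A_gt0 c.
    rewrite /V (Rintegral_vol A_gt0 (fun _ : cell K => 1)).
    by apply: eq_bigr => c _; rewrite mulr1.
  rewrite -(sum_nucell A_gt0 nu K) mulr_sumr -big_split/=.
  apply: ler_sum => c _; rewrite lnK ?posrE// mulrDr [s * _]mulrC lerD2r.
  rewrite mulrCA ler_piMr ?nucell_ge0// ler_pdivrMr// mul1r; exact: vol_le.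
lra.
Qed.

(** Keeps the density away from 0 and infinity, so that [ln (trunc M (p x))] is a bounded test
    function. *)
Definition trunc (M : nat) (y : R) : R :=
  Num.max M.+1%:R^-1 (Num.min M.+1%:R y).

Lemma trunc_bounds M y : M.+1%:R^-1 <= trunc M y <= M.+1%:R.
Proof.
rewrite /trunc le_max lexx/= ge_max ge_min lexx andbT.
by rewrite (@le_trans _ _ 1)// ?invf_le1 ?ler1n ?ltr0n.
Qed.

Lemma trunc_gt0 M y : 0 < trunc M y.
Proof. by have /andP[h _] := trunc_bounds M y; rewrite (lt_le_trans _ h)// invr_gt0. Qed.

Lemma ln_trunc_le M y : `|ln (trunc M y)| <= ln M.+1%:R.
Proof.
have /andP[h1 h2] := trunc_bounds M y; rewrite ler_norml.
rewrite -lnV ?posrE ?ltr0n// !ler_ln ?posrE ?trunc_gt0 ?invr_gt0 ?ltr0n//.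
by rewrite h1.
Qed.

(** Supplies the nonnegativity for Fatou's lemma. The truncation [u] projects [y] onto an interval
    containing 1, so [y - u] and [ln u] never have opposite signs; what remains is
    [u ln u - u + 1 >= 0]. *)
Lemma trunc_young M y : 0 <= y -> 0 <= y * ln (trunc M y) - trunc M y + 1.
Proof.
move=> y0; set u := trunc M y; have u0 : 0 < u := trunc_gt0 M y.
have h1 : u - 1 <= u * ln u.
  have := ler_wpM2l (ltW u0) (ln_ge_1subV u0).
  by rewrite mulrBr mulr1 divff ?gt_eqF.
suff h2 : 0 <= (y - u) * ln u by move: h2; rewrite mulrBl; lra.
have a1 : 1 <= M.+1%:R :> R by rewrite ler1n.
rewrite /u /trunc; have [ay|ya] := leP M.+1%:R y.
  by rewrite (max_idPr _) ?mulr_ge0 ?subr_ge0 ?ln_ge0// (le_trans _ a1)// invf_le1.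
have [ay|{}ya] := leP M.+1%:R^-1 y; first by rewrite subrr mul0r.
by rewrite mulr_le0// ?subr_le0 ?(ltW ya)// ln_le0// invf_le1.
Qed.

Lemma trunc_cvg y : 0 <= y ->
  (y * ln (trunc M y) - trunc M y + 1) @[M --> \oo] --> xlnx y - y + 1.
Proof.
rewrite le_eqVlt => /predU1P[<-|y0].
  have -> : (fun M => 0 * ln (trunc M 0) - trunc M 0 + 1) = (fun M => - harmonic M + 1).
    apply/funext => M; rewrite mul0r sub0r /trunc /harmonic.
    by rewrite (min_idPr _) ?(max_idPl _) ?invr_ge0.
  rewrite xlnx0; apply: cvgD; last exact: cvg_cst.
  by rewrite subr0 -oppr0; apply: cvgN; exact: cvg_harmonic.
apply: cvg_near_cst; near=> M.
have -> : trunc M y = y; last by [].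
have truncS (z : R) (k : nat) : (Num.truncn z <= k)%N -> z <= k.+1%:R.
  by move=> zk; apply: le_trans (ltW (truncnS_gt z)) _; rewrite ler_nat.
have h1 : y <= M.+1%:R by apply: truncS; near: M; exists (Num.truncn y).
have h2 : y^-1 <= M.+1%:R by apply: truncS; near: M; exists (Num.truncn y^-1).
rewrite /trunc (min_idPr h1) (max_idPr _)// -[leRHS]invrK lef_pV2 ?posrE ?invr_gt0//.
Unshelve. all: by end_near. Qed.

(** The optimal test function would be [ln p]; [psi M] is its truncation. The variational value of
    [psi M] differs by the constant [V - 1] from the integral of the nonnegative [G M], so Fatou's
    lemma yields an [M] with value above [- c]. *)
Lemma Hdisc_le_density (c : R) :
  (- (\int[lam]_x (xlnx (p x))%:E) < c%:E)%E ->
  exists K0, forall K, (K0 <= K)%N -> Hdisc A nu K <= c.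
Proof.
rewrite integral_xlnx_box => Hc.
pose psi M x := ln (trunc M (p x)).
pose V := \int[lamB]_x (1 : R).
have m_trunc M : measurable_fun [set: Rvec R n] (fun x => trunc M (p x)).
  by apply: measurable_maxr => //; exact: measurable_minr.
have b_trunc M : bmfun (fun x => trunc M (p x)).
  split=> //; exists M.+1%:R => x; rewrite ger0_norm ?(ltW (trunc_gt0 _ _))//.
  by have /andP[] := trunc_bounds M (p x).
have b_psi M : bmfun (psi M).
  split; first by apply: measurableT_comp => //; exact: measurable_ln.
  by exists (ln M.+1%:R) => x; exact: ln_trunc_le.
pose G M x := p x * psi M x - trunc M (p x) + 1.
pose G0 x := xlnx (p x) - p x + 1.
have G_ge0 M x : 0 <= G M x by exact: trunc_young.
have mG M : measurable_fun [set: Rvec R n] (G M).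
  apply: measurable_funD => //; apply: measurable_funB => //.
  by apply: measurable_funM => //; have [] := b_psi M.
have mx : measurable_fun [set: Rvec R n] (fun x => xlnx (p x)).
  by apply: measurableT_comp => //; exact: measurable_xlnx.
have mG0 : measurable_fun [set: Rvec R n] G0.
  by apply: measurable_funD => //; exact: measurable_funB.
have GG0 x : (fun M => (G M x)%:E) @ \oo --> (G0 x)%:E.
  by apply: cvg_EFin; [near=> M|exact: trunc_cvg].
have G0_ge0 x : 0 <= G0 x.
  have := cvg_lim (@Rhausdorff R) (trunc_cvg (p_ge0 x)); rewrite -/(G0 x) => <-.
  apply: limr_ge; first exact: cvgP (trunc_cvg (p_ge0 x)).
  by near=> M; exact: G_ge0.
have i1 : lam.-integrable B (EFin \o (fun=> 1)) :=
  bm_box_integrable A_gt0 (bmfun_cst _ (1 : R)).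
have i2 : lam.-integrable B (EFin \o p) by apply: integrableS density_integrable.
have intG M : (\int[lam]_(x in B) (G M x)%:E =
    (\int[nu]_x psi M x - \int[lamB]_x expR (psi M x) + V)%:E)%E.
  have j1 := bm_density_integrable (b_psi M).
  have j2 := bm_box_integrable A_gt0 (b_trunc M).
  have j12 : lam.-integrable B (EFin \o (fun x => psi M x * p x - trunc M (p x))) :=
    integrableB mB j1 j2.
  have j3 : lam.-integrable B (EFin \o (fun x => psi M x * p x - trunc M (p x) + 1)) :=
    integrableD mB j12 i1.
  have -> : (\int[lam]_(x in B) (G M x)%:E =
      \int[lam]_(x in B) (psi M x * p x - trunc M (p x) + 1)%:E)%E.
    by apply: eq_integral => x _; rewrite /G mulrC.
  rewrite -[LHS]fineK; last exact: (integrable_fin_num mB j3).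
  congr (_%:E); rewrite -/(Rintegral lam B _) RintegralD// RintegralB//.
  rewrite -density_change// /V (lamBE A_gt0 (bmfun_cst _ 1)).
  congr (_ - _ + _); rewrite lamBE//; last first.
    by under eq_fun do rewrite /psi lnK ?posrE ?trunc_gt0//.
  by apply: eq_Rintegral => x _; rewrite /psi lnK ?posrE ?trunc_gt0.
have intG0 : (\int[lam]_(x in B) (xlnx (p x))%:E <=
    \int[lam]_(x in B) (G0 x)%:E + (1 - V)%:E)%E.
  have [->|Gfin] := eqVneq (\int[lam]_(x in B) (G0 x)%:E)%E +oo%E.
    by rewrite addye// leey.
  have j0 : lam.-integrable B (EFin \o G0).
    apply/integrableP; split; first exact/measurable_EFinP/measurable_funTS.
    under eq_integral do rewrite /= ger0_norm//.
    by rewrite ltey.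
  have j1 : lam.-integrable B (EFin \o (fun x => p x - 1)) := integrableB mB i2 i1.
  have -> : (\int[lam]_(x in B) (xlnx (p x))%:E =
      \int[lam]_(x in B) ((G0 x)%:E + (p x - 1)%:E))%E.
    by apply: eq_integral => x _; rewrite -EFinD /G0; congr EFin; ring.
  rewrite integralD//; apply: leeD2l.
  rewrite -[leLHS]fineK; last exact: (integrable_fin_num mB j1).
  rewrite lee_fin -/(Rintegral lam B _) RintegralB// Rintegral_density_box.
  by rewrite /V (lamBE A_gt0 (bmfun_cst _ 1)).
have [M HM] : exists M, - c < \int[nu]_x psi M x - \int[lamB]_x expR (psi M x) + 1.
  apply: contrapT => /forallNP H.
  have : (\int[lam]_(x in B) (G0 x)%:E <= (- c - 1 + V)%:E)%E.
    have -> : (\int[lam]_(x in B) (G0 x)%:E =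
        \int[lam]_(x in B) limn_einf (fun M => (G M x)%:E))%E.
      by apply: eq_integral => x _; have [-> _] := cvg_limn_einf_sup (GG0 x).
    apply: (@le_trans _ _ (limn_einf (fun M => \int[lam]_(x in B) (G M x)%:E)%E)).
      apply: fatou => //.
      - by move=> M; exact/measurable_EFinP/measurable_funTS.
      - by move=> M x _; rewrite lee_fin.
    apply: le_trans (limn_einf_sup _) _; apply: limn_esup_le_near.
    near=> M; rewrite intG lee_fin; have /negP := H M; rewrite -leNgt; lra.
  apply/negP; rewrite -ltNge.
  have : ((- c)%:E < \int[lam]_(x in B) (G0 x)%:E + (1 - V)%:E)%E.
    by apply: lt_le_trans intG0; rewrite EFinN lteNl.
  by rewrite -lteBlDr// -EFinB (_ : - c - (1 - V) = - c - 1 + V)//; ring.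
(* The tolerance [e] is the whole margin by which the value at [psi M] exceeds [- c]. *)
have [K0 HK] := dv_Hdisc A_gt0 nu_box (b_psi M) (e := \int[nu]_x psi M x - \int[lamB]_x expR (psi M x) + 1 + c) ltac:(lra).
exists K0 => K /HK; lra.
Unshelve. all: by end_near. Qed.
End density.

(** * Laws without a density *)

Section no_density.
Variables (R : realType) (n : nat) (A : R).
Hypothesis A_gt0 : 0 < A.
Local Notation lam := (lebesgue R n).
Local Notation B := (@box R n A).
Local Notation lamB := (lamB n A_gt0).
Variable nu : probability (Rvec R n) R.
Hypothesis nu_box : nu (~` B) = 0%E.

(** Some Lebesgue-null set [E] has positive mass under [nu]. For the test function [k * \1_E] the
    exponential integral does not see [E], while the linear term grows with [k]; the chosen [k]
    makes the variational bound reach [|c| + 1]. *)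
Lemma Hdisc_le_no_density (c : R) :
  ~ (exists p : Rvec R n -> R, [/\ measurable_fun [set: Rvec R n] p, forall x, 0 <= p x &
     forall E : set (Rvec R n), measurable E -> nu E = (\int[lam]_(x in E) (p x)%:E)%E]) ->
  exists K0, forall K, (K0 <= K)%N -> Hdisc A nu K <= c.
Proof.
move=> np.
have [E [mE lE nE]] : exists E : set (Rvec R n), [/\ measurable E, lam E = 0%E & nu E != 0%E].
  apply: contrapT => H; apply: np.
  have nulam : nu `<< lam.
    apply/null_content_dominatesP => S mS lS; apply/eqP/negPn/negP => nS.
    by apply: H; exists S.
  pose f := Radon_Nikodym_SigmaFinite.f nu lam.
  have ff : EFin \o (fine \o f) = f.
    apply/funext => x /=; rewrite fineK//.
    exact: Radon_Nikodym_SigmaFinite.f_fin_num.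
  exists (fine \o f); split.
  - apply/measurable_EFinP; rewrite ff.
    by have /integrableP[] := Radon_Nikodym_SigmaFinite.f_integrable nulam.
  - by move=> x; apply: fine_ge0; exact: Radon_Nikodym_SigmaFinite.f_ge0.
  - move=> E mE; rewrite (Radon_Nikodym_SigmaFinite.f_integral nulam mE).
    apply: eq_integral => x _; rewrite /= fineK//.
    exact: Radon_Nikodym_SigmaFinite.f_fin_num.
have lBE : lamB E = 0%E.
  apply/eqP; rewrite -measure_le0 -lE; apply: measureIl => //; exact: measurable_box.
have nE0 : 0 < fine (nu E).
  by rewrite fine_gt0// lt0e nE measure_ge0/= ltey_eq fin_num_measure.
pose V := \int[lamB]_x (1 : R).
pose k : R := (`|c| + V + 1) / fine (nu E).
pose psi (x : Rvec R n) : R := k * \1_E x.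
have bpsi : bmfun psi by apply: bmfunZ; exact: bmfun_indic.
have i1 : \int[nu]_x psi x = `|c| + V + 1.
  rewrite bm_RintegralZl; last exact: bmfun_indic.
  by rewrite Rintegral_indic// /k divfK// gt_eqF.
have i2 : \int[lamB]_x expR (psi x) = V.
  have -> : (fun x => expR (psi x)) = (fun x => 1 + (expR k - 1) * \1_E x).
    apply/funext => x; rewrite /psi indicE; case: (x \in E).
      by rewrite !mulr1; ring.
    by rewrite !mulr0 expR0 addr0.
  rewrite bm_RintegralD; [|exact: bmfun_cst|by apply: bmfunZ; exact: bmfun_indic].
  rewrite bm_RintegralZl; last exact: bmfun_indic.
  by rewrite Rintegral_indic// lBE mulr0 addr0.
have [K0 HK] := dv_Hdisc A_gt0 nu_box bpsi (@ltr01 R).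
exists K0 => K /HK; rewrite i1 i2.
have : - c <= `|c| by rewrite -normrN ler_norm.
lra.
Qed.

End no_density.

(** * Discretized entropies of random variables *)

Section joint_entropy.
Context d (T : measurableType d) (R : realType) (P : probability T R)
  (n : nat) (X : 'I_n -> {RV P >-> R}).

Lemma measurable_joint : measurable_fun [set: T] (joint X).
Proof.
apply/measurable_fun_tnthP => i; rewrite (_ : _ \o _ = (X i : T -> R)); last first.
  by apply/funext => t /=; rewrite tnth_mktuple.
by move=> mD Y mY; exact: (@measurable_funPT _ _ T R (X i) mD Y mY).
Qed.

HB.instance Definition _ := isMeasurableFun.Build _ _ _ _ (joint X) measurable_joint.

Definition joint_law : probability (Rvec R n) R := distribution P (joint X).

Definition Hcell (A : R) (K : nat) : R :=
  - \sum_(c : {ffun 'I_n -> 'I_(2 ^ K).+2}) xlnx (cell_law X A c) + n%:R * ln (mesh A K).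

Variables (r0 A : R).
Hypotheses (A_gt0 : 0 < A) (X_le : forall i t, `|X i t| <= r0) (rA : r0 < A).

Lemma cellT_joint K t : cellT A K (joint X t) = cellf A K (Xv X t).
Proof. by congr cellf; apply/funext => i; rewrite tnth_mktuple. Qed.

Lemma nucell_joint_law K (c : {ffun 'I_n -> 'I_(2 ^ K).+2}) :
  nucell A joint_law c = cell_law X A c.
Proof.
rewrite cell_lawE// /nucell; congr (fine (P _)).
by apply/seteqP; split => t /=; rewrite cellT_joint.
Qed.

Lemma Hcell_disc K : Hcell A K = Hdisc A joint_law K.
Proof. by congr (- _ + _); apply: eq_bigr => c _; rewrite nucell_joint_law. Qed.

Lemma joint_law_box : joint_law (~` @box R n A) = 0%E.
Proof.
rewrite /joint_law /= /distribution /pushforward (_ : _ @^-1` _ = set0) ?measure0//.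
apply/seteqP; split => // t /=; apply => i; rewrite tnth_mktuple.
have := X_le i t; have rA' := rA; rewrite ler_norml => /andP[h1 h2].
by apply/andP; split; lra.
Qed.

Lemma entropy_le_Hcell K : (entropy X <= (Hcell A K)%:E)%E.
Proof.
rewrite /entropy; case: pselect => [h|_]; last exact: leNye.
rewrite Hcell_disc; case: (cid h) => p /= [mp p0 pE].
exact: (entropy_le_Hdisc A_gt0 joint_law_box mp p0 pE).
Qed.

Lemma Hcell_le_entropy (c : R) : (entropy X < c%:E)%E ->
  exists K0, forall K, (K0 <= K)%N -> Hcell A K <= c.
Proof.
rewrite /entropy; case: pselect => [h|nh] Hc.
  move: Hc; case: (cid h) => p /= [mp p0 pE] Hc.
  have [K0 HK] := Hdisc_le_density A_gt0 joint_law_box mp p0 pE Hc.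
  by exists K0 => K /HK; rewrite Hcell_disc.
have [K0 HK] := Hdisc_le_no_density A_gt0 joint_law_box c nh.
by exists K0 => K /HK; rewrite Hcell_disc.
Qed.

End joint_entropy.

Section entropy_information.
Context d (T : measurableType d) (R : realType) (P : probability T R)
  (n : nat) (X : 'I_n -> {RV P >-> R}).
Variables (A : R).
Hypotheses (A_gt0 : 0 < A).

Lemma rmarginal_cell_law K i (c : {ffun 'I_1 -> 'I_(2 ^ K).+2}) :
  cell_law (fun _ : 'I_1 => X i) A c = rmarginal (@cell_law _ _ _ _ _ X A K) i (c ord0).
Proof.
rewrite /rmarginal big_mkcond/=.
transitivity (\sum_(a : {ffun 'I_n -> 'I_(2 ^ K).+2}) cell_law X A a * (a i == c ord0)%:R).
  rewrite -(Rintegral_cell X A_gt0 (fun a : {ffun 'I_n -> 'I_(2 ^ K).+2} => (a i == c ord0)%:R)).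
  apply: eq_Rintegral => t _; congr (_%:R); congr nat_of_bool; rewrite ffunE.
  apply/eqP/eqP => [<-|h]; first by rewrite ffunE.
  by apply/ffunP => j; rewrite ffunE ord1.
by apply: eq_bigr => a _; case: ifP; rewrite ?mulr1 ?mulr0.
Qed.

(** The mesh terms cancel: one [ln (mesh A K)] for each marginal against [n] of them for the joint
    law. *)
Lemma info_Hcell K : info (@cell_law _ _ _ _ _ X A K) =
  \sum_i Hcell (fun _ : 'I_1 => X i) A K - Hcell X A K.
Proof.
have E i : Hcell (fun _ : 'I_1 => X i) A K =
    - \sum_k xlnx (rmarginal (@cell_law _ _ _ _ _ X A K) i k) + ln (mesh A K).
  rewrite /Hcell mul1r; congr (- _ + _).
  rewrite (reindex (fun k : 'I_(2 ^ K).+2 => [ffun _ : 'I_1 => k])) /=; last first.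
    exists (fun c : {ffun 'I_1 -> 'I_(2 ^ K).+2} => c ord0).
      by move=> k _; rewrite ffunE.
    move=> c _. by apply/ffunP => j; rewrite ffunE (ord1 j).
  by apply: eq_bigr => k _; rewrite rmarginal_cell_law ffunE.
under eq_bigr do rewrite E.
rewrite big_split/= sumrN sumr_const card_ord -[_ *+ n]mulr_natl /Hcell /info; ring.
Qed.

End entropy_information.

(** The upper bound is phrased through real [c > L] because [L] may be [-oo], where [L + e] would
    say nothing; for [L = +oo] it is void. *)
Lemma cvg_ereal_of_bounds (R : realType) (I : Type) (F : set_system I) {FF : ProperFilter F}
    (f : I -> \bar R) (L : \bar R) :
  (\forall x \near F, (L <= f x)%E) ->
  (forall c : R, (L < c%:E)%E -> \forall x \near F, (f x <= c%:E)%E) ->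
  f @ F --> L.
Proof.
case: L => [l| |] lo hi.
- have fin : \forall x \near F, f x \is a fin_num.
    near=> x; rewrite fin_numElt.
    have -> : (-oo < f x)%E by apply: (@lt_le_trans _ _ l%:E); rewrite ?ltNyr//; near: x.
    apply: (@le_lt_trans _ _ (l + 1)%:E); rewrite ?ltry//; near: x.
    by apply: hi; rewrite lte_fin ltrDl.
  apply/fine_cvgP; split => //; apply/cvgrPdist_le => e e0; near=> x.
  have fx : f x \is a fin_num by near: x.
  have h1 : (l%:E <= f x)%E by near: x.
  have h2 : (f x <= (l + e)%:E)%E.
    by near: x; apply: hi; rewrite lte_fin ltrDl.
  rewrite -(fineK fx) lee_fin in h1; rewrite -(fineK fx) lee_fin in h2.
  rewrite /= distrC ger0_norm ?subr_ge0//; lra.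
- apply: cvg_near_cst; near=> x; apply/eqP; rewrite eq_le leey/=; near: x; exact: lo.
- by apply/cvgeNyPle => c; apply: hi; rewrite ltNyr.
Unshelve. all: by end_near. Qed.

(** Since the lower limit is at most the upper limit, a lower bound on the former and an upper bound
    on the latter determine both. *)
Lemma I_limits (R : realType) (n : nat)
    (D : forall N : nat, nat -> R -> {set {ffun 'I_n -> 'S_N}}) (L : \bar R) :
  (forall m delta, 0 < delta -> (L <= limn_einf (log_rate D m delta))%E) ->
  (forall c : R, (L < c%:E)%E -> exists m0 delta0, 0 < delta0 /\
     forall m delta, (m0 <= m)%N -> 0 < delta <= delta0 ->
     (limn_esup (log_rate D m delta) <= c%:E)%E) ->
  I_limsup D = (- L)%E /\ I_liminf D = (- L)%E.
Proof.
move=> lo hi; pose F := filter_prod (\oo : set_system nat) (0 : R)^'+.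
have pos : \forall md \near F, 0 < md.2.
  exists (setT, [set x : R | 0 < x]) => [|[m x] []//].
  by split; [exact: filterT|exact: nbhs_right_gt].
have small (c : R) : (L < c%:E)%E ->
    \forall md \near F, (limn_esup (log_rate D md.1 md.2) <= c%:E)%E.
  move=> /hi[m0 [delta0 [d0 H]]].
  exists ([set m | (m0 <= m)%N], [set x : R | 0 < x <= delta0]) => [|[m x] [/= mm xx]].
    split; first by exists m0.
    near=> x; apply/andP; split; first by near: x; exact: nbhs_right_gt.
    by near: x; exact: nbhs_right_le.
  exact: H.
split; congr (- _)%E; apply/cvg_lim => //; apply: cvg_ereal_of_bounds => //.
- near=> md; apply: le_trans (limn_einf_sup _); apply: lo; near: md; exact: pos.
- near=> md; apply: lo; near: md; exact: pos.
- move=> c Lc; have := small c Lc; apply: filterS => md; apply: le_trans.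
  exact: limn_einf_sup.
Unshelve. all: by end_near. Qed.

(** * The entropy identity *)

Section bounded_case.
Context d (T : measurableType d) (R : realType) (P : probability T R)
  (n : nat) (X : 'I_n -> {RV P >-> R}) (r0 : R).
Hypothesis r0_ge0 : 0 <= r0.
Hypothesis X_le : forall i t, `|X i t| <= r0.

Let A := r0 + 1.
Let A_gt0 : 0 < A. Proof. by rewrite ltr_wpDl. Qed.
Let A_ge1 : 1 <= A. Proof. by rewrite lerDr. Qed.
Let rA : r0 < A. Proof. by rewrite ltrDl. Qed.
Local Notation X1 i := (fun _ : 'I_1 => X i).

Lemma entropy_lt_pinfty : (entropy X < +oo)%E.
Proof. by apply: le_lt_trans (ltry _); exact: (entropy_le_Hcell A_gt0 X_le rA 0). Qed.

Lemma entropy1_lt_pinfty i : (entropy1 (X i) < +oo)%E.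
Proof.
apply: le_lt_trans (ltry _).
exact: (entropy_le_Hcell (X := X1 i) A_gt0 (fun _ => X_le i) rA 0).
Qed.

Lemma entropy1_diffuse i (t : R) : entropy1 (X i) != -oo%E -> P [set w | X i w = t] = 0%E.
Proof.
rewrite /entropy1 /entropy; case: pselect => [[p [mp p0 pE]] _|]; last by rewrite eqxx.
pose S : set (Rvec R 1) := [set x | forall i : 'I_1, [set t] (tnth x i)].
have mS : measurable S.
  have -> : S = \bigcap_(i in [set: 'I_1]) (fun x : Rvec R 1 => tnth x i) @^-1` [set t].
    by apply/seteqP; split => [x Sx i' _|x Sx i']; exact: Sx.
  apply: fin_bigcap_measurable => [|i' _]; first exact: finite_finset.
  by rewrite -[X in measurable X]setTI; exact: measurable_tnth.
have -> : [set w | X i w = t] = joint (X1 i) @^-1` S.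
  apply/seteqP; split => w /=; first by move=> Xt i'; rewrite tnth_mktuple.
  by move=> /(_ ord0); rewrite tnth_mktuple.
rewrite pE//; apply: null_set_integral => //.
- by apply/measurable_EFinP/measurable_funTS.
- apply: etrans (lebesgue_box (A := fun _ : 'I_1 => [set t]) _) _ => //.
  by rewrite big_ord_recl lebesgue_measure_set1 mul0e.
Qed.

(** Nonnegative mutual information gives [H <= H_K <= sum_j H_K(X_j)] at each level [K]. One summand
    tends to [-oo] and the others stay bounded above. *)
Lemma entropy_degenerate i : entropy1 (X i) = -oo%E -> entropy X = -oo%E.
Proof.
move=> Hi.
have /choice[b Hb] : forall j, exists x : R, (entropy1 (X j) < x%:E)%E.
  move=> j; have := entropy1_lt_pinfty j; case: (entropy1 (X j)) => [x _| |_]//.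
    by exists (x + 1); rewrite lte_fin ltrDl.
  by exists 0; rewrite ltNyr.
have H (c : R) : (entropy X <= c%:E)%E.
  (* Targets with sum [c]: the coordinate of entropy [-oo] accepts any bound and compensates the
     others. *)
  pose b' j := if j == i then c - \sum_(k | k != i) b k else b j.
  have sb : \sum_j b' j = c.
    rewrite (bigD1 i)//= /b' eqxx (eq_bigr b) ?subrK// => j /negPf -> //.
  have Hb' j : (entropy1 (X j) < (b' j)%:E)%E.
    by rewrite /b'; case: eqP => [->|_]; rewrite ?Hi ?ltNyr.
  have [K0 HK0] := choice (fun j =>
    Hcell_le_entropy (X := X1 j) A_gt0 (fun _ => X_le j) rA (Hb' j)).
  pose K := (\max_j K0 j)%N.
  apply: le_trans (entropy_le_Hcell A_gt0 X_le rA K) _; rewrite lee_fin.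
  have := info_ge0 (cell_law_ge0 X A_gt0 (K := K)) (sum_cell_law X A_gt0 K).
  rewrite info_Hcell// subr_ge0 => /le_trans; apply; rewrite -sb.
  by apply: ler_sum => j _; apply: HK0; exact: leq_bigmax.
have := entropy_lt_pinfty; case: (entropy X) H => [x H _| |]//.
by have := H (x - 1); rewrite lee_fin leNgt ltrBlDr ltrDl ltr01.
Qed.

Variable D : forall N : nat, nat -> R -> {set {ffun 'I_n -> 'S_N}}.
Hypothesis D_sub : forall N m delta, D N m delta \subset Delta_sym X +oo%E N m delta.
Hypothesis D_lower : (forall i t, P [set w | X i w = t] = 0%E) ->
  forall K m delta, mesh A K <= 1 ->
  0 < delta -> 2 * (m%:R * A ^+ m * mesh A K) < delta ->
  ((- info (@cell_law _ _ _ _ _ X A K))%:E <= limn_einf (log_rate D m delta))%E.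

(** Since [- info = H_K - sum_i H_K(X_i)], the lower bound on the rate pairs [H <= H_K] for the
    joint law with upper estimates of the marginal [H_K(X_i)]; the upper bound exchanges the
    roles. *)
Theorem entropy_identity :
  (entropy X = - I_limsup D + \sum_(i < n) entropy1 (X i) /\
   entropy X = - I_liminf D + \sum_(i < n) entropy1 (X i))%E.
Proof.
have [/existsP[i /eqP Hi]|] := boolP [exists i, entropy1 (X i) == -oo%E].
  (* [-oo + +oo = -oo], so the right-hand side is [-oo] whatever the rate is. *)
  rewrite (entropy_degenerate Hi) (bigD1 i)//= Hi addNye !addeNy.
  by split.
rewrite negb_exists => /forallP fin.
have fin1 i : entropy1 (X i) \is a fin_num.
  by rewrite fin_numE fin/= lt_eqF// entropy1_lt_pinfty.
have diffuse i t := entropy1_diffuse t (fin i).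
pose S := \sum_i fine (entropy1 (X i)).
have SE : (\sum_(i < n) entropy1 (X i))%E = S%:E.
  by rewrite /S -sumEFin; apply: eq_bigr => i _; rewrite fineK.
have S_le K : S <= \sum_i Hcell (X1 i) A K.
  apply: ler_sum => i _; rewrite -lee_fin fineK//.
  exact: (entropy_le_Hcell (X := X1 i) A_gt0 (fun _ => X_le i) rA K).
have S_near (e : R) : 0 < e -> exists K0, forall K, (K0 <= K)%N ->
    \sum_i Hcell (X1 i) A K <= S + e.
  move=> e0; pose e' : R := e / (n%:R + 1).
  have n1 : 0 < n%:R + 1 :> R by rewrite ltr_wpDl.
  have e'0 : 0 < e' by rewrite divr_gt0.
  have Hc i : (entropy1 (X i) < (fine (entropy1 (X i)) + e')%:E)%E.
    by rewrite -{1}(fineK (fin1 i)) lte_fin ltrDl.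
  have [K0 HK0] := choice (fun j =>
    Hcell_le_entropy (X := X1 j) A_gt0 (fun _ => X_le j) rA (Hc j)).
  exists (\max_j K0 j)%N => K HK.
  apply: (@le_trans _ _ (\sum_i (fine (entropy1 (X i)) + e'))).
    by apply: ler_sum => i _; apply: HK0; apply: leq_trans HK; exact: leq_bigmax.
  rewrite big_split/= lerD2l sumr_const card_ord -[_ *+ n]mulr_natl /e' mulrA.
  by rewrite ler_pdivrMr// mulrC ler_pM2l// lerDl.
pose L := (entropy X - S%:E)%E.
have HL : (- (- L) + S%:E = entropy X)%E by rewrite oppeK subeK.
suff [-> ->] : I_limsup D = (- L)%E /\ I_liminf D = (- L)%E by rewrite SE HL.
apply: I_limits.
  move=> m delta delta0; apply/lee_addgt0Pr => e e0.
  have [K1 HK1] := S_near e e0.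
  pose q : R := 2 * (m%:R * A ^+ m) + 1.
  have q0 : 0 < q by rewrite ltr_wpDl// mulr_ge0// mulr_ge0// exprn_ge0// ltW.
  have [K2 HK2] := mesh_small A_gt0 (divr_gt0 delta0 q0).
  have [K3 HK3] := mesh_small A_gt0 (@ltr01 R).
  pose K := maxn K1 (maxn K2 K3).
  have hK1 : (K1 <= K)%N by rewrite leq_maxl.
  have hK2 : (K2 <= K)%N by rewrite leq_max leq_maxl orbT.
  have hK3 : (K3 <= K)%N by rewrite leq_max leq_maxr orbT.
  have small : 2 * (m%:R * A ^+ m * mesh A K) < delta.
    have := HK2 K hK2; rewrite ltr_pdivlMr// /q mulrDr mulr1 => h.
    have := mesh_gt0 A_gt0 K; rewrite mulrA mulrC; lra.
  have := D_lower diffuse (ltW (HK3 K hK3)) delta0 small.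
  move=> lo; apply: (@le_trans _ _ ((- info (@cell_law _ _ _ _ _ X A K))%:E + e%:E)%E); last exact: leeD.
  rewrite info_Hcell// opprB /L -EFinD leeBlDr//.
  apply: le_trans (entropy_le_Hcell A_gt0 X_le rA K) _; rewrite -EFinD lee_fin.
  have := HK1 K hK1; lra.
move=> c Lc.
(* The gap [c + S - b] becomes the tolerance [eta] of [rate_upper], so that [Hcell X A K <= b] gives
   the rate bound [b - S + eta = c]. *)
have [b [entb bc]] : exists b : R, (entropy X < b%:E)%E /\ b < c + S.
  move: Lc; rewrite /L; case: (entropy X) (entropy_lt_pinfty) => [x _| |_]//=.
    rewrite -EFinB lte_fin => xc; exists ((x + (c + S)) / 2).
    by rewrite lte_fin; split; lra.
  by move=> _; exists (c + S - 1); rewrite ltNyr; split => //; lra.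
have [K HK] := Hcell_le_entropy A_gt0 X_le rA entb.
have eta0 : 0 < c + S - b by rewrite subr_gt0.
have [m0 [delta0 d0 HU]] := rate_upper X_le A_ge1 rA diffuse K eta0.
exists m0, delta0; split => // m delta mm /andP[_ dd].
apply: le_trans (HU m delta mm dd D (fun N => D_sub N m delta)) _.
rewrite lee_fin info_Hcell//; have := S_le K; have := HK K (leqnn K); lra.
Qed.

End bounded_case.

(** * Invariance under almost sure modification *)

Section almost_everywhere.
Context d (T : measurableType d) (R : realType) (P : probability T R).

Lemma fine_expectation_ae (f g : T -> R) : measurable_fun setT f ->
  measurable_fun setT g -> (\forall t \ae P, f t = g t) ->
  fine 'E_P[f] = fine 'E_P[g].
Proof.
move=> mf mg fg; rewrite !fine_expectation /Rintegral; congr fine.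
apply: ae_eq_integral => //; [exact/measurable_EFinP|exact/measurable_EFinP|].
by apply: filterS fg => t fgt _; rewrite fgt.
Qed.

Variables (n : nat) (X Y : 'I_n -> {RV P >-> R}).
Hypothesis XY : forall i, \forall t \ae P, X i t = Y i t.

Let XY_all : \forall t \ae P, forall i, X i t = Y i t.
Proof. exact: filter_forall. Qed.

Lemma expectation_prod_ae k (w : 'I_k -> 'I_n) :
  fine 'E_P[fun t => \prod_(l < k) X (w l) t] = fine 'E_P[fun t => \prod_(l < k) Y (w l) t].
Proof.
apply: fine_expectation_ae.
- by apply: measurable_prod => l _; exact: measurable_funPT.
- by apply: measurable_prod => l _; exact: measurable_funPT.
- by apply: filterS XY_all => t XYt; apply: eq_bigr => l _.
Qed.

Lemma microstates_ae r N m delta :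
  @microstates _ _ _ _ n X r N m delta = microstates Y r m delta.
Proof.
apply/seteqP; split => x [h1 h2]; split => // k km w.
  by rewrite -expectation_prod_ae; exact: h2.
by rewrite expectation_prod_ae; exact: h2.
Qed.

Lemma Delta_sym_ae r : Delta_sym X r = Delta_sym Y r.
Proof.
apply: functional_extensionality_dep => N; apply/funext => m; apply/funext => delta; apply/setP => s.
by rewrite !finset.inE microstates_ae.
Qed.

Lemma Delta_sym_at_ae xi : Delta_sym_at X xi = Delta_sym_at Y xi.
Proof.
apply: functional_extensionality_dep => N; apply/funext => m; apply/funext => delta; apply/setP => s.
by rewrite !finset.inE microstates_ae.
Qed.

Lemma joint_density_ae : is_joint_density X = is_joint_density Y.
Proof.
apply/funext => p; apply/propext; suff H E : measurable E ->
    P (joint X @^-1` E) = P (joint Y @^-1` E).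
  by split=> -[mp p0 pE]; split => // E mE; rewrite -pE// H.
move=> mE; have mX : measurable (joint X @^-1` E).
  by rewrite -[X in measurable X]setTI; exact: measurable_joint.
have mY : measurable (joint Y @^-1` E).
  by rewrite -[X in measurable X]setTI; exact: measurable_joint.
have intP (S : set T) : measurable S -> P S = (\int[P]_t (\1_S t)%:E)%E.
  by move=> mS; rewrite integral_indic// setIT.
rewrite !intP//; apply: ae_eq_integral => //.
- by apply/measurable_EFinP; exact: measurable_indic.
- by apply/measurable_EFinP; exact: measurable_indic.
apply: filterS XY_all => t XYt _; rewrite !indicE; congr (_%:R%:E).
have -> : (t \in joint X @^-1` E) = (joint X t \in E) by [].
have -> : (t \in joint Y @^-1` E) = (joint Y t \in E) by [].
suff -> : joint X t = joint Y t by [].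
by apply: eq_from_tnth => i; rewrite !tnth_mktuple.
Qed.

Lemma entropy_ae : entropy X = entropy Y.
Proof. by rewrite /entropy joint_density_ae. Qed.

Lemma approximating_ae i xi : approximating (X i) xi -> approximating (Y i) xi.
Proof.
move=> [nd mom]; split => // k k1; have := mom k k1.
rewrite (@fine_expectation_ae _ (fun t => Y i t ^+ k))//.
- by apply: measurable_funX; exact: measurable_funPT.
- by apply: measurable_funX; exact: measurable_funPT.
- by apply: filterS (XY i) => t ->.
Qed.

End almost_everywhere.

Section clipping.
Context d (T : measurableType d) (R : realType) (P : probability T R)
  (X : {RV P >-> R}) (C : R).

Definition clip_fun (t : T) : R := clip C (X t).

Lemma measurable_clip_fun : measurable_fun [set: T] clip_fun.
Proof.
by apply: measurable_maxr => //; exact: measurable_minr.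
Qed.

HB.instance Definition _ := isMeasurableFun.Build _ _ _ _ clip_fun measurable_clip_fun.

Definition clipRV : {RV P >-> R} := clip_fun.

End clipping.

Local Open Scope ereal_scope.

Theorem theorem1p6 (d : measure_display) (T : measurableType d) (R : realType)
    (P : probability T R) (n : nat) (X : 'I_n -> {RV P >-> R})
    (n_gt0 : (0 < n)%N)
    (X_bounded : forall i : 'I_n, (X i : T -> R) \in Lfun P +oo) :
  (forall r : \bar R, 0 < r ->
     (forall i : 'I_n, 'N[P]_+oo[EFin \o X i] <= r) ->
     entropy X = - Isym_cut X r + \sum_(i < n) entropy1 (X i) /\
     entropy X = - Isym_cut_bar X r + \sum_(i < n) entropy1 (X i)) /\
  (forall xi : 'I_n -> forall N : nat, 'I_N -> R,
     (forall i : 'I_n, approximating (X i) (xi i)) ->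
     entropy X = - Isym_at X xi + \sum_(i < n) entropy1 (X i) /\
     entropy X = - Isym_at_bar X xi + \sum_(i < n) entropy1 (X i)).

Proof.
pose N_ i := fine ('N[P]_+oo[EFin \o X i])%E.
have NE i : ('N[P]_+oo[EFin \o X i] = (N_ i)%:E)%E.
  rewrite fineK// ge0_fin_numE ?Lnorm_ge0//.
  by have /set_mem := sub_Lfun_finLfun (X_bounded i).
have N_ge0 i : (0 <= N_ i)%R by rewrite fine_ge0// Lnorm_ge0.
pose r0 : R := (\big[Num.max/0]_i N_ i)%R.
have r0_ge0 : (0 <= r0)%R by apply: bigmax_ge_id.
have Nr0 i : (N_ i <= r0)%R by exact: le_bigmax.
have aeX i : \forall t \ae P, (`|X i t| <= r0)%R.
  (* The norm ['N[P]_+oo] unfolds to the essential supremum under the condition that the whole space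
     has positive measure, which is 1 here. *)
  have := NE i; rewrite unlock [X in (_ < X)%E](_ : _ = 1%E) ?lte01 => [H|]; last exact: probability_setT.
  have := ess_sup_ge P (abse \o (EFin \o X i)); rewrite H.
  by apply: filterS => t /=; rewrite lee_fin => /le_trans; apply.
(* The bound [r0] on [X i] holds only almost surely; clipping produces versions bounded everywhere,
   and every quantity in the statement is unchanged. *)
pose Y i := clipRV (X i) r0.
have Y_le i t : (`|Y i t| <= r0)%R by exact: clip_le.
have XY i : \forall t \ae P, X i t = Y i t.
  by apply: filterS (aeX i) => t Xt; rewrite /Y /= /clip_fun clip_id.
have -> : entropy X = entropy Y by exact: entropy_ae.
have -> : (\sum_(i < n) entropy1 (X i))%E = (\sum_(i < n) entropy1 (Y i))%E.
  by apply: eq_bigr => i _; apply: entropy_ae => _; exact: XY.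
have sub r : (r0%:E <= r)%E -> forall N m delta,
    Delta_sym Y r N m delta \subset Delta_sym Y +oo%E N m delta.
  move=> rr N m delta; apply/fintype.subsetP => s; rewrite !finset.inE => /asboolP[x nx [h1 h2]].
  by apply/asboolP; exists x => //; split => // i j; exact: leey.
split=> [r r_gt0 Xr|xi Hxi].
  have rr : (r0%:E <= r)%E.
    move: r_gt0 Xr; case: r => [s s0 Xs| |//]; last by move=> *; exact: leey.
    rewrite lee_fin; apply: bigmax_le; first exact: ltW.
    by move=> i _; rewrite -lee_fin -NE.
  rewrite /Isym_cut /Isym_cut_bar (Delta_sym_ae XY).
  apply: (entropy_identity r0_ge0 Y_le (sub r rr)) => _ K m delta.
  exact: (rate_lower_sym r0_ge0 Y_le (lexx _) rr).
have aY i : approximating (Y i) (xi i) := approximating_ae XY (Hxi i).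
rewrite /Isym_at /Isym_at_bar (Delta_sym_at_ae XY).
apply: (entropy_identity (D := Delta_sym_at Y xi) r0_ge0 Y_le) => [N m delta|diffuse K m delta].
  apply/fintype.subsetP => s; rewrite !finset.inE => /asboolP[h1 h2]; apply/asboolP.
  by exists (fun i => xi i N) => // i; have [] := aY i.
exact: (rate_lower_at r0_ge0 Y_le (lexx _) diffuse aY).
Qed.
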